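(* Let $y=X\beta+\varepsilon$ with $X\in\mathbb{R}^{n\times p}$ deterministic, $\beta\in\mathbb{R}^p$, $\varepsilon\sim N(0,\sigma^2I_n)$, and let $\mu=X\beta$, $\Sigma=X'X/n$. Let $\lambda>0$ be fixed, $\widehat\beta=\arg\min_b\{(2n)^{-1}\|y-Xb\|^2+\sum_{j=1}^p\rho(|b_j|;\lambda)\}$ and $\widehat\mu=X\widehat\beta$. Suppose $\kappa(\rho;\lambda)<c_{\min}(\Sigma)$, the smallest eigenvalue of $\Sigma$. Let $\widetilde\mu$ be the orthogonal projection of $y$ onto the linear span of the columns of $X$. Define the degrees of freedom $$\mathrm{df}(\widehat\mu)=\sum_{i=1}^n\mathrm{Cov}(\widetilde\mu_i,\widehat\mu_i)/\sigma^2,$$ the estimator $\widehat{\mathrm{df}}=\mathrm{trace}\big(Q^{-1}(\widehat\beta;\lambda)\widehat P\Sigma\widehat P'\big)$, and $$\widehat C_p=\|\widetilde\mu-\widehat\mu\|^2+\widehat\sigma^2\{2\widehat{\mathrm{df}}-\mathrm{rank}(X)\},$$ where $\widehat\sigma^2=\sigma^2$ in the case of known $\sigma^2$, or $\widehat\sigma^2=\|y-\widetilde\mu\|^2/(n-p)$ in the case of $p<n$. Then $$E(\widehat{\mathrm{df}})=\mathrm{df}(\widehat\mu),\qquad E\widehat C_p=E\|\widehat\mu-\mu\|^2.$$ Furthermore, if either $\rho(t;\lambda)=\lambda t$ (the LASSO), or $\rho$ satisfies $\dot\rho(t;\lambda)=0$ for all $t\ge\gamma\lambda$ and $\dot\rho(0+;\lambda)=\lambda$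 and $|\widehat\beta_j|>\gamma\lambda$ for all $j$ with $\widehat\beta_j\ne0$, then $$\widehat{\mathrm{df}}=\#\{j:\widehat\beta_j\ne0\}.$$
   Context: Penalty: $\rho(\cdot;\lambda)$ is nondecreasing on $[0,\infty)$ with continuous derivative $\dot\rho(t;\lambda)=\partial\rho(t;\lambda)/\partial t$ on $(0,\infty)$, $\dot\rho(0+;\lambda)>0$, normalized so that $\dot\rho(0+;\lambda)=\lambda$ whenever finite, and is almost twice differentiable: there is a function $\ddot\rho(\cdot;\lambda)$ with $\dot\rho(t;\lambda)=\dot\rho(1;\lambda)+\int_1^t\ddot\rho(x;\lambda)\,dx$ for all $t>0$ (with $\ddot\rho=0$ where $\dot\rho$ is locally constant). Maximum concavity: $\kappa(\rho;\lambda)=\sup_{0<t_1<t_2}\{\dot\rho(t_1;\lambda)-\dot\rho(t_2;\lambda)\}/(t_2-t_1)$. $Q(\beta;\lambda)=\Sigma_{\{j:\beta_j\ne0\}}+\mathrm{diag}(\ddot\rho(|\beta_j|;\lambda),\beta_j\ne0)$, where $\Sigma_A$ is the $A\times A$ submatrix of $\Sigma$. $\widehat P$ is the matrix with $\widehat Pb=(b_j:\widehat\beta_j\ne0)'$. Quantities over an empty index set are zero.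
   Formalization: The penalty ρ is additionally assumed continuous at 0 (a jump there makes the df identity false), and the C_p identity with estimated variance assumes rank(X)=p, which is automatic unless κ<0 and without which σ̂² is biased. *)

(* Defs.v *)
From mathcomp Require Export all_boot all_order all_algebra.
From mathcomp Require Export all_classical all_reals all_analysis.

Set Implicit Arguments.
Unset Strict Implicit.
Unset Printing Implicit Defensive.

Import Order.TTheory GRing.Theory Num.Theory.
Import numFieldNormedType.Exports.

Local Open Scope classical_set_scope.
Local Open Scope ring_scope.

Section LinearAlgebra.
Context {R : realType}.

(* The library norm `|v| on matrices is the sup norm, so the squared Euclidean
   norm is written out. *)
Definition sqnorm (n : nat) (v : 'cV[R]_n) : R := \sum_(i < n) v i 0 ^+ 2.

Definition gram (n p : nat) (X : 'M[R]_(n, p)) : 'M[R]_p :=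
  n%:R^-1 *: (X^T *m X).

(* Meaningful for a symmetric matrix of size p > 0: the infimum is then that of
   a finite nonempty set. *)
Definition c_min (p : nat) (A : 'M[R]_p) : R := inf [set a | eigenvalue A a].

(* m is the orthogonal projection of v onto the span of the columns of X. *)
Definition is_orth_proj (n p : nat) (X : 'M[R]_(n, p)) (v m : 'cV[R]_n) : Prop :=
  (exists b : 'cV[R]_p, m = X *m b) /\
  (forall b : 'cV[R]_p, \sum_(i < n) (v - m) i 0 * (X *m b) i 0 = 0).

End LinearAlgebra.

Section Penalty.
Context {R : realType}.

(* The integral from a to b, with the sign convention for b < a. *)
Definition oriented_integral (f : R -> R) (a b : R) : R :=
  if a <= b then \int[lebesgue_measure]_(x in `[a, b]) f x
  else - \int[lebesgue_measure]_(x in `[b, a]) f x.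

(* rho is the penalty at the fixed level lambda; only its values on [0, +oo[
   matter.  Its derivative on ]0, +oo[ is derive1 rho, and ddrho is the chosen
   second derivative. *)
Record penalty (rho ddrho : R -> R) (lambda : R) : Prop := {
  penalty_nondecreasing : forall s t : R, 0 <= s -> s <= t -> rho s <= rho t;
  (* Without continuity at 0 the term rho(|b|) could contain an l0 penalty,
     which the maximum concavity below does not see. *)
  penalty_continuous0 : rho t @[t --> 0^'+] --> rho 0;
  penalty_derivable : forall t : R, 0 < t -> derivable rho t 1;
  penalty_continuous_derive : forall t : R, 0 < t ->
    {for t, continuous (derive1 rho)};
  (* The limit at 0+ may a priori be +oo. *)
  penalty_derive0 : exists l : \bar R,
    [/\ (derive1 rho t)%:E @[t --> 0^'+] --> l, (0 < l)%E
      & l \is a fin_num -> l = lambda%:E];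
  penalty_integrable : forall a b : R, 0 < a ->
    lebesgue_measure.-integrable `[a, b] (EFin \o ddrho);
  penalty_ddrho : forall t : R, 0 < t ->
    derive1 rho t = derive1 rho 1 + oriented_integral ddrho 1 t;
  penalty_ddrho_flat : forall t : R, 0 < t ->
    (\forall u \near t, derive1 rho u = derive1 rho t) -> ddrho t = 0
}.

Definition max_concavity (rho : R -> R) : \bar R :=
  ereal_sup [set z | exists t1 t2 : R, [/\ 0 < t1, t1 < t2
    & z = ((derive1 rho t1 - derive1 rho t2) / (t2 - t1))%:E]].

Definition penalized_loss (n p : nat) (X : 'M[R]_(n, p)) (rho : R -> R)
    (v : 'cV[R]_n) (b : 'cV[R]_p) : R :=
  (2 * n%:R)^-1 * sqnorm (v - X *m b) + \sum_(j < p) rho `|b j 0|.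

Definition is_argmin (T : Type) (f : T -> R) (b : T) : Prop :=
  forall b', f b <= f b'.

End Penalty.

Section DegreesOfFreedomEstimator.
Context {R : realType} {p : nat}.

Definition supp (b : 'cV[R]_p) : {set 'I_p} := [set j | b j 0 != 0].

(* Coordinates in the support are numbered by enum_val : 'I_#|supp b| -> 'I_p. *)
Definition supp_idx (b : 'cV[R]_p) (k : 'I_#|supp b|) : 'I_p := enum_val k.

Definition Qmx (Sigma : 'M[R]_p) (ddrho : R -> R) (b : 'cV[R]_p) :
    'M[R]_#|supp b| :=
  mxsub (@supp_idx b) (@supp_idx b) Sigma +
  diag_mx (\row_k ddrho `|b (supp_idx k) 0|).

Definition Pmx (b : 'cV[R]_p) : 'M[R]_(#|supp b|, p) :=
  rowsub (@supp_idx b) 1%:M.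

Definition df_hat (Sigma : 'M[R]_p) (ddrho : R -> R) (b : 'cV[R]_p) : R :=
  \tr (invmx (Qmx Sigma ddrho b) *m Pmx b *m Sigma *m (Pmx b)^T).

End DegreesOfFreedomEstimator.

Section Probability.
Context {R : realType} {d : measure_display} {Omega : measurableType d}
  (P : probability Omega R).

Definition mutual_independence (I : finType) (Z : I -> {RV P >-> R}) : Prop :=
  forall (J : {set I}) (B : I -> set R), (forall i, measurable (B i)) ->
  P (\bigcap_(i in [set` J]) (Z i @^-1` B i)) =
  (\prod_(i in J) P (Z i @^-1` B i))%E.

(* The vector (eps i)_i has law N(0, sigma^2 I_n). *)
Definition gaussian_noise (n : nat) (sigma : R) (eps : 'I_n -> {RV P >-> R}) :
    Prop :=
  mutual_independence eps /\
  forall (i : 'I_n) (B : set R), measurable B ->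
    distribution P (eps i) B = normal_prob 0 sigma B.

Definition degrees_of_freedom (n : nat) (sigma : R)
    (mutilde muhat : Omega -> 'cV[R]_n) : \bar R :=
  ((\sum_(i < n) covariance P (fun w => (mutilde w) i ord0)
                              (fun w => (muhat w) i ord0))
   * ((sigma ^+ 2)^-1)%:E)%E.

Definition Cp_hat (n p : nat) (X : 'M[R]_(n, p))
    (mutilde muhat : Omega -> 'cV[R]_n) (dfhat sigma2hat : Omega -> R)
    (w : Omega) : R :=
  sqnorm (mutilde w - muhat w) +
  sigma2hat w * (2 * dfhat w - (\rank X)%:R).

End Probability.

(* Main.v *)
(** Since [max_concavity rho < c_min], the penalized loss is strictly convex, so
    its minimizer [h v] exists, is unique and is Lipschitz in the data [v].  Almost
    surely the coordinates of [h] and of [|h|] are derivable along each axis at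
    the data (a Lipschitz function on a line is almost everywhere derivable, and
    Gaussian null sets are those that are null along all parallel lines).  An
    inactive coordinate then has derivative [0], because [|h_k|] is derivable at
    a minimum.  Along the line directed by the [k]-th column of [X], the
    stationarity equation makes the [k]-th coordinate hit the null set where
    [ddrho] is not the derivative of [derive1 rho] with probability zero, so the
    stationarity equations of the active coordinates can be differentiated.  The
    resulting linear system has matrix [Q], which is positive definite, and the
    divergence of [y |-> X h(y)] is the trace [df_hat].  Stein's identity, obtained
    by differentiating the Cameron-Martin formula, turns the expected divergence
    into the covariance, and [C_p] follows by expanding the squares; for the
    estimated variance one uses that the divergence does not change along the
    orthogonal complement of the column span. *)

Require Import Defs.
From HB Require Import structures.
From mathcomp Require Import ring lra zify measurable_realfun.

Set Implicit Arguments.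
Unset Strict Implicit.
Unset Printing Implicit Defensive.

Import Order.TTheory GRing.Theory Num.Theory.
Import numFieldNormedType.Exports.
Local Open Scope classical_set_scope.
Local Open Scope ring_scope.

(** * Almost everywhere derivability of Lipschitz functions *)

(** Only difference quotients along single directions are used, so a total derivative of the
    minimizer is never formed. Two obstacles shape the argument. [ddrho] is the derivative of
    [derive1 rho] only off a null set [N], and a Lipschitz coordinate may well send a set of
    positive measure into [N]. A reverse estimate excludes this: moving the data by [s] along the
    [k]-th column amounts to translating the [k]-th coordinate in the quadratic part alone, so [s]
    is bounded by the increments of that coordinate and of its score. As long as the coordinate
    keeps one sign, its score is [derive1 rho] up to sign, whose increment is an integral of
    [ddrho]; hence preimages of null sets are null. The other obstacle is that [max_concavity rho]
    may be negative, and then [X] may be rank deficient or have zero columns. The bound [K]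
    extracted from it is therefore a real number of any sign, the projector is built from a basis of
    the column span, and the coordinate of a zero column is shown to vanish identically. *)

Lemma lipschitz_continuous {R : realType} (f : R -> R) (L : R) :
  (forall s t, `|f s - f t| <= L * `|s - t|) -> continuous f.
Proof.
move=> fL x; apply/cvgrPdist_lt => e e0.
near=> t; apply: (le_lt_trans (fL x t)).
apply: (@le_lt_trans _ _ ((`|L| + 1) * `|x - t|)).
  by rewrite ler_wpM2r// (le_trans (ler_norm L))// lerDl.
rewrite -ltr_pdivlMl ?ltr_wpDl//.
near: t; apply: cvgr_dist_lt; first exact: cvg_id.
by rewrite mulr_gt0// invr_gt0 ltr_wpDl.
Unshelve. all: by end_near. Qed.

Lemma lebesgue_stieltjes_measure_oc {R : realType} (F : cumulative R R) (a b : R) :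
  a <= b -> lebesgue_stieltjes_measure F `]a, b]%classic = (F b - F a)%:E.
Proof.
move=> ab; rewrite /lebesgue_stieltjes_measure /= /measure_extension.
rewrite measurable_mu_extE/= ?wlength_itv_bnd//; exact: is_ocitv.
Qed.

(** The Stieltjes measures of [F] and [G] add up to [L] times Lebesgue measure, by uniqueness on
    half-open intervals, and that of [G] is nonnegative. *)
Lemma lebesgue_stieltjes_measure_le {R : realType} (F G : cumulative R R) (L : R) :
  0 <= L -> (forall s, F s + G s = L * s) -> forall A : set R, measurable A ->
  (lebesgue_stieltjes_measure F A <= L%:E * lebesgue_measure A)%E.
Proof.
move=> L0 FG A mA.
have ndl : {homo ( *%R L) : s t / s <= t} by move=> s t; exact: ler_wpM2l.
pose il := isCumulative.Build R _ R _ ndl (right_continuousW (@mulrl_continuous R L)).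
pose Cl : cumulative R R := HB.pack ( *%R L) il.
have HL B : measurable B -> lebesgue_stieltjes_measure Cl B = (L%:E * lebesgue_measure B)%E.
  move=> mB.
  apply: (@lebesgue_stieltjes_measure_unique _ Cl (mscale (NngNum L0) lebesgue_measure)) => //.
  move=> X /ocitvP [->|[[a b] /= ab ->]]; first by rewrite !measure0.
  rewrite lebesgue_stieltjes_measure_oc ?ltW// /mscale/= lebesgue_measure_itv/=.
  by rewrite lte_fin ab -EFinB -EFinM mulrBr.
rewrite -HL//.
suff -> : lebesgue_stieltjes_measure Cl A =
    (lebesgue_stieltjes_measure F A + lebesgue_stieltjes_measure G A)%E.
  by rewrite leeDl.
rewrite -measure_addE; apply: lebesgue_stieltjes_measure_unique => //.
move=> X /ocitvP [->|[[a b] /= ab ->]]; first by rewrite !measure0.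
rewrite -[RHS]/(measure_add (lebesgue_stieltjes_measure F) (lebesgue_stieltjes_measure G) _).
rewrite measure_addE (lebesgue_stieltjes_measure_oc Cl (ltW ab)).
apply: (etrans (y := ((F b - F a)%:E + (G b - G a)%:E)%E)).
  by rewrite /= -EFinD -!FG opprD addrACA.
by congr (_ + _)%E; apply/esym/lebesgue_stieltjes_measure_oc/ltW.
Qed.
(** The Stieltjes measure of [g] is dominated by Lebesgue measure, so on bounded intervals [g] is,
    up to a constant, the primitive of a Radon-Nikodym density; the fundamental theorem of calculus
    makes such a primitive derivable almost everywhere. *)
Lemma nondecreasing_lipschitz_ae_derivable {R : realType} (g : R -> R) (L : R) :
  {homo g : s t / s <= t} -> (forall s t, `|g s - g t| <= L * `|s - t|) ->
  {ae (@lebesgue_measure R), forall s, derivable g s 1}.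
Proof.
move=> ndg gL.
have L0 : 0 <= L.
  by have := gL 1 0; rewrite subr0 normr1 mulr1; apply: le_trans.
have cg := lipschitz_continuous gL.
(* The Lipschitz bound makes this complement nondecreasing as well, so that it has a Stieltjes
   measure of its own. *)
pose h s := L * s - g s.
have ndh : {homo h : s t / s <= t}.
  move=> s t st; have : g t - g s <= L * (t - s).
    by rewrite (le_trans (ler_norm _))// (le_trans (gL _ _))// ger0_norm ?subr_ge0.
  by rewrite /h; lra.
have ch : continuous h.
  move=> x; apply: (@cvgB _ R^o); last exact: cg.
  by apply: cvgMl_tmp; exact: cvg_id.
pose ig := isCumulative.Build R _ R g ndg (right_continuousW cg).
pose Cg : cumulative R R := HB.pack g ig.
pose ih := isCumulative.Build R _ R h ndh (right_continuousW ch).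
pose Ch : cumulative R R := HB.pack h ih.
pose mg : {measure set (measurableTypeR R) -> \bar R} := lebesgue_stieltjes_measure Cg.
have FG s : Cg s + Ch s = L * s by rewrite /= /h addrC subrK.
have mgle := lebesgue_stieltjes_measure_le L0 FG.
have key (K : R) : 0 < K -> {ae (@lebesgue_measure R), forall s, `]-K, K[%classic s -> derivable g s 1}.
  move=> K0; pose D : set (measurableTypeR R) := `]-K, K]%classic.
  have mD : measurable D by exact: measurable_itv.
  have mgD : (mg D < +oo)%E.
    apply: (le_lt_trans (mgle _ mD)).
    by rewrite lebesgue_measure_itv/= lte_fin gtrN// -EFinB -EFinM ltry.
  pose nu : {finite_measure set (measurableTypeR R) -> \bar R} := mfrestr mD mgD.
  have dom : charge_of_finite_measure nu `<< (@lebesgue_measure R).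
    apply/null_content_dominatesP => A mA A0.
    apply/eqP; rewrite eq_le measure_ge0 andbT.
    rewrite /charge_of_finite_measure /= /mfrestr /mrestr.
    apply: le_trans (mgle _ _) _; first exact: measurableI.
    have : (lebesgue_measure (A `&` D) <= lebesgue_measure A)%E.
      by apply: le_measure; rewrite ?inE//; exact: measurableI.
    rewrite A0 => A0'. 
    by rewrite -(mule0 L%:E) lee_wpmul2l.
  pose phi := Radon_Nikodym (charge_of_finite_measure nu) (@lebesgue_measure R).
  have iphi : (@lebesgue_measure R).-integrable setT (EFin \o (fine \o phi)).
    have := Radon_Nikodym_integrable dom; apply: eq_integrable => // x _ /=.
    by rewrite fineK// Radon_Nikodym_fin_num.
  have lphi : locally_integrable setT (fine \o phi).
    by apply: open_integrable_locally => //; exact: openT.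
  have ii y : (@lebesgue_measure R).-integrable [set` Interval (BRight (-K)) (BRight y)] (EFin \o (fine \o phi)).
    by apply: integrableS iphi => //; exact: measurable_itv.
  have := @FTC1 R (fine \o phi) (BRight (-K)) ii lphi.
  apply: filterS; first exact: (ae_filter_ringOfSetsType (@lebesgue_measure R)).
  move=> s + sK; have [s1 s2] : -K < s /\ s < K by move: sK; rewrite /= in_itv/= => /andP.
  have sK' : (BRight (-K) < BRight s)%O by rewrite bnd_simp.
  move=> /(_ sK')[+ _].
  
  have E : \forall y \near s, (\int[lebesgue_measure]_(t in [set` Interval (BRight (- K)) (BRight y)]) (fine \o phi) t)%R = g y - g (-K).
    near=> y.
    have y1 : -K < y by near: y; exact: lt_nbhsr.
    have y2 : y < K by near: y; exact: lt_nbhsl.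
    rewrite /Rintegral.
    have -> : (\int[lebesgue_measure]_(t in [set` Interval (BRight (- K)%R) (BRight y)]) ((fine \o phi) t)%:E)%E = nu `]-K, y]%classic.
      rewrite -[RHS]/(charge_of_finite_measure nu _) (Radon_Nikodym_integral dom)//.
      by apply: eq_integral => t _; rewrite /= fineK// Radon_Nikodym_fin_num.
    rewrite /nu /= /mfrestr /mrestr.
    rewrite setIidl; last by apply: subset_itvl; rewrite bnd_simp ltW.
    by rewrite /mg lebesgue_stieltjes_measure_oc// ltW.
  move=> dF.
  have : derivable (fun y => (g y - g (-K)) + g (-K)) s 1.
    apply: derivableD; last exact: derivable_cst.
    move: dF; apply: near_eq_derivable => //.
  by under eq_fun do rewrite subrK.
have : forall n : nat, {ae (@lebesgue_measure R), forall s, `]-(n.+1%:R), n.+1%:R[%classic s -> derivable g s 1}.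
  by move=> n; exact: key.
move=> /ae_foralln; apply: filterS => /= s /(_ (Num.bound `|s : R|)); apply.
have b : `|s : R| < (Num.bound `|s : R|).+1%:R.
  by apply: (lt_trans (archi_boundP _)) => //; rewrite ltr_nat.
by rewrite /= in_itv /= -ltr_norml.
Unshelve. all: by end_near.
Qed.

(** Adding the linear function of slope [L] makes [f] nondecreasing. *)
Lemma lipschitz_ae_derivable {R : realType} (f : R -> R) (L : R) :
  (forall s t, `|f s - f t| <= L * `|s - t|) ->
  {ae (@lebesgue_measure R), forall s, derivable f s 1}.
Proof.
move=> fL; pose g s := f s + L * s.
have gL s t : `|g s - g t| <= (L + `|L|) * `|s - t|.
  rewrite /g opprD addrACA -mulrBr (le_trans (ler_normD _ _))// normrM mulrDl.
  by rewrite lerD.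
have ndg : {homo g : s t / s <= t}.
  move=> s t st; have := fL s t; rewrite distrC (distrC s) (ger0_norm (_ : 0 <= t - s)) ?subr_ge0// ler_norml /g.
  by move=> /andP[]; lra.
have := nondecreasing_lipschitz_ae_derivable ndg gL.
apply: filterS; first exact: (ae_filter_ringOfSetsType (@lebesgue_measure R)).
move=> s dg.
rewrite (_ : f = fun s => g s - L * s); last by apply/funext => t; rewrite /g addrK.
exact: derivableB.
Qed.

Lemma Rintegral_itvcD {R : realType} (f : R -> R) (a b c : R) :
  a <= b -> b <= c -> (@lebesgue_measure R).-integrable `[a, c] (EFin \o f) ->
  \int[lebesgue_measure]_(x in `[a, c]) f x =
  \int[lebesgue_measure]_(x in `[a, b]) f x + \int[lebesgue_measure]_(x in `[b, c]) f x.
Proof.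
move=> ab bc fi.
have := @Rintegral_itvB R f (BLeft a) (BRight c) b fi.
rewrite !bnd_simp => /(_ ab bc) /eqP; rewrite subr_eq => /eqP ->.
rewrite addrC; congr (_ + _); apply: Rintegral_itv_obnd_cbnd.
apply: integrableS fi => //; apply: subset_itv; rewrite bnd_simp//.
Qed.

(** * The second derivative of the penalty *)

Section PenaltyDerivative.
Context {R : realType} (rho ddrho : R -> R) (lambda : R).
Hypothesis hrho : penalty rho ddrho lambda.

Lemma penalty_increment (a b : R) : 0 < a -> a <= b ->
  derive1 rho b - derive1 rho a = \int[lebesgue_measure]_(x in `[a, b]) ddrho x.
Proof.
move=> a0 ab; have b0 := lt_le_trans a0 ab.
have fi c d : 0 < c -> (@lebesgue_measure R).-integrable `[c, d] (EFin \o ddrho).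
  by move=> c0; exact: (penalty_integrable hrho).
rewrite (penalty_ddrho hrho b0) (penalty_ddrho hrho a0) /oriented_integral.
case: (leP 1 a) => a1.
  rewrite (le_trans a1 ab) (Rintegral_itvcD a1 ab) ?fi//; ring.
case: (leP 1 b) => b1.
  rewrite [RHS](Rintegral_itvcD (ltW a1) b1) ?fi//; ring.
rewrite (Rintegral_itvcD ab (ltW b1)) ?fi//; ring.
Qed.

(** The fundamental theorem of calculus is applied to [ddrho] cut off to the intervals from 1/(n+1)
    to n+1, where it is integrable; they exhaust the open half-line. The exceptional points are
    gathered in one measurable null set because its preimage under the coordinates of the minimizer
    has to be controlled later. *)
Lemma penalty_ae_derivable : exists N : set R, [/\ measurable N,
  (lebesgue_measure N = 0)%E & forall t, 0 < t -> ~ N t ->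
    derivable (derive1 rho) t 1 /\ derive1 (derive1 rho) t = ddrho t].
Proof.
suff [N [mN N0 HN]] : {ae (@lebesgue_measure R), forall t, 0 < t ->
    derivable (derive1 rho) t 1 /\ derive1 (derive1 rho) t = ddrho t}.
  exists N; split => // t t0 Nt; apply: contrapT => H; apply: Nt; apply: HN.
  by move=> /= H'; apply: H; exact: H'.
suff : forall n : nat, {ae (@lebesgue_measure R), forall t, n.+1%:R^-1 < t < n.+1%:R ->
    derivable (derive1 rho) t 1 /\ derive1 (derive1 rho) t = ddrho t}.
  move=> /ae_foralln; apply: filterS => /= t H t0.
  pose n := (Num.bound (t : R) + Num.bound (t^-1 : R))%N; apply: (H n).
  have t1 : t < n.+1%:R.
    apply: (lt_le_trans (archi_boundP (ltW t0))).
    by rewrite ler_nat /n; lia.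
  have t2 : t^-1 < n.+1%:R.
    apply: (@lt_le_trans _ _ (Num.bound (t^-1 : R))%:R).
      by apply: archi_boundP; rewrite invr_ge0 ltW.
    by rewrite ler_nat /n; lia.
  by rewrite t1 andbT invf_plt// posrE.
move=> n; pose a : R := n.+1%:R^-1; pose b : R := n.+1%:R.
have a0 : 0 < a by rewrite invr_gt0.
pose f := ddrho \_ `[a, b].
have fi : (@lebesgue_measure R).-integrable setT (EFin \o f).
  have := penalty_integrable hrho b a0.
  move/integrable_mkcond => /(_ (measurable_itv _)) H.
  apply: eq_integrable H => // x _; rewrite /= /f !patchE; by case: ifP.
have lf : locally_integrable setT f.
  by apply: open_integrable_locally => //; exact: openT.
have ii y : (@lebesgue_measure R).-integrable [set` Interval (BLeft a) (BRight y)] (EFin \o f).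
  by apply: integrableS fi => //; exact: measurable_itv.
have := @FTC1 R f (BLeft a) ii lf.
apply: filterS; first exact: (ae_filter_ringOfSetsType (@lebesgue_measure R)).
move=> t H /andP[at_ tb].
have at' : (a%:E < (t : R)%:E)%E by rewrite lte_fin.
move: H => /(_ at')[dF F't].
have E : \forall y \near (t : R), (\int[lebesgue_measure]_(x in [set` Interval (BLeft a) (BRight y)]) f x)%R + derive1 rho a = derive1 rho y.
  near=> y.
  have y1 : a < y by near: y; exact: lt_nbhsr.
  have y2 : y < b by near: y; exact: lt_nbhsl.
  rewrite (_ : \int[lebesgue_measure]_(x in _) f x = \int[lebesgue_measure]_(x in `[a, y]) ddrho x).
    by rewrite -(penalty_increment a0 (ltW y1)) subrK.
  apply: eq_Rintegral => x; rewrite inE /= in_itv /= => /andP[ax xy].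
  by rewrite /f patchE mem_set//= in_itv /= ax (le_trans xy (ltW y2)).
split.
  move: (derivableD dF (derivable_cst (derive1 rho a) t 1)).
  by apply: near_eq_derivable.
rewrite (_ : derive1 (derive1 rho) t = derive1 (fun y => (\int[lebesgue_measure]_(x in `[a, y]) f x)%R + derive1 rho a) t); last first.
  by rewrite [LHS]derive1E [RHS]derive1E; apply/esym; apply: near_eq_derive; exact: E.
rewrite derive1E deriveD; [|exact: dF|exact: derivable_cst].
rewrite derive_cst addr0 -derive1E F't /f patchE mem_set//= in_itv /=.
by rewrite (ltW at_) (ltW tb).
Unshelve. all: by end_near.
Qed.

End PenaltyDerivative.

(* The density [w] bounds the Lebesgue measure of the preimage of an interval;
   the null set [N] is covered by disjoint intervals of small total [w]-mass. *)
Lemma null_preimage {R : realType} (b w : R -> R) (N : set R) (A M : R) :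
  continuous b -> measurable N -> (lebesgue_measure N = 0)%E ->
  (@lebesgue_measure R).-integrable `]A, M[ (EFin \o w) ->
  (forall s s', A < b s -> b s <= b s' -> b s' < M ->
    (`|s - s'|%:E <= \int[lebesgue_measure]_(x in `[b s, b s']) `|w x|%:E)%E) ->
  (lebesgue_measure (b @^-1` (N `&` `]A, M[)) = 0)%E.
Proof.
move=> cb mN N0 wi Hb.
have mb : measurable_fun setT b by exact: measurable_realfun.continuous_measurable_fun.
have mpre (B : set R) : measurable B -> measurable (b @^-1` B).
  by move=> mB; rewrite -[X in measurable X]setTI; exact: mb.
pose f := w \_ `]A, M[.
have fi : (@lebesgue_measure R).-integrable setT (EFin \o f).
  move/integrable_mkcond : wi => /(_ (measurable_itv _)) H.
  by apply: eq_integrable H => // x _; rewrite /= /f !patchE; case: ifP.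
have mf : measurable_fun setT (fun x => `|f x|%:E).
  apply/measurable_EFinP/measurableT_comp => //; apply/measurable_EFinP.
  by move/integrableP : fi => [].
(* Points whose images lie in [I] are at distance at most the mass of [I], so the preimage fits in a
   segment of that radius about any of its points; hence the factor 2. *)
have small (I : set R) : is_interval I -> measurable I -> I `<=` `]A, M[%classic ->
    (lebesgue_measure (b @^-1` I) <= 2%:E * \int[lebesgue_measure]_(x in I) `|f x|%:E)%E.
  move=> iI mI IAM.
  have [->|/set0P[s0 /= Is0]] := eqVneq (b @^-1` I) set0.
    by rewrite measure0 mule_ge0// integral_ge0.
  set m := (\int[lebesgue_measure]_(x in I) `|f x|%:E)%E.
  have mfin : m \is a fin_num.
    rewrite ge0_fin_numE ?integral_ge0//.
    have /integrableP[_] : (@lebesgue_measure R).-integrable I (EFin \o f).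
      exact: integrableS fi.
    by [].
  have H s : I (b s) -> `|s - s0| <= fine m.
    move=> Is; rewrite -lee_fin fineK//.
    have bnd s1 s2 : I (b s1) -> I (b s2) -> b s1 <= b s2 -> (`|s1 - s2|%:E <= m)%E.
      move=> I1 I2 b12.
      have /= := IAM _ I1; rewrite in_itv/= => /andP[A1 _].
      have /= := IAM _ I2; rewrite in_itv/= => /andP[_ A2].
      apply: (le_trans (Hb _ _ A1 b12 A2)).
      have sub : `[b s1, b s2]%classic `<=` I.
        by move=> z /=; rewrite in_itv /=; exact: iI.
      have -> : (\int[lebesgue_measure]_(x in `[b s1, b s2]) `|w x|%:E =
          \int[lebesgue_measure]_(x in `[b s1, b s2]) `|f x|%:E)%E.
        apply: eq_integral => x /set_mem /sub /IAM xAM.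
        by rewrite /f patchE mem_set.
      apply: ge0_subset_integral => //.
      exact: measurable_funTS.
    by case: (leP (b s) (b s0)) => [|/ltW] h; [|rewrite distrC]; exact: bnd.
  apply: (@le_trans _ _ (lebesgue_measure `[s0 - fine m, s0 + fine m]%classic)).
    apply: le_measure; rewrite ?inE//; first exact: mpre.
    by move=> s /H; rewrite ler_distlC /= in_itv/=; lra.
  rewrite lebesgue_measure_itv/= lte_fin; case: ifPn => _.
    rewrite -EFinB -[in leRHS](fineK mfin) -EFinM lee_fin; lra.
  by rewrite mule_ge0// integral_ge0.
apply/eqP; rewrite eq_le measure_ge0 andbT.
apply/lee_addgt0Pr => e e0; rewrite add0e.
(* Absolute continuity of the integral: a set of measure below [d] has mass below [e / 2], the half
   absorbing the factor 2 above. Outer regularity then encloses the null set in an open set that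
   small. *)
have [d [d0 Hd]] := integral_normr_continuous fi (divr_gt0 e0 (ltr0n _ 2)).
have mN' : measurable (N `&` `]A, M[) by exact: measurableI.
have N'0 : lebesgue_measure (N `&` `]A, M[) = 0%E.
  by apply: subset_measure0 N0 => //; exact: subIsetl.
have N'oo : (lebesgue_measure (N `&` `]A, M[) < +oo)%E by rewrite N'0.
have [U [oU NU Ud]] := lebesgue_regularity_outer mN' N'oo d0.
pose V := U `&` `]A, M[%classic.
have oV : open V by apply: openI => //; exact: interval_open.
have mV : measurable V by exact: open_measurable.
have Vd : (lebesgue_measure V < d%:E)%E.
  apply: le_lt_trans Ud; rewrite (@measureDI _ _ _ lebesgue_measure V (N `&` `]A, M[))//.
  rewrite (@subset_measure0 _ _ _ lebesgue_measure (V `&` (N `&` `]A, M[)) (N `&` `]A, M[))//.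
  - rewrite adde0; apply: le_measure; rewrite ?inE//.
    + exact: measurableD.
    + by apply: measurableD => //; exact: open_measurable.
    + by apply: setSD; exact: subIsetl.
  - exact: measurableI.
have mI k : measurable (open_disjoint_itv oV k).
  by apply: open_measurable; exact: open_disjoint_itv_open.
have VI k : open_disjoint_itv oV k `<=` V.
  by rewrite [X in _ `<=` X](open_disjoint_itv_bigcup oV) => x ?; exists k.
apply: (@le_trans _ _ (\sum_(k <oo) lebesgue_measure (b @^-1` open_disjoint_itv oV k))%E).
  apply: measure_sigma_subadditive.
  - by move=> k; exact: mpre.
  - exact: mpre.
  - rewrite -preimage_bigcup -open_disjoint_itv_bigcup; apply: preimage_subset.
    by move=> x Nx; split; [exact: NU|case: Nx].
apply: (@le_trans _ _ (\sum_(k <oo) (2%:E * \int[lebesgue_measure]_(x in open_disjoint_itv oV k) `|f x|%:E))%E).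
  apply: lee_nneseries => // k _; apply: small => //.
    exact: open_disjoint_itv_is_interval.
  by move=> x /VI [].
rewrite nneseriesZl//; last by move=> k _; exact: integral_ge0.
rewrite -ge0_integral_bigcup//; last 2 first.
- exact: measurable_funTS.
- exact: open_disjoint_itv_trivIset.
rewrite -open_disjoint_itv_bigcup.
have := Hd _ mV Vd; rewrite /Rintegral -lte_fin fineK; last first.
  rewrite ge0_fin_numE ?integral_ge0//.
  by have /integrableP[_] : (@lebesgue_measure R).-integrable V (EFin \o f)
    by exact: integrableS fi.
move=> /ltW H; apply: (@le_trans _ _ (2%:E * (e / 2)%:E)%E).
  by rewrite lee_wpmul2l.
by rewrite -EFinM lee_fin mulrC divfK.
Qed.

(** * Gaussian integration by parts *)

Section Density.
Local Open Scope ereal_scope.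
Context d (T : measurableType d) (R : realType).
Variables (m nu : {measure set T -> \bar R}) (g : T -> R).
Hypotheses (mg : measurable_fun setT g) (g0 : forall x, (0 <= g x)%R).
Hypothesis nuE : forall A, measurable A -> nu A = \int[m]_(x in A) (g x)%:E.

Import HBNNSimple.

Let integral_density_nnsfun (h : {nnsfun T >-> R}) :
  \int[nu]_x (h x)%:E = \int[m]_x (h x * g x)%:E.
Proof.
under [LHS]eq_integral do rewrite fimfunE -fsumEFin//.
rewrite [LHS]ge0_integral_fsum//; last 2 first.
  - by move=> r; exact/measurable_EFinP/measurableT_comp.
  - by move=> n x _; rewrite EFinM nnfun_muleindic_ge0.
under [RHS]eq_integral.
  move=> x _; rewrite EFinM fimfunE -fsumEFin// ge0_mule_fsuml; last first.
    by move=> r; rewrite EFinM nnfun_muleindic_ge0.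
  over.
rewrite [RHS]ge0_integral_fsum//; last 2 first.
  - move=> r; apply: emeasurable_funM; apply/measurable_EFinP => //.
    exact/measurableT_comp.
  - by move=> n x _; rewrite EFinM mule_ge0// ?nnfun_muleindic_ge0// lee_fin.
apply: eq_fsbigr => r _.
rewrite integralZl_indic_nnsfun//= integral_indic// setIT nuE//.
under [RHS]eq_integral do rewrite EFinM -muleA.
have [r0|r0] := ltP r 0%R.
  rewrite preimage_nnfun0// integral_set0 mule0.
  by rewrite integral0_eq// => x _; rewrite indicE in_set0 mul0e mule0.
rewrite [RHS]ge0_integralZl//; last 2 first.
  - by apply: emeasurable_funM; apply/measurable_EFinP => //.
  - by move=> x _; rewrite mule_ge0// lee_fin.
congr (_ * _); rewrite integral_mkcond; apply: eq_integral => x _.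
by rewrite patchE indicE; case: ifP; rewrite ?mul1e ?mul0e.
Qed.

(** The identity holds for simple functions by additivity and passes to [f] by monotone
    convergence. *)
Lemma ge0_integral_density (f : T -> \bar R) :
  measurable_fun setT f -> (forall x, 0 <= f x) ->
  \int[nu]_x f x = \int[m]_x (f x * (g x)%:E).
Proof.
move=> mf f0; pose f_ := nnsfun_approx measurableT mf.
transitivity (limn (fun n => \int[nu]_x (f_ n x)%:E)).
  rewrite -monotone_convergence//=.
  - apply: eq_integral => x _; apply/esym/cvg_lim => //=.
    exact: cvg_nnsfun_approx.
  - by move=> n; apply: measurableT_comp.
  - by move=> n x _; rewrite lee_fin.
  - by move=> x _ a b ab; rewrite lee_fin//; exact/lefP/nd_nnsfun_approx.
transitivity (limn (fun n => \int[m]_x (f_ n x * g x)%:E)).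
  by congr (limn _); apply/funext => n; exact: integral_density_nnsfun.
rewrite -monotone_convergence//=.
- apply: eq_integral => x _; apply/cvg_lim => //=.
  under eq_fun do rewrite EFinM.
  apply: cvgeZr; first by [].
  exact: cvg_nnsfun_approx.
- by move=> n; apply/measurable_EFinP/measurable_funM.
- by move=> n x _; rewrite lee_fin mulr_ge0.
- move=> x _ a b ab; rewrite lee_fin ler_wpM2r//.
  exact/lefP/nd_nnsfun_approx.
Qed.

End Density.

Section AeIntegral.
Local Open Scope ereal_scope.
Context d (T : measurableType d) (R : realType) (mu : {measure set T -> \bar R}).

Import HBNNSimple.

(** The integral of a nonnegative function, measurable or not, is a supremum over the simple
    functions below it. Setting such a function to 0 on [N] keeps its integral and places it below
    [g]. *)
Let le_integral_ae_nng (f g : T -> \bar R) (N : set T) :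
  measurable N -> mu N = 0 ->
  (forall x, 0 <= f x) -> (forall x, 0 <= g x) -> (forall x, ~ N x -> f x <= g x) ->
  \int[mu]_x f x <= \int[mu]_x g x.
Proof.
move=> mN N0 f0 g0 fg.
rewrite !ge0_integralTE//; apply: ge_ereal_sup => _ [h hf <-].
pose h' := proj_nnsfun h (measurableC mN).
have -> : sintegral mu h = sintegral mu h'.
  rewrite -!integralT_nnsfun; apply: ae_eq_integral => //.
  - exact/measurable_EFinP.
  - exact/measurable_EFinP.
  - exists N; split => // x /=; apply: contra_notP => Nx _.
    by rewrite mindicE mem_set// mulr1.
apply: ereal_sup_ubound; exists h' => // x /=; rewrite mindicE.
have [/set_mem Nx|_] := boolP (x \in ~` N); last by rewrite mulr0.
by rewrite mulr1 (le_trans (hf x))// fg.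
Qed.

(** No measurability is assumed, so an expectation of the estimator can be replaced by that of a
    measurable function almost surely equal to it. *)
Lemma integral_ae_eq_any (f g : T -> \bar R) :
  {ae mu, forall x, f x = g x} -> \int[mu]_x f x = \int[mu]_x g x.
Proof.
move=> [N [mN N0 fgN]].
have fg x : ~ N x -> f x = g x by apply: contra_notP => /fgN.
rewrite integralE [RHS]integralE; congr (_ - _); apply/eqP; rewrite eq_le;
  apply/andP; split; apply: (le_integral_ae_nng mN N0) => // x /fg;
  by move=> fgx; rewrite !(funeposE, funenegE) fgx.
Qed.

End AeIntegral.

(** * The product sigma-algebra on matrices *)

Section MatrixMeasurable.
Context {R : realType} {m n : nat}.

Definition mx_box (A : 'I_m -> 'I_n -> set R) : set 'M[R]_(m, n) :=
  [set x | forall i j, A i j (x i j)].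

(** A pi-system generating the sigma-algebra chosen on matrices; finite measures are compared on
    it. *)
Definition mx_boxes : set (set 'M[R]_(m, n)) :=
  [set B | exists2 A, (forall i j, measurable (A i j)) & B = mx_box A].

Lemma mx_boxes_setI : setI_closed mx_boxes.
Proof.
move=> _ _ [A mA ->] [B mB ->]; exists (fun i j => A i j `&` B i j).
  by move=> i j; exact: measurableI.
apply/seteqP; split=> x; first by move=> [Ax Bx] i j; split.
by move=> AB; split=> i j; have [] := AB i j.
Qed.

End MatrixMeasurable.

Definition mx_display : measure_display.
Proof. exact: default_measure_display. Qed.

HB.instance Definition _ (R : realType) (m n : nat) :=
  @isMeasurable.Build mx_display 'M[R]_(m, n) <<s @mx_boxes R m n >>
    (@sigma_algebra0 _ setT (@mx_boxes R m n))
    (fun A => @sigma_algebraC _ (@mx_boxes R m n) A)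
    (fun F => @sigma_algebra_bigcup _ setT (@mx_boxes R m n) F).

Section MatrixMeasurableTheory.
Context {R : realType} {m n : nat}.

Lemma measurable_mx_box (A : 'I_m -> 'I_n -> set R) :
  (forall i j, measurable (A i j)) -> measurable (mx_box A).
Proof. by move=> mA; apply: sub_sigma_algebra; exists A. Qed.

Lemma measurable_coord (i : 'I_m) (j : 'I_n) :
  measurable_fun setT (fun x : 'M[R]_(m, n) => x i j).
Proof.
move=> _ B mB; rewrite setTI.
rewrite (_ : _ @^-1` _ = mx_box (fun k l => if (k == i) && (l == j) then B else setT)).
  by apply: measurable_mx_box => k l; case: ifP.
apply/seteqP; split=> x /=.
  by move=> Bx k l; case: ifP => [/andP[/eqP -> /eqP ->]|].
by move=> /(_ i j); rewrite !eqxx.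
Qed.

Lemma measurable_fun_mxP d (T : measurableType d) (f : T -> 'M[R]_(m, n)) :
  (forall i j, measurable_fun setT (fun t => f t i j)) -> measurable_fun setT f.
Proof.
move=> mf; apply: (measurability (@mx_boxes R m n)) => //.
move=> _ [_ [A mA ->] <-]; rewrite setTI.
rewrite (_ : _ @^-1` _ = \bigcap_(ij in [set: 'I_m * 'I_n])
   ((fun t => f t ij.1 ij.2) @^-1` A ij.1 ij.2)).
  apply: fin_bigcap_measurable; first exact: finite_finset.
  by move=> [i j] _ /=; rewrite -[X in measurable X]setTI; apply: mf.
apply/seteqP; split=> t /=; first by move=> At [i j] _; exact: At.
by move=> At i j; exact: (At (i, j)).
Qed.

(** The norm is the sup norm, so its balls are boxes, and an open set is the countable union of the
    boxes with rational centre and radius 1/(k+1) that it contains. *)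
Lemma open_measurable_mx (U : set 'M[R]_(m, n)) : open U -> measurable U.
Proof.
move=> oU.
pose bx (c : 'M[rat]_(m, n) * nat) : set 'M[R]_(m, n) :=
  mx_box (fun i j => `]ratr (c.1 i j) - c.2.+1%:R^-1, ratr (c.1 i j) + c.2.+1%:R^-1[%classic).
rewrite (_ : U = \bigcup_c (if `[< bx c `<=` U >] then bx c else set0)).
  apply: countable_bigcupT_measurable; first exact: countableP.
  by move=> c; case: asboolP => // _; apply: measurable_mx_box => i j; exact: measurable_itv.
apply/seteqP; split=> x; last first.
  by move=> [c _]; case: asboolP => // cU; exact: cU.
move=> Ux; move: (oU); rewrite openE => /(_ _ Ux) /nbhs_ballP[e /= e0 eU].
pose k := Num.bound (2 / e).
(* Twice the radius has to fit in [e], since [x] and the other points of the box are compared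
   through its rational centre. *)
have ke : k.+1%:R^-1 + k.+1%:R^-1 < e :> R.
  have : 2 / e < k.+1%:R :> R.
    apply: (@lt_le_trans _ _ k%:R); last by rewrite ler_nat.
    by apply: archi_boundP; rewrite divr_ge0// ltW.
  rewrite ltr_pdivrMr// => h.
  by rewrite -mulr2n -[ltLHS]mulr_natl ltr_pdivrMr// mulrC.
have Hq i j : exists q : rat, x i j - k.+1%:R^-1 < ratr q < x i j + k.+1%:R^-1.
  have : x i j - k.+1%:R^-1 < x i j + k.+1%:R^-1.
    by rewrite ltrD2l gtrN// invr_gt0.
  by move=> /rat_in_itvoo[q]; rewrite in_itv/= => ?; exists q.
pose q := \matrix_(i, j) sval (cid (Hq i j)).
have qP i j : x i j - k.+1%:R^-1 < ratr (q i j) < x i j + k.+1%:R^-1.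
  by rewrite mxE; case: cid.
exists (q, k) => //.
have bU : bx (q, k) `<=` U; last first.
  case: asboolP => // _ i j /=.
  have := qP i j; rewrite /= in_itv/= => /andP[h1 h2].
  by apply/andP; split; [rewrite ltrBlDr|rewrite -ltrBlDr].
move=> z bz; apply: eU; split => // i j.
have := bz i j; have := qP i j; rewrite /= in_itv/= => /andP[h1 h2] /andP[h3 h4].
rewrite /ball/=.
move: ke; rewrite ltr_distlC; set c := k.+1%:R^-1 in h1 h2 h3 h4 * => ke.
by apply/andP; split; lra.
Qed.

Lemma continuous_measurable_mx (f : 'M[R]_(m, n) -> R) :
  continuous f -> measurable_fun setT f.
Proof.
move=> /continuousP cf; apply: (measurability _ (RGenOpens.measurableE R)) => //.
move=> _ [_ [a [b ->]] <-]; rewrite setTI; apply: open_measurable_mx.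
by apply: cf; exact: interval_open.
Qed.

End MatrixMeasurableTheory.

Definition mdensity d (T : measurableType d) (R : realType)
    (m : {measure set T -> \bar R}) (g : T -> R)
    (mg : measurable_fun setT g) (g0 : forall x, 0 <= g x) : set T -> \bar R :=
  fun A => (\int[m]_(x in A) (g x)%:E)%E.

Section DensityMeasure.
Local Open Scope ereal_scope.
Context d (T : measurableType d) (R : realType) (m : {measure set T -> \bar R}).
Variables (g : T -> R) (mg : measurable_fun setT g) (g0 : forall x, (0 <= g x)%R).

Let mu := mdensity m mg g0.

Let mu0 : mu set0 = 0.
Proof. by rewrite /mu /mdensity integral_set0. Qed.

Let mu_ge0 A : 0 <= mu A.
Proof. by apply: integral_ge0 => x _; rewrite lee_fin. Qed.

Let mu_sigma_additive : semi_sigma_additive mu.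
Proof.
move=> F mF tF mUF; rewrite /mu /mdensity ge0_integral_bigcup//.
- by apply: is_cvg_ereal_nneg_natsum_cond => n _ _; exact: mu_ge0.
- by apply: measurable_funTS; exact/measurable_EFinP.
- by move=> x _; rewrite lee_fin.
Qed.

HB.instance Definition _ := isMeasure.Build _ _ _ (mdensity m mg g0)
  mu0 mu_ge0 mu_sigma_additive.

End DensityMeasure.

(** * Translation of Lebesgue measure and of the normal law *)

Section Translation.
Local Open Scope ereal_scope.
Context {R : realType}.

Lemma lebesgue_measure_shift (a : R) (A : set R) : measurable A ->
  lebesgue_measure ((fun t => (t + a)%R) @^-1` A) = lebesgue_measure A.
Proof.
move=> mA.
have mf : measurable_fun (setT : set (measurableTypeR R)) (fun t : measurableTypeR R => (t + a)%R : measurableTypeR R).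
  by apply: measurable_funD => //; exact: measurable_cst.
pose M : {measure set (measurableTypeR R) -> \bar R} := pushforward (@lebesgue_measure R) (fun t : measurableTypeR R => (t + a)%R : measurableTypeR R).
suff H X : ocitv X -> lebesgue_measure X = M mf X.
  by apply/esym; exact: (@lebesgue_measure_unique R (M mf) H A mA).
move=> /ocitvP [->|[[b c] /= bc ->]]; first by rewrite !measure0.
rewrite lebesgue_measure_itv/= lte_fin bc /M /= /pushforward.
rewrite (_ : _ @^-1` `]b, c]%classic = `](b - a)%R, (c - a)%R]%classic); last first.
  by apply/seteqP; split => t /=; rewrite !in_itv/= ltrBlDr lerBrDr.
by rewrite lebesgue_measure_itv/= lte_fin ltrD2r bc -!EFinB; congr (_%:E); ring.
Qed.

Lemma ge0_integral_shift (a : R) (f : R -> \bar R) :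
  measurable_fun setT f -> (forall x, 0 <= f x) ->
  \int[lebesgue_measure]_x f (x + a)%R = \int[lebesgue_measure]_x f x.
Proof.
move=> mf f0.
have ms : measurable_fun (setT : set (measurableTypeR R)) (fun t : measurableTypeR R => (t + a)%R : measurableTypeR R).
  by apply: measurable_funD => //; exact: measurable_cst.
rewrite -[LHS]/(\int[@lebesgue_measure R]_(x in (fun t : measurableTypeR R => (t + a)%R : measurableTypeR R) @^-1` setT) (f \o (fun t => (t + a)%R)) x).
rewrite -ge0_integral_pushforward//.
by apply: eq_measure_integral => A mA _; exact: lebesgue_measure_shift.
Qed.

End Translation.

Section NormalShift.
Context {R : realType} (sigma : R) (s0 : 0 < sigma).

(** The density of N(a, sigma^2) with respect to N(0, sigma^2). *)
Definition normal_tilt (a t : R) : R :=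
  expR (a * t / sigma ^+ 2 - a ^+ 2 / (2 * sigma ^+ 2)).

Lemma normal_tilt_ge0 a t : 0 <= normal_tilt a t. Proof. exact: expR_ge0. Qed.

Lemma measurable_normal_tilt a : measurable_fun setT (normal_tilt a).
Proof.
apply: continuous_measurable_fun => t.
apply: (@continuous_comp _ _ _ (fun t => a * t / sigma ^+ 2 - a ^+ 2 / (2 * sigma ^+ 2)) expR); last exact: continuous_expR.
apply: (@cvgB _ R^o); last exact: cvg_cst.
by apply: cvgM; [apply: cvgM; [exact: cvg_cst|exact: cvg_id]|exact: cvg_cst].
Qed.

Lemma normal_pdf_tilt a t :
  normal_pdf 0 sigma (t - a) = normal_pdf 0 sigma t * normal_tilt a t.
Proof.
rewrite !normal_pdfE ?gt_eqF// -mulrA; congr (_ * _).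
rewrite /normal_fun /normal_tilt -expRD; congr expR.
by field; rewrite gt_eqF.
Qed.

Lemma normal_prob_shift a (B : set R) : measurable B ->
  normal_prob 0 sigma ((fun t => t + a) @^-1` B) =
  (\int[normal_prob 0 sigma]_(t in B) (normal_tilt a t)%:E)%E.
Proof.
move=> mB; rewrite [RHS]integral_mkcond.
have nE A : measurable A -> normal_prob 0 sigma A = (\int[lebesgue_measure]_(x in A) (normal_pdf 0 sigma x)%:E)%E by [].
have mt : measurable_fun setT ((fun t => (normal_tilt a t)%:E) \_ B).
  apply: (measurable_restrictT _ mB).1.
  by apply: measurable_funTS; apply/measurable_EFinP; exact: measurable_normal_tilt.
rewrite (@ge0_integral_density _ (measurableTypeR R) R (@lebesgue_measure R) (normal_prob 0 sigma) _ (measurable_normal_pdf 0 sigma) (normal_pdf_ge0 0 sigma) nE)//; last first.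
  by move=> t; rewrite patchE; case: ifP => // _; rewrite lee_fin normal_tilt_ge0.
have ms : measurable_fun setT (fun t : R => t + a) by apply: measurable_funD.
have mD : measurable ((fun t : R => t + a) @^-1` B).
  by rewrite -[X in measurable X]setTI; exact: ms.
rewrite /normal_prob [LHS]integral_mkcond.
rewrite -[LHS](ge0_integral_shift (- a)); last 2 first.
  apply: (measurable_restrictT _ mD).1.
  by apply: measurable_funTS; apply/measurable_EFinP; exact: measurable_normal_pdf.
  by move=> t; rewrite patchE; case: ifP => // _; rewrite lee_fin normal_pdf_ge0.
apply: eq_integral => t _; rewrite !patchE.
rewrite (_ : (t - a \in (fun u => u + a) @^-1` B) = (t \in B)); last first.
  by apply/idP/idP; rewrite !inE /= subrK.
case: ifP => _; last by rewrite mul0e.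
by rewrite normal_pdf_tilt -EFinM mulrC.
Qed.

End NormalShift.

(** * The Cameron-Martin formula for the noise *)

Section CameronMartin.
Context {R : realType} {d : measure_display} {Omega : measurableType d}
  (P : probability Omega R) {n : nat}.
Variables (sigma : R) (s0 : 0 < sigma).
Variables (eps : 'I_n -> {RV P >-> R}) (heps : gaussian_noise sigma eps).

Definition noise (w : Omega) : 'cV[R]_n := \col_(i < n) eps i w.

Lemma measurable_noise : measurable_fun setT noise.
Proof.
apply: measurable_fun_mxP => i j.
by under eq_fun do rewrite mxE; exact: measurable_funPT.
Qed.

Let mpre i (B : set R) : measurable B -> measurable (eps i @^-1` B).
Proof. by move=> mB; rewrite -[X in measurable X]setTI; exact: measurable_funPT. Qed.

(** The product formula is used twice, over all indices and over all but [i]; the two products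
    differ by the factor of index [i]. *)
Lemma noise_independence (i : 'I_n) (A : 'I_n -> set R) (B : set R) :
  (forall k, measurable (A k)) -> measurable B ->
  P ((\bigcap_(k in [set k | k != i]) (eps k @^-1` A k)) `&` eps i @^-1` B) =
  (P (\bigcap_(k in [set k | k != i]) (eps k @^-1` A k)) * normal_prob 0 sigma B)%E.
Proof.
move=> mA mB; have [ind law] := heps.
pose A' k := if k == i then B else A k.
have mA' k : measurable (A' k) by rewrite /A'; case: ifP.
have -> : normal_prob 0 sigma B = P (eps i @^-1` B) by rewrite -(law i).
have HT := ind [set: 'I_n]%SET A' mA'.
have HD := ind [set~ i]%SET A' mA'.
have EC : \bigcap_(k in [set k | k != i]) (eps k @^-1` A k) =
    \bigcap_(k in [set` [set~ i]%SET]) (eps k @^-1` A' k).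
  apply: eq_bigcap => [|k /negbTE ki]; last by rewrite /A' ki.
  by split=> k /=; rewrite !inE.
rewrite EC HD.
have -> : \bigcap_(k in [set` [set~ i]%SET]) (eps k @^-1` A' k) `&` eps i @^-1` B =
    \bigcap_(k in [set` [set: 'I_n]%SET]) (eps k @^-1` A' k).
  apply/seteqP; split=> [w [H Bw] k _|w H].
    have [->|ki] := eqVneq k i; first by rewrite /A' eqxx.
    by apply: H; rewrite /= !inE.
  split; first by move=> k _; apply: H; rewrite /= inE.
  by have := H i; rewrite /A' eqxx; apply; rewrite /= inE.
rewrite HT (bigD1 i) ?inE//= /A' eqxx muleC; congr (_ * _)%E.
by apply: eq_bigl => k; rewrite !inE.
Qed.

(** Restrict [P] to the event on the other coordinates, that is, give it the indicator as density.
    By independence its image under [eps i] is the normal law times the probability of the event. *)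
Lemma integral_noise_independence (i : 'I_n) (A : 'I_n -> set R) (f : R -> \bar R) :
  (forall k, measurable (A k)) -> measurable_fun setT f -> (forall x, 0 <= f x)%E ->
  (\int[P]_(w in \bigcap_(k in [set k | k != i]) (eps k @^-1` A k)) f (eps i w) =
  P (\bigcap_(k in [set k | k != i]) (eps k @^-1` A k)) * \int[normal_prob 0 sigma]_x f x)%E.
Proof.
move=> mA mf f0; set C := \bigcap_(k in _) _.
have mC : measurable C.
  by apply: fin_bigcap_measurable; [exact: finite_finset|move=> k _; exact: mpre].
have m1C : measurable_fun setT (\1_C : Omega -> R) by exact: measurable_indic.
have C0 w : 0 <= (\1_C w : R) by [].
pose mC1 := mdensity P m1C C0.
have PC0 : 0 <= fine (P C) by rewrite fine_ge0.
pose m2 := mscale (NngNum PC0) (normal_prob 0 sigma).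
have mfi : measurable_fun setT (f \o eps i).
  by apply: measurableT_comp => //; exact: measurable_funPT.
transitivity (\int[mC1]_w f (eps i w))%E.
  rewrite (@ge0_integral_density _ _ _ P _ (\1_C))//.
  rewrite [LHS]integral_mkcond. apply: eq_integral => w _; rewrite patchE indicE.
  by case: ifP => _; rewrite ?mule1 ?mule0.
have me : measurable_fun setT (eps i : Omega -> measurableTypeR R).
  have me0 : measurable_fun setT (eps i) by exact: measurable_funPT.
  exact: me0.
transitivity (\int[pushforward mC1 (eps i : Omega -> measurableTypeR R)]_x f x)%E.
  by rewrite ge0_integral_pushforward// preimage_setT.
transitivity (\int[m2]_x f x)%E.
  apply: eq_measure_integral => B mB _.
  change ((\int[P]_(w in eps i @^-1` B) (\1_C w)%:E)%E =
    ((NngNum PC0)%:num%:E * normal_prob 0 sigma B)%E).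
  rewrite integral_indic//=; last exact: mpre.
  by rewrite fineK ?fin_num_measure// noise_independence.
by rewrite ge0_integral_mscale//= fineK ?fin_num_measure.
Qed.

(** The density of N(a, sigma^2 I) with respect to N(0, sigma^2 I), that is, the product of the
    one-dimensional tilts. *)
Definition noise_tilt (a : 'cV[R]_n) (x : 'cV[R]_n) : R :=
  expR ((\sum_i a i 0 * x i 0) / sigma ^+ 2 - (\sum_i a i 0 ^+ 2) / (2 * sigma ^+ 2)).

Lemma measurable_noise_tilt a : measurable_fun setT (noise_tilt a).
Proof.
apply: measurableT_comp => //; apply: measurable_funB => //.
apply: measurable_funM => //; apply: measurable_sum => i.
by apply: measurable_funM => //; exact: measurable_coord.
Qed.

Lemma measurable_shift_mx (a : 'cV[R]_n) : measurable_fun setT (fun x : 'cV[R]_n => x + a).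
Proof.
apply: measurable_fun_mxP => i j; under eq_fun do rewrite mxE.
by apply: measurable_funD => //; exact: measurable_coord.
Qed.

(** Both sides are integrals of [f] against image measures on vectors, which need only be compared
    on boxes. There independence separates the shifted coordinate from the others and the claim
    reduces to the one-dimensional shift. *)
Lemma cameron_martin_coord (i : 'I_n) (c : R) (f : 'cV[R]_n -> \bar R) :
  measurable_fun setT f -> (forall x, 0 <= f x)%E ->
  (\int[P]_w f (noise w + c *: delta_mx i 0)%R =
   \int[P]_w (f (noise w) * (normal_tilt sigma c (noise w i 0))%:E))%E.
Proof.
move=> mf f0.
have mn := measurable_noise.
have ms : measurable_fun setT (fun w => noise w + c *: delta_mx i 0).
  by have := measurableT_comp (measurable_shift_mx (c *: delta_mx i 0)) mn.
have mt : measurable_fun setT (fun w => normal_tilt sigma c (noise w i 0)).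
  apply: measurableT_comp; first exact: measurable_normal_tilt.
  by have := measurableT_comp (@measurable_coord R n 1 i 0) mn.
have t0 w : 0 <= normal_tilt sigma c (noise w i 0) by exact: normal_tilt_ge0.
transitivity (\int[pushforward P (fun w => noise w + c *: delta_mx i 0)%R]_x f x)%E.
  by rewrite ge0_integral_pushforward// preimage_setT.
transitivity (\int[pushforward (mdensity P mt t0) noise]_x f x)%E; last first.
  rewrite ge0_integral_pushforward// preimage_setT.
  rewrite (@ge0_integral_density _ _ _ P _ (fun w => normal_tilt sigma c (noise w i 0)))//.
    exact: measurableT_comp.
  by move=> w /=.
pose m1 : {measure set 'cV[R]_n -> \bar R} := pushforward P (fun w => noise w + c *: delta_mx i 0).
pose m2 : {measure set 'cV[R]_n -> \bar R} := pushforward (mdensity P mt t0) noise.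
apply: (@eq_measure_integral _ _ _ _ (m2 mn) (m1 ms)) => B mB _.
apply: (@g_sigma_algebra_measure_unique _ _ _ (@mx_boxes R n 1) _ (fun=> setT) _ _ (m1 ms) (m2 mn)) => //.
- by move=> _ [A mA ->]; exact: measurable_mx_box.
- move=> _; exists (fun _ _ => setT) => //; apply/seteqP; split => //.
- by rewrite bigcup_const//; exists 0%N.
- exact: mx_boxes_setI.
- move=> _ [A mA ->]; rewrite /m1 /m2 /= /pushforward.
  pose A' (k : 'I_n) := A k 0.
  have mA' k : measurable (A' k) by exact: mA.
  set C := \bigcap_(k in [set k | k != i]) (eps k @^-1` A' k).
  have mC : measurable C.
    by apply: fin_bigcap_measurable; [exact: finite_finset|move=> k _; exact: mpre].
  rewrite (_ : _ @^-1` _ = C `&` eps i @^-1` ((fun t => t + c) @^-1` A' i)); last first.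
    apply/seteqP; split=> w /=.
      move=> H; split; last by have := H i 0; rewrite !mxE !eqxx mulr1.
      move=> k /= /negbTE ki; have := H k 0; rewrite !mxE ki mulr0 addr0//.
    move=> [H1 H2] k j; rewrite (ord1 j) !mxE eqxx andbT.
    have [->|ki] := eqVneq k i; first by rewrite mulr1.
    by rewrite mulr0 addr0; exact: H1.
  have msh : measurable_fun setT (fun t : R => t + c) by apply: measurable_funD.
  rewrite noise_independence//; last first.
    by rewrite -[X in measurable X]setTI; exact: msh.
  rewrite normal_prob_shift//.
  rewrite (_ : noise @^-1` _ = C `&` eps i @^-1` A' i); last first.
    apply/seteqP; split=> w /=.
      move=> H; split; last by have := H i 0; rewrite !mxE.
      by move=> k /= /negbTE ki; have := H k 0; rewrite !mxE.
    move=> [H1 H2] k j; rewrite (ord1 j) !mxE.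
    by have [->|ki] := eqVneq k i; [|exact: H1].
  rewrite [X in (_ * X)%E]integral_mkcond -integral_noise_independence//; last 2 first.
    apply: (measurable_restrictT _ (mA' i)).1; apply: measurable_funTS.
    by apply/measurable_EFinP; exact: measurable_normal_tilt.
    by move=> t; rewrite patchE; case: ifP => // _; rewrite lee_fin normal_tilt_ge0.
  rewrite /mdensity integral_mkcondr; apply: eq_integral => w _.
  rewrite !patchE mxE; congr (if _ then _ else _).
- by move=> _; rewrite /= /pushforward /= preimage_setT probability_setT ltry.
Qed.

End CameronMartin.

Section CameronMartin.
Context {R : realType} {d : measure_display} {Omega : measurableType d}
  (P : probability Omega R) {n : nat}.
Variables (sigma : R) (s0 : 0 < sigma).
Variables (eps : 'I_n -> {RV P >-> R}) (heps : gaussian_noise sigma eps).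

Let E := noise eps.
Let mE : measurable_fun setT E := measurable_noise eps.

Theorem cameron_martin (a : 'cV[R]_n) (f : 'cV[R]_n -> \bar R) :
  measurable_fun setT f -> (forall x, 0 <= f x)%E ->
  (\int[P]_w f (E w + a)%R = \int[P]_w (f (E w) * (noise_tilt sigma a (E w))%:E))%E.
Proof.
pose W s (x : 'cV[R]_n) := \prod_(i <- s) normal_tilt sigma (a i 0) (x i 0).
have mW s : measurable_fun setT (W s).
  apply: measurable_prod => i _; apply: measurableT_comp.
    exact: measurable_normal_tilt.
  exact: measurable_coord.
have W0 s x : 0 <= W s x by apply: prodr_ge0 => i _; exact: normal_tilt_ge0.
have H (s : seq 'I_n) : uniq s -> forall f : 'cV[R]_n -> \bar R,
    measurable_fun setT f -> (forall x, 0 <= f x)%E ->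
    (\int[P]_w f (E w + \sum_(i <- s) a i 0 *: delta_mx i 0)%R =
     \int[P]_w (f (E w) * (W s (E w))%:E))%E.
  elim: s => [_ g mg g0|i s IH /= /andP[ins us] g mg g0].
    by apply: eq_integral => w _; rewrite /W !big_nil addr0 mule1.
  pose g' x := g (x + a i 0 *: delta_mx i 0).
  have mg' : measurable_fun setT g'.
    exact: (measurableT_comp mg (measurable_shift_mx _)).
  transitivity (\int[P]_w g' (E w + \sum_(i <- s) a i 0 *: delta_mx i 0)%R)%E.
    apply: eq_integral => w _; rewrite /g' big_cons -addrA.
    by congr (g (_ + _)); rewrite addrC.
  rewrite IH// /g'; last by move=> x; exact: g0.
  pose g2 x := (g x * (W s x)%:E)%E.
  (* The weight accumulated over [s] does not involve coordinate [i], so it is unaffected by the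
     shift still to be removed. *)
  transitivity (\int[P]_w g2 (E w + a i 0 *: delta_mx i 0)%R)%E.
    apply: eq_integral => w _; rewrite /g2; congr (_ * (_)%:E)%E.
    rewrite /W big_seq [RHS]big_seq; apply: eq_bigr => k ks; rewrite !mxE.
    have /negbTE -> : k != i by apply: contraNneq ins => <-.
    by rewrite mulr0 addr0.
  rewrite (cameron_martin_coord s0 heps)//; last 2 first.
    by apply: emeasurable_funM => //; exact/measurable_EFinP.
    by move=> x; rewrite mule_ge0// lee_fin.
  by apply: eq_integral => w _; rewrite /g2 /W big_cons -muleA -EFinM mulrC.
move=> mf f0.
have := H (index_enum 'I_n) (index_enum_uniq _) f mf f0.
have -> : \sum_(i <- index_enum 'I_n) a i 0 *: delta_mx i 0 = a.
  by rewrite [RHS]matrix_sum_delta; apply: eq_bigr => i _; rewrite big_ord1.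
move=> ->; apply: eq_integral => w _; congr (_ * (_)%:E)%E.
rewrite /W -expR_sum /noise_tilt; congr expR.
by rewrite sumrB !mulr_suml.
Qed.

(** Apply Cameron-Martin to the constant 1 with shift [sigma ^+ 2 *: a]: the tilt is this
    exponential up to a positive constant factor, and it integrates to 1. *)
Lemma expR_dot_noise_lty (a : 'cV[R]_n) :
  (\int[P]_w (expR (\sum_i a i 0 * E w i 0))%:E < +oo)%E.
Proof.
have : (1 = \int[P]_w (1%E * (noise_tilt sigma (sigma ^+ 2 *: a) (E w))%:E))%E.
  rewrite -(@cameron_martin (sigma ^+ 2 *: a) (fun=> 1%E))//.
  by rewrite integral_cst// mul1e; apply/esym; exact: probability_setT.
set c := (\sum_i (sigma ^+ 2 *: a) i 0 ^+ 2) / (2 * sigma ^+ 2).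
have -> : (\int[P]_w (1%E * (noise_tilt sigma (sigma ^+ 2 *: a) (E w))%:E) =
   (expR (- c))%:E * \int[P]_w (expR (\sum_i a i 0 * E w i 0))%:E)%E.
  rewrite -ge0_integralZl//; last first.
    apply/measurable_EFinP; apply: measurableT_comp => //.
    apply: measurable_sum => i; apply: measurable_funM => //.
    exact: (measurableT_comp (@measurable_coord R n 1 i 0) mE).
  apply: eq_integral => w _; rewrite mul1e -EFinM -expRD /noise_tilt addrC.
  congr (expR (_ + _))%:E; rewrite mulr_suml; apply: eq_bigr => i _.
  by rewrite mxE; field; rewrite gt_eqF.
move=> e1; rewrite ltNge leye_eq; apply/eqP => eoo; move: e1; rewrite eoo.
by rewrite gt0_muley// lte_fin expR_gt0.
Qed.

Lemma integrable_expR_norm_noise (c : R) :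
  P.-integrable setT (fun w => (expR (c * `|E w|))%:E).
Proof.
have mnE : measurable_fun setT (fun w => `|E w|).
  apply: measurableT_comp mE; apply: continuous_measurable_mx.
  exact: norm_continuous.
have mexp (a : 'cV[R]_n) : measurable_fun setT (fun w => (expR (\sum_i a i 0 * E w i 0))%:E).
  apply/measurable_EFinP; apply: measurableT_comp => //.
  apply: measurable_sum => i; apply: measurable_funM => //.
  exact: (measurableT_comp (@measurable_coord R n 1 i 0) mE).
have mc : measurable_fun setT (fun w => (expR (c * `|E w|))%:E).
  by apply/measurable_EFinP; apply: measurableT_comp => //; apply: measurable_funM.
pose a (b : bool) (i : 'I_n) : 'cV[R]_n := ((if b then c else - c) *: delta_mx i 0).
(* The sup norm is the absolute value of some entry, so one of these exponentials dominates; the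
   summand 1 covers the case of norm 0. *)
pose G w : \bar R := (1 + \sum_i ((expR (\sum_k a true i k 0 * E w k 0))%:E + (expR (\sum_k a false i k 0 * E w k 0))%:E))%E.
have aE b i w : \sum_k a b i k 0 * E w k 0 = (if b then c else - c) * E w i 0.
  rewrite (bigD1 i)//= big1 ?addr0; last first.
    by move=> k /negbTE ki; rewrite !mxE ki mulr0 mul0r.
  by rewrite mxE mxE !eqxx mulr1.
have iexp b i : P.-integrable setT (fun w => (expR (\sum_k a b i k 0 * E w k 0))%:E).
  apply/integrableP; split => //.
  under eq_integral do rewrite gee0_abs ?lee_fin ?expR_ge0//.
  exact: expR_dot_noise_lty.
have iG : P.-integrable setT G.
  apply: integrableD => //; first exact: finite_measure_integrable_cst.
  by apply: integrable_sum => // i _; apply: integrableD.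
apply: (le_integrable _ mc _ iG) => // w _.
rewrite !gee0_abs ?lee_fin ?expR_ge0//; last first.
  by rewrite /G adde_ge0// sume_ge0// => i _; rewrite adde_ge0// lee_fin expR_ge0.
have [E0|/mx_norm_neq0 [[i j] Ei]] := eqVneq `|E w| 0.
  rewrite E0 mulr0 expR0 /G leeDl// sume_ge0// => i _.
  by rewrite adde_ge0// lee_fin expR_ge0.
rewrite /G (bigD1 i)//=; set r := (\sum_(k < n | _) _)%E; set u := (X in (1 + (X + _))%E).
have r0 : (0 <= r)%E.
  by apply: sume_ge0 => k _; rewrite adde_ge0// lee_fin expR_ge0.
apply: (@le_trans _ _ u); last first.
  by apply: (le_trans (leeDl _ r0)); rewrite leeDr.
rewrite /u.
rewrite !aE -EFinD lee_fin -[in leLHS]/(mx_norm (E w)) Ei /= (ord1 j).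
case: (leP 0 (E w i 0)) => h.
  by rewrite ger0_norm// lerDl expR_ge0.
by rewrite ltr0_norm// mulrN mulNr lerDr expR_ge0.
Qed.

(** By Tonelli in the outcome and in the position on the line, the noise shifted by [s *: a] avoids
    [B] almost surely for almost every [s]. For one such [s], Cameron-Martin transfers this to the
    unshifted noise because the tilt is positive. *)
Lemma null_along_lines (a : 'cV[R]_n) (B : set 'cV[R]_n) : measurable B ->
  (forall x, lebesgue_measure [set s : R | B (x + s *: a)] = 0%E) ->
  P (E @^-1` B) = 0%E.
Proof.
move=> mB HB.
have mI : measurable_fun setT (\1_B : 'cV[R]_n -> R) by exact: measurable_indic.
have mEB : measurable (E @^-1` B) by rewrite -[X in measurable X]setTI; exact: mE.
have mF : measurable_fun setT (fun z : Omega * measurableTypeR R => E z.1 + z.2 *: a).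
  apply: measurable_fun_mxP => i j; under eq_fun do rewrite !mxE.
  apply: measurable_funD.
    by apply: (measurableT_comp (f := fun w => eps i w)) => //; exact: measurable_funPT.
  by apply: measurable_funM => //; exact: measurable_snd.
pose f (z : Omega * measurableTypeR R) : \bar R := (\1_B (E z.1 + z.2 *: a))%:E.
have mf : measurable_fun setT f.
  apply/measurable_EFinP.
  exact: (measurableT_comp mI mF).
have f0 z : (0 <= f z)%E by rewrite lee_fin.
have := @fubini_tonelli _ _ _ _ _ P (@lebesgue_measure R) f mf f0.
rewrite integral0_eq; last first.
  move=> w _; rewrite -[RHS](HB (E w)) -(setIT [set s | _]).
  have mEw : measurable_fun setT (fun s : measurableTypeR R => E w + s *: a).
    apply: measurable_fun_mxP => i j; under eq_fun do rewrite !mxE.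
    by apply: measurable_funD => //; apply: measurable_funM.
  rewrite -integral_indic//.
  rewrite -[X in measurable X]setTI; exact: (mEw measurableT _ mB).
move=> /esym I0.
pose g (s : R) := (\int[P]_w f (w, s))%E.
have g0 s : (0 <= g s)%E by exact: integral_ge0.
have mg : measurable_fun setT g.
  exact: (measurable_fun_fubini_tonelli_G f mf f0).
have [N [mN N0 gN]] : {ae (@lebesgue_measure R), forall s, g s = 0%E}.
  have /(ae_eq_integral_abs (@lebesgue_measure R) measurableT mg).1 : (\int[lebesgue_measure]_s `|g s| = 0)%E.
    by under eq_integral do rewrite gee0_abs//.
  by apply: filterS => s; apply.
(* An [s] exists because a null set cannot contain the unit interval. *)
have [s gs0] : exists s, g s = 0%E.
  apply: contrapT => H; suff : (lebesgue_measure `[0%R, 1%R]%classic <= 0 :> \bar R)%E.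
    by rewrite lebesgue_measure_itv/= lte_fin ltr01 oppr0 adde0 leNgt lte_fin ltr01.
  rewrite -N0; apply: le_measure; rewrite ?inE//.
  by move=> s _; apply: gN => gs; apply: H; exists s.
have := @cameron_martin (s *: a) (fun x => (\1_B x)%:E).
rewrite -/(g s) gs0 => /(_ _ _)/esym Z0.
have {}Z0 : (\int[P]_w `|(\1_B (E w))%:E * (noise_tilt sigma (s *: a) (E w))%:E| = 0)%E.
  under eq_integral do rewrite gee0_abs ?mule_ge0 ?lee_fin ?expR_ge0//.
  apply: Z0 => //; exact/measurable_EFinP.
have mZ : measurable_fun setT (fun w => (\1_B (E w))%:E * (noise_tilt sigma (s *: a) (E w))%:E)%E.
  apply: emeasurable_funM; apply/measurable_EFinP.
    exact: (measurableT_comp mI mE).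
  exact: (measurableT_comp (measurable_noise_tilt _ _) mE).
have [M [mM M0 HM]] := (ae_eq_integral_abs P measurableT mZ).1 Z0.
apply: subset_measure0 M0 => // w /= Bw; apply: HM => /=.
move=> /(_ Logic.I); rewrite indicE mem_set// mul1e => /eqP.
by rewrite eqe gt_eqF// expR_gt0.
Qed.

End CameronMartin.

(** * Stein's identity *)

Lemma expR_sub1_le {R : realType} (t : R) : `|expR t - 1| <= `|t| * expR `|t|.
Proof.
have h1 := expR_ge1Dx t; have h2 := expR_ge1Dx (- t).
have e0 := expR_gt0 t.
have h3 : expR t - 1 <= t * expR t.
  have : expR t * (1 - t) <= 1.
    rewrite -[leRHS](expRxMexpNx_1 t); apply: ler_wpM2l; first exact: ltW.
    exact: expR_ge1Dx.
  lra.
have [t0|t0] := leP 0 t.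
  rewrite (ger0_norm t0) ger0_norm; lra.
have n1 : 1 <= expR `|t| by apply: le_trans (expR_ge1Dx _); rewrite lerDl.
rewrite (ltr0_norm t0) in n1 *.
rewrite ler0_norm; last by rewrite subr_le0 -expR0 ler_expR ltW.
nra.
Qed.

Lemma expR_sub1D_le {R : realType} (t : R) :
  `|expR t - 1 - t| <= `|t| ^+ 2 * expR `|t|.
Proof.
have h1 := expR_ge1Dx t; have e0 := expR_gt0 t.
have h3 : expR t - 1 - t <= t * (expR t - 1).
  have : expR t * (1 - t) <= 1.
    rewrite -[leRHS](expRxMexpNx_1 t); apply: ler_wpM2l; first exact: ltW.
    exact: expR_ge1Dx.
  lra.
rewrite ger0_norm; last by lra.
apply: (le_trans h3); apply: (le_trans (ler_norm _)).
by rewrite normrM expr2 -mulrA ler_wpM2l// expR_sub1_le.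
Qed.

Lemma coord_le_norm {R : realType} {m n : nat} (x : 'M[R]_(m, n)) i j :
  `|x i j| <= `|x|.
Proof.
rewrite [leRHS]/Num.norm /= mx_normrE; apply/bigmax_geP; right => /=.
by exists (i, j).
Qed.

(** Steps are restricted to 1/(m+1), so that limits are sequential and preserve measurability. *)
Definition dquot {R : realType} {n : nat} (g : 'cV[R]_n -> R) (a : 'cV[R]_n)
    (m : nat) (x : 'cV[R]_n) : R :=
  m.+1%:R * (g (x + m.+1%:R^-1 *: a) - g x).

Section Stein.
Context {R : realType} {d : measure_display} {Omega : measurableType d}
  (P : probability Omega R) {n : nat}.
Variables (sigma : R) (s0 : 0 < sigma).
Variables (eps : 'I_n -> {RV P >-> R}) (heps : gaussian_noise sigma eps).

Let E := noise eps.
Let mE : measurable_fun setT E := measurable_noise eps.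

Lemma measurable_dquot (g : 'cV[R]_n -> R) (a : 'cV[R]_n) (m : nat) :
  measurable_fun setT g -> measurable_fun setT (dquot g a m).
Proof.
move=> mg; apply: measurable_funM => //; apply: measurable_funB => //.
exact: (measurableT_comp mg (measurable_shift_mx _)).
Qed.

Lemma integrable_noise (f : 'cV[R]_n -> R) (A c : R) :
  measurable_fun setT f -> (forall x, `|f x| <= A * expR (c * `|x|)) ->
  P.-integrable setT (fun w => (f (E w))%:E).
Proof.
move=> mf fA.
have i1 : P.-integrable setT (fun w => (A * expR (c * `|E w|))%:E).
  under eq_fun do rewrite EFinM.
  by apply: integrableZl => //; exact: (integrable_expR_norm_noise s0 heps c).
apply: (le_integrable measurableT _ _ i1).
  by apply/measurable_EFinP; exact: measurableT_comp.
move=> w _; rewrite lee_fin [leRHS]ger0_norm ?fA//.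
exact: le_trans (fA (E w)).
Qed.

Lemma cameron_martin_real (a : 'cV[R]_n) (f : 'cV[R]_n -> R) :
  measurable_fun setT f ->
  (\int[P]_w (f (E w + a))%:E = \int[P]_w (f (E w) * noise_tilt sigma a (E w))%:E)%E.
Proof.
move=> mf; rewrite integralE [RHS]integralE.
have mfE : measurable_fun setT (EFin \o f) by exact/measurable_EFinP.
congr (_ - _)%E.
- have := cameron_martin s0 heps a (measurable_funepos mfE) (funepos_ge0 _).
  rewrite -/E => H; transitivity (\int[P]_w ((EFin \o f)^\+ (E w + a)%R))%E.
    by apply: eq_integral => w _; rewrite !funeposE.
  rewrite H; apply: eq_integral => w _; rewrite !funeposE /=.
  by rewrite maxe_pMl ?lee_fin ?expR_ge0// mul0e EFinM.
- have := cameron_martin s0 heps a (measurable_funeneg mfE) (funeneg_ge0 _).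
  rewrite -/E => H; transitivity (\int[P]_w ((EFin \o f)^\- (E w + a)%R))%E.
    by apply: eq_integral => w _; rewrite !funenegE.
  rewrite H; apply: eq_integral => w _; rewrite !funenegE /=.
  by rewrite maxe_pMl ?lee_fin ?expR_ge0// mul0e -EFinM mulNr.
Qed.

(* Differentiate the Cameron-Martin formula along [h *: a] at [h = 0]. *)
Theorem stein (a : 'cV[R]_n) (g D : 'cV[R]_n -> R) (A C c : R) :
  measurable_fun setT g -> (forall x, `|g x| <= A * expR (c * `|x|)) ->
  measurable_fun setT D ->
  (forall m x, `|dquot g a m x| <= C * expR (c * `|x|)) ->
  {ae P, forall w, dquot g a m (E w) @[m --> \oo] --> D (E w)} ->
  (\int[P]_w ((\sum_i a i 0 * E w i 0) * g (E w))%:E =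
   (sigma ^+ 2)%:E * \int[P]_w (D (E w))%:E)%E.
Proof.
move=> mg gA mD qC qD.
pose h m : R := m.+1%:R^-1.
have h0 m : 0 < h m by rewrite /h invr_gt0.
have h1 m : h m <= 1 by rewrite /h invf_le1// ler1n.
(* For a step of length h the tilt is exp(h u - h^2 q), so [u] is its derivative at h = 0. *)
pose u (x : 'cV[R]_n) := (\sum_i a i 0 * x i 0) / sigma ^+ 2.
pose q := (\sum_i a i 0 ^+ 2) / (2 * sigma ^+ 2).
have q0 : 0 <= q.
  apply: divr_ge0; first by apply: sumr_ge0 => i _; exact: sqr_ge0.
  by apply: mulr_ge0 => //; exact: sqr_ge0.
pose T m x := noise_tilt sigma (h m *: a) x.
have TE m x : T m x = expR (h m * u x - h m ^+ 2 * q).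
  rewrite /T /noise_tilt /u /q; congr (expR (_ - _)).
    rewrite mulrA mulr_sumr; congr (_ / _); apply: eq_bigr => i _.
    by rewrite mxE mulrA.
  rewrite mulrA mulr_sumr; congr (_ / _); apply: eq_bigr => i _.
  by rewrite mxE exprMn.
pose k0 := (\sum_i `|a i 0|) / sigma ^+ 2.
have k00 : 0 <= k0 by apply: divr_ge0; [apply: sumr_ge0|exact: sqr_ge0].
have uk x : `|u x| <= k0 * `|x|.
  rewrite /u /k0 mulrAC normrM (ger0_norm (x := (sigma ^+ 2)^-1)) ?invr_ge0 ?sqr_ge0//.
  rewrite ler_wpM2r ?invr_ge0 ?sqr_ge0// (le_trans (ler_norm_sum _ _ _))// mulr_suml.
  apply: ler_sum => i _; rewrite normrM ler_wpM2l//.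
  exact: coord_le_norm.
have mu : measurable_fun setT u.
  apply: measurable_funM => //; apply: measurable_sum => i.
  by apply: measurable_funM => //; exact: measurable_coord.
pose t m x := h m * u x - h m ^+ 2 * q.
pose r x : R := `|u x| + q.
have r0 x : 0 <= r x by rewrite /r addr_ge0.
have th m x : `|t m x| <= h m * r x.
  rewrite /t /r (le_trans (ler_normB _ _))// normrM (gtr0_norm (h0 m)) mulrDr lerD2l.
  have hh : 0 <= h m ^+ 2 by exact: sqr_ge0.
  rewrite ger0_norm; last exact: mulr_ge0.
  by rewrite ler_wpM2r// expr2 ler_piMr// ltW.
have tr m x : `|t m x| <= r x.
  by apply: le_trans (th m x) _; rewrite ler_piMl.
have gi := integrable_noise mg gA.
have Tq m x : `|m.+1%:R * (T m x - 1)| <= r x * expR (r x).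
  rewrite TE -/(t m x) normrM ger0_norm//.
  apply: (@le_trans _ _ (m.+1%:R * (h m * r x * expR (r x)))).
    rewrite ler_wpM2l//; apply: (le_trans (expR_sub1_le _)).
    by apply: ler_pM => //; rewrite ?expR_ge0 ?ler_expR.
  by rewrite /h -!mulrA mulVKf.
have Tl x : m.+1%:R * (T m x - 1) @[m --> \oo] --> u x.
  apply/cvgrPdist_le => e e0.
  (* The error is of order [h m]: the quadratic term of the exponent contributes [q], the Taylor
     remainder of the exponential the rest. *)
  pose K := q + r x ^+ 2 * expR (r x).
  have K0 : 0 <= K by rewrite addr_ge0// mulr_ge0 ?sqr_ge0 ?expR_ge0.
  near=> m.
  have le1 : `|u x - m.+1%:R * (T m x - 1)| <= h m * K.
    have -> : u x - m.+1%:R * (T m x - 1) =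
        h m * q - m.+1%:R * (expR (t m x) - 1 - t m x).
      rewrite TE -/(t m x) /t /h.
      have : m.+1%:R != 0 :> R by rewrite pnatr_eq0.
      by set N := m.+1%:R => N0; field.
    rewrite (le_trans (ler_normB _ _))// /K [leRHS]mulrDr lerD//.
      by rewrite ger0_norm// mulr_ge0// ltW.
    rewrite normrM ger0_norm//.
    apply: (@le_trans _ _ (m.+1%:R * ((h m * r x) ^+ 2 * expR (r x)))).
      rewrite ler_wpM2l//; apply: (le_trans (expR_sub1D_le _)).
      apply: ler_pM => //; rewrite ?sqr_ge0 ?expR_ge0 ?ler_expR//.
      by rewrite lerXn2r ?nnegrE// mulr_ge0// ltW.
    rewrite le_eqVlt; apply/orP; left; apply/eqP; rewrite /h.
    have : m.+1%:R != 0 :> R by rewrite pnatr_eq0.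
    by set N := m.+1%:R => N0; field.
  apply: (le_trans le1).
  have Km : K / e < m.+1%:R.
    apply: (@lt_le_trans _ _ (Num.bound (K / e))%:R).
      by apply: archi_boundP; rewrite divr_ge0// ltW.
    by rewrite ler_nat ltnW// ltnS; near: m; exact: nbhs_infty_ge.
  by rewrite /h mulrC ler_pdivrMr// mulrC -ler_pdivrMr// ltW.
have gTi m : P.-integrable setT (fun w => (g (E w) * T m (E w))%:E).
  have mT : measurable_fun setT (T m) by exact: measurable_noise_tilt.
  apply: (@integrable_noise (fun x => g x * T m x) (A * expR q) (c + k0)).
    exact: measurable_funM.
  move=> x; rewrite normrM mulrDl expRD mulrACA.
  apply: ler_pM => //; rewrite TE -/(t m x) gtr0_norm ?expR_gt0// -expRD ler_expR.
  apply: (le_trans (ler_norm _)); apply: (le_trans (tr m x)).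
  by rewrite /r addrC lerD2l.
(* Cameron-Martin moves the difference quotient from [g] to the Gaussian weight, where it converges
   at every point. *)
have step m : (\int[P]_w (dquot g a m (E w))%:E =
    \int[P]_w (g (E w) * (m.+1%:R * (T m (E w) - 1)))%:E)%E.
  have gs : P.-integrable setT (fun w => (g (E w + h m *: a))%:E).
    have mgs : measurable_fun setT (fun x : 'cV[R]_n => g (x + h m *: a)).
      exact: (measurableT_comp mg (measurable_shift_mx _)).
    apply: (@integrable_noise (fun x => g (x + h m *: a)) (A * expR (`|c| * `|a|)) `|c|) => //.
    move=> x; apply: (le_trans (gA _)); rewrite -mulrA -expRD.
    have A0 : 0 <= A.
      have := le_trans (normr_ge0 _) (gA 0).
      by rewrite pmulr_lge0// expR_gt0.
    rewrite ler_wpM2l// ler_expR -mulrDr.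
    apply: (le_trans (ler_wpM2r (normr_ge0 _) (ler_norm c))).
    rewrite ler_wpM2l// addrC (le_trans (ler_normD _ _))// lerD2r normrZ gtr0_norm//.
    by rewrite ler_piMl.
  transitivity (m.+1%:R%:E * (\int[P]_w (g (E w + h m *: a)%R)%:E - \int[P]_w (g (E w))%:E))%E.
    rewrite -integralB_EFin// -integralZl//; last exact: integrableB.
  rewrite cameron_martin_real// -integralB_EFin//; last exact: gTi.
  rewrite -integralZl//; last by apply: integrableB => //; exact: gTi.
  apply: eq_integral => w _; rewrite -EFinB -EFinM; congr (_%:E).
  by rewrite -/(T m (E w)); ring.
have lim1 : (\int[P]_w (dquot g a m (E w))%:E @[m --> \oo] --> \int[P]_w (D (E w))%:E)%E.
  suff [_ _] : [/\ P.-integrable setT (fun w => (D (E w))%:E),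
      ((\int[P]_w `|(dquot g a m (E w))%:E - (D (E w))%:E|) @[m --> \oo] --> 0)%E &
      (\int[P]_w (dquot g a m (E w))%:E @[m --> \oo] --> \int[P]_w (D (E w))%:E)%E] by [].
  apply: (@dominated_convergence _ _ _ P setT measurableT _ _
    (fun w => (C * expR (c * `|E w|))%:E)).
  - by move=> m; apply/measurable_EFinP; apply: measurableT_comp => //; exact: measurable_dquot.
  - by apply/measurable_EFinP; exact: measurableT_comp.
  - by apply: filterS qD => w qDw _; apply: cvg_EFin => //; exact: nearW.
  - under eq_fun do rewrite EFinM.
    by apply: integrableZl => //; exact: (integrable_expR_norm_noise s0 heps c).
  - by apply: aeW => w m _; rewrite lee_fin.
have lim2 : (\int[P]_w (g (E w) * (m.+1%:R * (T m (E w) - 1)))%:E @[m --> \oo] -->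
    \int[P]_w (g (E w) * u (E w))%:E)%E.
  suff [_ _] : [/\ P.-integrable setT (fun w => (g (E w) * u (E w))%:E),
      ((\int[P]_w `|(g (E w) * (m.+1%:R * (T m (E w) - 1)))%:E - (g (E w) * u (E w))%:E|) @[m --> \oo] --> 0)%E &
      (\int[P]_w (g (E w) * (m.+1%:R * (T m (E w) - 1)))%:E @[m --> \oo] -->
       \int[P]_w (g (E w) * u (E w))%:E)%E] by [].
  (* The dominating function combines the growth of [g] with r exp(r) <= exp(2 r), where [r] is at
     most [k0] times the norm plus [q]. *)
  apply: (@dominated_convergence _ _ _ P setT measurableT _ _
    (fun w => (A * expR (2 * q) * expR ((c + 2 * k0) * `|E w|))%:E)).
  - move=> m; apply/measurable_EFinP.
    apply: (measurableT_comp (f := fun x => g x * (m.+1%:R * (T m x - 1)))) => //.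
    apply: measurable_funM => //; apply: measurable_funM => //; apply: measurable_funB => //.
    exact: measurable_noise_tilt.
  - apply/measurable_EFinP; apply: (measurableT_comp (f := fun x => g x * u x)) => //.
    exact: measurable_funM.
  - apply: aeW => w _; apply: cvg_EFin; first exact: nearW.
    by apply: cvgM; [exact: cvg_cst|exact: Tl].
  - under eq_fun do rewrite EFinM.
    by apply: integrableZl => //; exact: (integrable_expR_norm_noise s0 heps _).
  - apply: aeW => w m _; rewrite lee_fin normrM.
    rewrite (mulrDl c) expRD mulrACA.
    apply: ler_pM => //; apply: (le_trans (Tq _ _)); rewrite -expRD.
    apply: (@le_trans _ _ (expR (r (E w)) * expR (r (E w)))).
      rewrite ler_wpM2r ?expR_ge0//.
      by apply: le_trans (expR_ge1Dx _); rewrite lerDr.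
    rewrite -expRD ler_expR /r; have := uk (E w); lra.
have : (\int[P]_w (g (E w) * u (E w))%:E = \int[P]_w (D (E w))%:E)%E.
  apply: (cvg_unique _ lim2); first exact: ereal_hausdorff.
  by move: lim1; under eq_fun do rewrite step.
move=> <-.
rewrite -integralZl//; last first.
  apply: (@integrable_noise (fun x => g x * u x) (A * k0) (c + 1)).
    exact: measurable_funM.
  move=> x; rewrite normrM mulrDl expRD mulrACA mul1r.
  apply: ler_pM => //; apply: (le_trans (uk x)); rewrite ler_wpM2l//.
  by apply: le_trans (expR_ge1Dx _); rewrite lerDr.
apply: eq_integral => w _; rewrite -EFinM; congr (_%:E).
by rewrite /u; field; rewrite gt_eqF.
Unshelve. all: by end_near. Qed.

End Stein.

Lemma measurable_cvg_set d (T : measurableType d) (R : realType)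
    (u : nat -> T -> R) (f : T -> R) :
  (forall m, measurable_fun setT (u m)) -> measurable_fun setT f ->
  measurable [set x | u m x @[m --> \oo] --> f x].
Proof.
move=> mu mf.
rewrite (_ : [set x | _] = \bigcap_k \bigcup_N \bigcap_m
  [set x | (N <= m)%N -> `|f x - u m x| <= k.+1%:R^-1]).
  apply: bigcapT_measurable => k; apply: bigcupT_measurable => N.
  apply: bigcapT_measurable => m.
  have [Nm|Nm] := leqP N m; last first.
    rewrite (_ : [set x | _] = setT)//; apply/seteqP; split => //.
  rewrite (_ : [set x | _] = (fun x => `|f x - u m x|) @^-1` `]-oo, k.+1%:R^-1]); last first.
    by apply/seteqP; split => x /=; rewrite in_itv/=; [apply|].
  rewrite -[X in measurable X]setTI.
  suff : measurable_fun setT (fun x => `|f x - u m x|) by apply.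
  by apply: measurableT_comp => //; exact: measurable_funB.
apply/seteqP; split => x /=.
  move=> /cvgrPdist_le H k _; have k0 : (0 : R) < k.+1%:R^-1 by rewrite invr_gt0.
  by have [N _ HN] := H _ k0; exists N => // m _ Nm; exact: HN.
move=> H; apply/cvgrPdist_le => e e0.
pose k := Num.bound e^-1.
have ke : k.+1%:R^-1 <= e.
  rewrite -(invrK e) lef_pV2 ?posrE ?invr_gt0//.
  apply: ltW; apply: (lt_trans (archi_boundP _)); rewrite ?invr_ge0 ?ltW//.
  by rewrite ltr_nat.
have [N _ HN] := H k Logic.I.
by exists N => // m /= Nm; exact: le_trans (HN m Logic.I Nm) ke.
Qed.

(** * Directional derivatives of Lipschitz functions *)

Definition is_lipschitz {R : realType} {n : nat} (g : 'cV[R]_n -> R) (L : R) :=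
  forall x y, `|g x - g y| <= L * `|x - y|.

Section Directional.
Context {R : realType} {n : nat}.
Variables (g : 'cV[R]_n -> R) (L : R) (gL : is_lipschitz g L).

Lemma lipschitz_measurable : measurable_fun setT g.
Proof.
apply: continuous_measurable_mx => x.
apply/(@cvgrPdist_lt _ _ _ (nbhs x) (nbhs_filter x)) => e e0.
apply/nbhs_ballP; exists ((`|L| + 1)^-1 * e) => [|t].
  by rewrite /= mulr_gt0// invr_gt0 ltr_wpDl.
rewrite -ball_normE /= ltr_pdivlMl ?ltr_wpDl//; apply: le_lt_trans.
apply: (le_trans (gL x t)).
by rewrite ler_wpM2r// (le_trans (ler_norm L))// lerDl.
Qed.

Lemma dquot_bound a m x : `|dquot g a m x| <= L * `|a|.
Proof.
rewrite /dquot normrM ger0_norm//.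
apply: (@le_trans _ _ (m.+1%:R * (L * `|m.+1%:R^-1 *: a|))).
  by rewrite ler_wpM2l// (le_trans (gL _ _))// addrAC subrr add0r.
by rewrite normrZ ger0_norm// mulrCA mulVKf.
Qed.

(* The upper limit makes the directional derivative total and measurable. *)
Definition ddir (a x : 'cV[R]_n) : R := limn_sup (fun m => dquot g a m x).

Lemma measurable_ddir a : measurable_fun setT (ddir a).
Proof.
apply: measurable_fun_limn_sup => [x _|x _|m].
- exists (L * `|a|) => _ [m _ <-].
  exact: le_trans (ler_norm _) (dquot_bound _ _ _).
- exists (- (L * `|a|)) => _ [m _ <-].
  by rewrite lerNl; apply: le_trans (dquot_bound a m x); rewrite -normrN ler_norm.
- by apply: measurable_dquot; exact: lipschitz_measurable.
Qed.

Lemma ddirE a x l : dquot g a m x @[m --> \oo] --> l -> ddir a x = l.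
Proof. by move=> /cvg_limn_inf_sup []. Qed.

(* The second limit, along [- a], is what distinguishes a derivative from a
   one-sided derivative. *)
Definition ddir_set a : set 'cV[R]_n :=
  [set x | dquot g a m x @[m --> \oo] --> ddir a x] `&`
  [set x | dquot g (- a) m x @[m --> \oo] --> - ddir a x].

Lemma measurable_ddir_set a : measurable (ddir_set a).
Proof.
apply: measurableI; apply: measurable_cvg_set => [m|].
- by apply: measurable_dquot; exact: lipschitz_measurable.
- exact: measurable_ddir.
- by apply: measurable_dquot; exact: lipschitz_measurable.
- by apply: measurableT_comp => //; exact: measurable_ddir.
Qed.

(** A two-sided derivative can be read off along the steps 1/(m+1) and -1/(m+1), with opposite
    limits; the upper limit [ddir] is then a true limit. *)
Lemma derivable_ddir_set a x (s : R) :
  derivable (fun t : R => g (x + t *: a)) s 1 -> ddir_set a (x + s *: a).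
Proof.
set f := fun t => _; move=> df.
have H (c : R) : c != 0 ->
   dquot g (c *: a) m (x + s *: a) @[m --> \oo] --> c * 'D_1 f s.
  move=> c0; pose u m : R := c * m.+1%:R^-1.
  have u0 m : u m != 0 by rewrite mulf_neq0// invr_eq0 pnatr_eq0.
  have ul : u m @[m --> \oo] --> (0 : R).
    rewrite -[X in _ --> X](mulr0 c); apply: cvgM; first exact: cvg_cst.
    exact: cvg_harmonic.
  have /cvgr_dnbhsP /(_ u (conj u0 ul)) {}ul := df.
  rewrite [X in X @ \oo --> _](_ : _ = (fun m => c * ((u m)^-1 *: (f (u m *: 1 + s) - f s)))).
    by apply: cvgM; [exact: cvg_cst|exact: ul].
  apply/funext => m.
  have e : x + s *: a + m.+1%:R^-1 *: (c *: a) = x + (u m *: 1 + s) *: a.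
    by rewrite /u [_ *: 1]mulr1 scalerA [_^-1 * c]mulrC scalerDl -addrA [s *: a + _]addrC.
  rewrite /dquot e /f; set A := _ - _.
  have -> : (u m)^-1 *: A = (u m)^-1 * A by [].
  by rewrite /u invfM invrK !mulrA mulfV// mul1r.
have H1 := H 1 (oner_neq0 _); rewrite scale1r mul1r in H1.
have N1 : - 1 != 0 :> R by rewrite oppr_eq0 oner_neq0.
have H2 := H (- 1) N1; rewrite scaleN1r mulN1r in H2.
by split => /=; rewrite (ddirE H1).
Qed.

End Directional.

Section AeDirectional.
Context {R : realType} {d : measure_display} {Omega : measurableType d}
  (P : probability Omega R) {n : nat}.
Variables (sigma : R) (s0 : 0 < sigma).
Variables (eps : 'I_n -> {RV P >-> R}) (heps : gaussian_noise sigma eps).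

(** The restriction of [g] to each line parallel to [a] is Lipschitz, hence derivable almost
    everywhere. Measurability of [ddir_set] lets these null sets of lines be assembled into a
    Gaussian null set. *)
Lemma ae_ddir_set (g : 'cV[R]_n -> R) (L : R) (a : 'cV[R]_n) : is_lipschitz g L ->
  {ae P, forall w, ddir_set g a (noise eps w)}.
Proof.
move=> gL.
have mG := measurable_ddir_set gL a.
exists (noise eps @^-1` (~` ddir_set g a)); split => //.
  rewrite -[X in measurable X]setTI; apply: measurable_noise => //.
  exact: measurableC.
apply: (null_along_lines s0 heps (a := a)); first exact: measurableC.
move=> x.
have fL s t : `|g (x + s *: a) - g (x + t *: a)| <= L * `|a| * `|s - t|.
  rewrite (le_trans (gL _ _))// opprD addrACA subrr add0r -scalerBl normrZ.
  by rewrite mulrAC -mulrA.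
have [N [mN N0 HN]] := lipschitz_ae_derivable fL.
apply: subset_measure0 N0 => //; last first.
  move=> s /= ns; apply: HN => /= df; apply: ns.
  exact: (derivable_ddir_set (x := x) (s := s)).
have mg := lipschitz_measurable gL.
have ml : measurable_fun setT (fun s : measurableTypeR R => x + s *: a).
  apply: measurable_fun_mxP => i j; under eq_fun do rewrite !mxE.
  by apply: measurable_funD => //; apply: measurable_funM.
have := ml measurableT _ (measurableC mG).
by rewrite setTI.
Qed.

End AeDirectional.

(** * The Rayleigh quotient and orthogonal projections *)

Section Dot.
Context {R : realType}.

Definition dot {n : nat} (x y : 'cV[R]_n) : R := \sum_(i < n) x i 0 * y i 0.

Lemma dotE n (x y : 'cV[R]_n) : dot x y = (x^T *m y) 0 0.
Proof. by rewrite mxE; apply: eq_bigr => i _; rewrite mxE. Qed.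

Lemma dotC n (x y : 'cV[R]_n) : dot x y = dot y x.
Proof. by apply: eq_bigr => i _; rewrite mulrC. Qed.

Lemma dotDl n (x y z : 'cV[R]_n) : dot (x + y) z = dot x z + dot y z.
Proof. by rewrite -big_split; apply: eq_bigr => i _; rewrite mxE mulrDl. Qed.

Lemma dotDr n (x y z : 'cV[R]_n) : dot x (y + z) = dot x y + dot x z.
Proof. by rewrite dotC dotDl !(dotC x). Qed.

Lemma dotZl n c (x y : 'cV[R]_n) : dot (c *: x) y = c * dot x y.
Proof. by rewrite mulr_sumr; apply: eq_bigr => i _; rewrite mxE mulrA. Qed.

Lemma dotZr n c (x y : 'cV[R]_n) : dot x (c *: y) = c * dot x y.
Proof. by rewrite dotC dotZl dotC. Qed.

Lemma dotNl n (x y : 'cV[R]_n) : dot (- x) y = - dot x y.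
Proof. by rewrite -scaleN1r dotZl mulN1r. Qed.

Lemma dotNr n (x y : 'cV[R]_n) : dot x (- y) = - dot x y.
Proof. by rewrite dotC dotNl dotC. Qed.

Lemma dotBl n (x y z : 'cV[R]_n) : dot (x - y) z = dot x z - dot y z.
Proof. by rewrite dotDl dotNl. Qed.

Lemma dotBr n (x y z : 'cV[R]_n) : dot x (y - z) = dot x y - dot x z.
Proof. by rewrite dotDr dotNr. Qed.

Lemma dot_mulmxl n p (A : 'M[R]_(n, p)) x y : dot (A *m x) y = dot x (A^T *m y).
Proof. by rewrite !dotE trmx_mul mulmxA. Qed.

Lemma dot_mulmxr n p (A : 'M[R]_(n, p)) x y : dot x (A *m y) = dot (A^T *m x) y.
Proof. by rewrite dot_mulmxl trmxK. Qed.

Lemma dot_delta n (i : 'I_n) (x : 'cV[R]_n) : dot (delta_mx i 0) x = x i 0.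
Proof.
rewrite /dot (bigD1 i)//= big1 ?addr0 ?mxE ?eqxx ?mul1r// => k /negbTE ki.
by rewrite mxE ki mul0r.
Qed.

Lemma sqnormE n (x : 'cV[R]_n) : sqnorm x = dot x x.
Proof. by apply: eq_bigr => i _; rewrite expr2. Qed.

Lemma sqnorm_ge0 n (x : 'cV[R]_n) : 0 <= sqnorm x.
Proof. by apply: sumr_ge0 => i _; exact: sqr_ge0. Qed.

Lemma sqnorm_ge_coord n (x : 'cV[R]_n) i : x i 0 ^+ 2 <= sqnorm x.
Proof. by rewrite /sqnorm (bigD1 i)//= lerDl sumr_ge0// => k _; exact: sqr_ge0. Qed.

Lemma sqnorm_eq0 n (x : 'cV[R]_n) : sqnorm x = 0 -> x = 0.
Proof.
move=> x0; apply/matrixP => i j; rewrite (ord1 j) mxE; apply/eqP.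
by rewrite -sqrf_eq0 eq_le sqr_ge0 andbT -x0 sqnorm_ge_coord.
Qed.

Lemma sqnorm_gt0 n (x : 'cV[R]_n) : x != 0 -> 0 < sqnorm x.
Proof.
by move=> x0; rewrite lt_neqAle sqnorm_ge0 andbT eq_sym; apply: contraNneq x0 => /sqnorm_eq0 ->.
Qed.

Lemma sqnormD n (x y : 'cV[R]_n) : sqnorm (x + y) = sqnorm x + 2 * dot x y + sqnorm y.
Proof. by rewrite !sqnormE dotDl !dotDr (dotC y x); ring. Qed.

Lemma sqnormB n (x y : 'cV[R]_n) : sqnorm (x - y) = sqnorm x - 2 * dot x y + sqnorm y.
Proof. by rewrite !sqnormE dotBl !dotBr (dotC y x); ring. Qed.

Lemma sqnormZ n c (x : 'cV[R]_n) : sqnorm (c *: x) = c ^+ 2 * sqnorm x.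
Proof. by rewrite !sqnormE dotZl dotZr expr2 mulrA. Qed.

Lemma dot_mulmx_bound n (A : 'M[R]_n) :
  exists2 C, 0 < C & forall x, `|dot x (A *m x)| <= C * sqnorm x.
Proof.
exists (1 + \sum_i \sum_j `|A i j|).
  by rewrite ltr_wpDr// sumr_ge0// => i _; exact: sumr_ge0.
move=> x; rewrite mulrDl mul1r; apply: ler_wpDl; first exact: sqnorm_ge0.
rewrite /dot (le_trans (ler_norm_sum _ _ _))// mulr_suml; apply: ler_sum => i _.
rewrite normrM mxE mulr_suml.
apply: (@le_trans _ _ (`|x i 0| * \sum_j `|A i j * x j 0|)).
  by rewrite ler_wpM2l// ler_norm_sum.
rewrite mulr_sumr; apply: ler_sum => j _; rewrite normrM mulrCA ler_wpM2l//.
have hi := sqnorm_ge_coord x i; have hj := sqnorm_ge_coord x j.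
rewrite -real_normK ?num_real// in hi; rewrite -real_normK ?num_real// in hj.
have := sqr_ge0 (`|x i 0| - `|x j 0|); nra.
Qed.

Lemma gram_dot n p (X : 'M[R]_(n, p)) (b c : 'cV[R]_p) :
  dot b (gram X *m c) = n%:R^-1 * dot (X *m b) (X *m c).
Proof. by rewrite /gram -scalemxAl dotZr -mulmxA dot_mulmxl. Qed.

Lemma gram_sym n p (X : 'M[R]_(n, p)) : (gram X)^T = gram X.
Proof. by rewrite /gram linearZ /= trmx_mul trmxK. Qed.

(* The infimum of the Rayleigh quotient is an eigenvalue: otherwise [A - m]
   would be positive semidefinite and invertible, hence bounded below by a
   positive multiple of the identity. *)
Lemma c_min_rayleigh p (A : 'M[R]_p) : (0 < p)%N -> A^T = A ->
  forall x, c_min A * sqnorm x <= dot x (A *m x).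
Proof.
move=> p0 As.
pose Ray := [set r | exists2 x : 'cV[R]_p, x != 0 & r = dot x (A *m x) / sqnorm x].
have [C C0 HC] := dot_mulmx_bound A.
have lRay : lbound Ray (- C).
  move=> _ [x x0 ->]; rewrite ler_pdivlMr ?sqnorm_gt0//.
  by have := HC x; rewrite ler_norml mulNr => /andP[].
have nRay : Ray !=set0.
  pose one : 'cV[R]_p := const_mx 1.
  exists (dot one (A *m one) / sqnorm one).
  exists one => //; apply/eqP => /matrixP /(_ (Ordinal p0) 0).
  by rewrite !mxE => /eqP; rewrite oner_eq0.
pose m := inf Ray.
have hm x : m * sqnorm x <= dot x (A *m x).
  have [->|x0] := eqVneq x 0.
    by rewrite mulmx0 !sqnormE /dot !big1 ?mulr0// => i _; rewrite mxE mul0r.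
  rewrite -ler_pdivlMr ?sqnorm_gt0//; apply: ge_inf; first by exists (- C).
  by exists x.
have eig a : eigenvalue A a -> m <= a.
  move=> /eigenvalueP[v vA v0].
  have vT0 : v^T != 0.
    by apply: contra_neq v0 => h; rewrite -(trmxK v) h trmx0.
  have := hm v^T; rewrite -{1}As -trmx_mul vA linearZ /= dotZr -sqnormE.
  by rewrite ler_pM2r// sqnorm_gt0.
suff em : eigenvalue A m.
  move=> x; apply: le_trans (hm x); rewrite ler_wpM2r ?sqnorm_ge0//.
  by apply: ge_inf => //; exists m => a /= /eig.
pose B := A - m%:M.
have Bs : B^T = B by rewrite /B linearB /= tr_scalar_mx As.
have Bq x : dot x (B *m x) = dot x (A *m x) - m * sqnorm x.
  by rewrite /B mulmxBl mul_scalar_mx dotBr dotZr sqnormE.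
have [uB|] := boolP (B \in unitmx); last first.
  rewrite unitmxE unitfE negbK => /det0P[v v0 vB].
  apply/eigenvalueP; exists v => //.
  by move: vB; rewrite /B mulmxBr mul_mx_scalar => /subr0_eq.
exfalso.
have [K K0 HK] := dot_mulmx_bound (invmx B).
(* The form of [B] is nonnegative at x - y/K, where B y = x. Expanding gives <x, B x> - 2 |x|^2 / K
   + <y, x> / K^2 >= 0, and <y, x> <= K |x|^2 leaves <x, B x> >= |x|^2 / K, against the choice of
   [m] as infimum. *)
have hm' : lbound Ray (m + K^-1).
  move=> _ [x x0 ->]; rewrite ler_pdivlMr ?sqnorm_gt0// mulrDl.
  pose y := invmx B *m x.
  have By : B *m y = x by rewrite mulKVmx.
  have : 0 <= dot (x - K^-1 *: y) (B *m (x - K^-1 *: y)) by rewrite Bq subr_ge0.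
  rewrite mulmxBr -scalemxAr By dotBl !dotBr !dotZl !dotZr.
  rewrite (dot_mulmxr B y x) Bs By Bq -!sqnormE.
  have := HK x; rewrite ler_norml => /andP[_]; rewrite -/y dotC => h h2.
  have : K^-1 * (K^-1 * dot y x) <= K^-1 * sqnorm x.
    by rewrite ler_wpM2l ?invr_ge0 ?(ltW K0)// mulrC ler_pdivrMr// mulrC.
  lra.
have : m + K^-1 <= m by apply: lb_le_inf.
by rewrite gerDl leNgt invr_gt0 K0.
Qed.

(** As [X] may be rank deficient, the projector is C (C'C)^-1 C' for a basis [C] of the column span.
    Cyclicity of the trace reduces it to an identity matrix whose size is the rank. *)
Lemma orth_projector n p (X : 'M[R]_(n, p)) : exists Pj : 'M[R]_n,
  [/\ Pj^T = Pj, Pj *m Pj = Pj, Pj *m X = X, \tr Pj = (\rank X)%:R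
    & forall v m, is_orth_proj X v m -> m = Pj *m v].
Proof.
pose C := col_base X.
have [B BC] := row_fullP (col_base_full X).
have [G RG] := row_freeP (row_base_free X).
have BC' : B *m C = 1%:M by [].
have CX : C *m row_base X = X by exact: mulmx_base.
have XG : X *m G = C by rewrite -[LHS](congr1 (mulmx^~ G) CX) -mulmxA RG mulmx1.
clearbody C; move: BC' => {}BC.
(* A kernel vector of C'C is sent to 0 by [C], its image having norm 0, and [C] has the left inverse
   [B]. *)
have uC : C^T *m C \in unitmx.
  rewrite -row_free_unit; apply: inj_row_free => v v0.
  have : C *m v^T = 0.
    apply: sqnorm_eq0; rewrite sqnormE dot_mulmxl mulmxA.
    have -> : C^T *m C *m v^T = 0.
      have e : (C^T *m C *m v^T)^T = 0 by rewrite trmx_mul trmxK trmx_mul trmxK v0.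
      by rewrite -[LHS]trmxK e trmx0.
    by rewrite /dot big1// => i _; rewrite [X in _ * X]mxE mulr0.
  move=> Cv; have : v^T = 0 by rewrite -[LHS]mul1mx -BC -mulmxA Cv mulmx0.
  by move=> h; rewrite -(trmxK v) h trmx0.
pose Pj := C *m invmx (C^T *m C) *m C^T.
have PC : Pj *m C = C by rewrite /Pj -!mulmxA mulVmx ?mulmx1.
have PX : Pj *m X = X.
  by have := congr1 (mulmx Pj) CX; rewrite mulmxA PC CX => <-.
exists Pj; split => //.
- by rewrite /Pj !trmx_mul trmxK trmx_inv trmx_mul trmxK mulmxA.
- by rewrite {2}/Pj !mulmxA PC.
- by rewrite /Pj mxtrace_mulC mulmxA mulmxV// mxtrace1.
- move=> v m [[b mE] orth].
  have X0 : X^T *m (v - m) = 0.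
    apply/matrixP => i j; rewrite (ord1 j) [RHS]mxE -dot_delta -dot_mulmxl dotC.
    exact: orth.
  have C0 : C^T *m (v - m) = 0 by rewrite -XG trmx_mul -mulmxA X0 mulmx0.
  have : Pj *m (v - m) = 0 by rewrite /Pj -mulmxA C0 mulmx0.
  have Pm : Pj *m m = m by rewrite mE mulmxA PX.
  by rewrite mulmxBr Pm => /subr0_eq.
Qed.

End Dot.

(** * The penalized least squares minimizer *)

(** The supremum is finite: it lies below [c] and above the quotient at the points 1 and 2. The
    resulting [K] may be negative. *)
Lemma max_concavity_bound {R : realType} (rho : R -> R) (c : R) :
  (max_concavity rho < c%:E)%E ->
  exists2 K, K < c & forall t1 t2, 0 < t1 -> t1 < t2 ->
    derive1 rho t1 - derive1 rho t2 <= K * (t2 - t1).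
Proof.
move=> kc.
have H t1 t2 : 0 < t1 -> t1 < t2 ->
    (((derive1 rho t1 - derive1 rho t2) / (t2 - t1))%:E <= max_concavity rho)%E.
  by move=> t10 t12; apply: ereal_sup_ubound; exists t1, t2.
have kfin : max_concavity rho \is a fin_num.
  rewrite fin_numE; apply/andP; split; last by apply: contraTneq kc => ->; rewrite -leNgt leey.
  have := H 1 2 ltr01 ltac:(by rewrite ltr1n).
  by apply: contraTneq => ->; rewrite leNgt ltNyr.
exists (fine (max_concavity rho)); first by rewrite -lte_fin fineK.
move=> t1 t2 t10 t12; rewrite -ler_pdivrMr ?subr_gt0//.
by rewrite -lee_fin fineK//; exact: H.
Qed.

Section PenaltyTheory.
Context {R : realType} (rho ddrho : R -> R) (lambda K : R).
Hypothesis lambda0 : 0 < lambda.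
Hypothesis hrho : penalty rho ddrho lambda.
Hypothesis hK : forall t1 t2, 0 < t1 -> t1 < t2 ->
  derive1 rho t1 - derive1 rho t2 <= K * (t2 - t1).

(** An infinite limit at 0 is impossible, because the concavity bound between [t] and 1 keeps
    [derive1 rho t] bounded; the normalization then identifies the finite limit. *)
Lemma penalty_derive1_cvg : derive1 rho t @[t --> 0^'+] --> lambda.
Proof.
have [l [lcvg l0 lfin]] := penalty_derive0 hrho.
have lnum : l \is a fin_num.
  rewrite ge0_fin_numE ?ltW// ltey; apply/eqP => loo; rewrite loo in lcvg.
  have /cvgeyPge /(_ (derive1 rho 1 + `|K| + 1)) : (derive1 rho t)%:E @[t --> 0^'+] --> +oo%E := lcvg.
  move=> H.
  have [t [/= h [t0 t1]]] := filter_ex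
    (filterI H (filterI (nbhs_right_gt (0 : R)) (nbhs_right_lt (@ltr01 R)))).
  rewrite lee_fin in h; have := hK t0 t1.
  have : K * (1 - t) <= `|K|.
    apply: (le_trans (ler_norm _)); rewrite normrM ler_piMr// ger0_norm; lra.
  lra.
by rewrite (lfin lnum) in lcvg; exact: (fine_cvg lcvg).
Qed.

(** The concavity bound between [s] and [t], as [s] tends to 0 from the right. *)
Lemma penalty_derive1_ge t : 0 < t -> lambda - K * t <= derive1 rho t.
Proof.
move=> t0; suff : lambda - derive1 rho t <= K * t by lra.
have c1 : derive1 rho s - derive1 rho t + K * s @[s --> 0^'+] --> lambda - derive1 rho t + K * 0.
  apply: cvgD; first by apply: cvgB; [exact: penalty_derive1_cvg|exact: cvg_cst].
  by apply: cvgM; [exact: cvg_cst|apply: cvg_at_right_filter; exact: cvg_id].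
rewrite -[leLHS]addr0 -(mulr0 K); apply: (cvgr_to_le c1).
near=> s.
have s0 : 0 < s by near: s; exact: nbhs_right_gt.
have st : s < t by near: s; exact: nbhs_right_lt.
have := hK s0 st; lra.
Unshelve. all: by end_near. Qed.

Lemma penalty_increment0 t : 0 < t ->
  exists2 c, 0 < c < t & rho t - rho 0 = derive1 rho c * t.
Proof.
move=> t0.
have [c /itvP cI ->] : exists2 c, c \in `]0, t[%R & rho t - rho 0 = derive1 rho c * (t - 0).
  apply: MVT => //.
    move=> x; rewrite in_itv/= => /andP[x0 _]; rewrite derive1E.
    exact/derivableP/(penalty_derivable hrho).
  apply/continuous_within_itvP => //; split.
  - move=> x; rewrite in_itv/= => /andP[x0 _].
    by apply/differentiable_continuous/derivable1_diffP/(penalty_derivable hrho).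
  - exact: penalty_continuous0 hrho.
  - apply: cvg_at_left_filter.
    by apply/differentiable_continuous/derivable1_diffP/(penalty_derivable hrho).
by exists c; rewrite ?subr0 ?cI.
Qed.

(** By the previous bound, [rho] plus [K / 2] times the square minus the linear term has nonnegative
    derivative. This makes the penalized loss coercive. *)
Lemma penalty_ge t : 0 <= t -> rho 0 + lambda * t - K / 2 * t ^+ 2 <= rho t.
Proof.
rewrite le_eqVlt => /predU1P[<-|t0]; first by rewrite expr0n/= !mulr0 subr0 addr0.
pose f s := rho s + (K / 2 * s ^+ 2 - lambda * s).
have df (x : R) : 0 < x -> is_derive x (1 : R) f (derive1 rho x + (K * x - lambda)).
  move=> x0; apply: is_deriveD.
    by rewrite derive1E; apply: DeriveDef => //; exact: (penalty_derivable hrho).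
  apply: is_derive_eq; rewrite !scaler1 /GRing.scale/=; by field.
have cf : forall z : R, 0 < z -> {for z, continuous f}.
  by move=> z z0; apply/differentiable_continuous/derivable1_diffP; have [] := df z z0.
have [c /itvP cI] : exists2 c, c \in `]0, t[%R &
    f t - f 0 = (derive1 rho c + (K * c - lambda)) * (t - 0).
  apply: MVT => //; first by move=> x; rewrite in_itv/= => /andP[x0 _]; exact: df.
  apply/continuous_within_itvP => //; split.
  - by move=> x; rewrite in_itv/= => /andP[x0 _]; exact: cf.
  - apply: cvgD; first exact: (penalty_continuous0 hrho).
    apply: cvg_at_right_filter.
    apply: cvgB; apply: cvgM; try exact: cvg_cst; try exact: cvg_id.
    exact: (@sqr_continuous _ 0).
  - by apply: cvg_at_left_filter; exact: cf.
rewrite /f expr0n/= !mulr0 !subr0 addr0.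
have : 0 <= (derive1 rho c + (K * c - lambda)) * t.
  apply: mulr_ge0; last exact: ltW.
  have c0 : 0 < c by rewrite cI.
  have := penalty_derive1_ge c0; lra.
lra.
Qed.

(* The graph of the subdifferential of [b |-> rho `|b|]. *)
Definition pgraph (b r : R) : Prop :=
  [/\ 0 < b -> r = derive1 rho b, b < 0 -> r = - derive1 rho (- b)
    & b = 0 -> `|r| <= lambda].

(** Adding K b^2 / 2 to the penalty makes it convex, and subgradients of a convex function are
    monotone. When the points are not on the same side of 0, the lower bound of [derive1 rho] by
    [lambda - K * t] replaces the concavity bound. *)
Lemma pgraph_monotone b r b' r' : pgraph b r -> pgraph b' r' ->
  - K * (b - b') ^+ 2 <= (b - b') * (r - r').
Proof.
wlog bb' : b r b' r' / b' < b.
  move=> H g g'; have [h|h|<-] := ltgtP b' b; first exact: H.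
    have := H _ _ _ _ h g' g; nra.
  by rewrite subrr expr0n mulr0 mul0r.
move=> [bp bn b0] [bp' bn' b0'].
suff h : - K * (b - b') <= r - r'.
  by rewrite expr2 mulrA mulrC ler_wpM2l// subr_ge0 ltW.
have [b1|b1|b1] := ltgtP b 0.
- have b1' := lt_trans bb' b1.
  rewrite bn// bn'//.
  have := @hK (- b) (- b') ltac:(by rewrite oppr_gt0) ltac:(by rewrite ltrN2); lra.
- rewrite bp//; have [b1'|b1'|b1'] := ltgtP b' 0.
  + rewrite bn'//.
    have := penalty_derive1_ge b1; have : 0 < - b' by rewrite oppr_gt0.
    move=> /penalty_derive1_ge; move: lambda0; lra.
  + rewrite bp'//; have := hK b1' bb'; lra.
  + have := b0' b1'; rewrite ler_norml => /andP[_ h].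
    by have := penalty_derive1_ge b1; rewrite b1'; lra.
- have b1' : b' < 0 by rewrite -b1.
  have := b0 b1; rewrite ler_norml => /andP[h _].
  rewrite bn'//; have : 0 < - b' by rewrite oppr_gt0.
  by move=> /penalty_derive1_ge; rewrite b1; lra.
Qed.

Lemma continuous_penalty_norm : continuous (fun t : R => rho `|t|).
Proof.
move=> t; have [t0|t0] := eqVneq t 0; last first.
  apply: (@continuous_comp _ _ _ (fun t : R => `|t|) rho); first exact: norm_continuous.
  apply/differentiable_continuous/derivable1_diffP/(penalty_derivable hrho).
  by rewrite normr_gt0.
rewrite t0; apply/cvgrPdist_lt => e e0.
have /cvgrPdist_lt /(_ _ e0) := penalty_continuous0 hrho.
move=> [d /= d0 Hd]; apply/nbhs_ballP; exists d => // s.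
rewrite /ball/= sub0r normrN normr0 => sd.
have [->|s0] := eqVneq s 0; first by rewrite normr0 subrr normr0.
by apply: Hd; rewrite ?normr_gt0//= sub0r normrN normr_id.
Qed.

End PenaltyTheory.

Lemma dot_norm_bound {R : realType} {n : nat} (x y : 'cV[R]_n) :
  `|dot x y| <= n%:R * `|x| * `|y|.
Proof.
rewrite (le_trans (ler_norm_sum _ _ _))//.
apply: (@le_trans _ _ (\sum_(i < n) `|x| * `|y|)).
  by apply: ler_sum => i _; rewrite normrM ler_pM// coord_le_norm.
by rewrite sumr_const card_ord -mulrA mulr_natl.
Qed.

Lemma sqr_norm_le_sqnorm {R : realType} {n : nat} (x : 'cV[R]_n) :
  `|x| ^+ 2 <= sqnorm x.
Proof.
have [->|x0] := eqVneq `|x| 0; first by rewrite expr0n sqnorm_ge0.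
have [[i j] /= xi] := mx_norm_neq0 x0.
rewrite [X in X ^+ 2]xi (ord1 j) real_normK ?num_real//; exact: sqnorm_ge_coord.
Qed.

Lemma mulmx_delta {R : realType} {m n : nat} (A : 'M[R]_(m, n)) (i : 'I_m) (j : 'I_n) :
  (A *m delta_mx j (0 : 'I_1)) i 0 = A i j.
Proof.
rewrite mxE (bigD1 j)//= big1 ?addr0 ?mxE ?eqxx ?mulr1// => k /negbTE kj.
by rewrite mxE kj mulr0.
Qed.

Section Minimizer.
Context {R : realType} {n p : nat} (X : 'M[R]_(n, p)).
Context (rho ddrho : R -> R) (lambda K : R).
Hypotheses (n0 : (0 < n)%N) (p0 : (0 < p)%N).
Hypothesis lambda0 : 0 < lambda.
Hypothesis hrho : penalty rho ddrho lambda.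
Hypothesis Kc : K < c_min (gram X).
Hypothesis hK : forall t1 t2, 0 < t1 -> t1 < t2 ->
  derive1 rho t1 - derive1 rho t2 <= K * (t2 - t1).

Let delta := c_min (gram X) - K.
Let delta0 : 0 < delta. Proof. by rewrite subr_gt0. Qed.

Let nR0 : n%:R != 0 :> R. Proof. by rewrite pnatr_eq0 -lt0n. Qed.

(** Minus the gradient in [b] of the least squares term, so stationarity says that it is a
    subgradient of the penalty. *)
Definition score (v : 'cV[R]_n) (b : 'cV[R]_p) : 'cV[R]_p :=
  n%:R^-1 *: (X^T *m (v - X *m b)).

Lemma gram_ge (b : 'cV[R]_p) : c_min (gram X) * sqnorm b <= dot b (gram X *m b).
Proof. by apply: c_min_rayleigh => //; exact: gram_sym. Qed.

Lemma scoreB v v' b b' : score v b - score v' b' =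
  n%:R^-1 *: (X^T *m (v - v')) - gram X *m (b - b').
Proof.
rewrite /score /gram -scalerBr -mulmxBr -scalemxAl -scalerBr; congr (_ *: _).
rewrite -mulmxA -!mulmxBr; congr (_ *m _); rewrite mulmxBr.
by apply/matrixP => i j; move: (X *m b) (X *m b') => c c'; rewrite !mxE; ring.
Qed.

Lemma penalized_loss_diff v (b h : 'cV[R]_p) :
  penalized_loss X rho v (b + h) - penalized_loss X rho v b =
  - dot h (score v b) + dot h (gram X *m h) / 2 +
  \sum_(j < p) (rho `|b j 0 + h j 0| - rho `|b j 0|).
Proof.
rewrite /penalized_loss sumrB.
have -> : v - X *m (b + h) = (v - X *m b) - X *m h by rewrite mulmxDr opprD addrA.
rewrite sqnormB /score dotZr -dot_mulmxl gram_dot -sqnormE (dotC (X *m h)).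
have -> : \sum_(j < p) rho `|(b + h) j 0| = \sum_(j < p) rho `|b j 0 + h j 0|.
  by apply: eq_bigr => j _; rewrite mxE.
by field.
Qed.

(** Only one coordinate is perturbed, so the quadratic part changes by a polynomial in the step.
    Dividing by the step and letting it tend to 0, from both sides or, at a zero coordinate, in each
    direction, gives the three cases. *)
Lemma argmin_pgraph v b : is_argmin (penalized_loss X rho v) b ->
  forall j, pgraph rho lambda (b j 0) (score v b j 0).
Proof.
move=> bmin j.
pose S := gram X j j.
have H t : 0 <= - (t * score v b j 0) + t ^+ 2 * S / 2 + (rho `|b j 0 + t| - rho `|b j 0|).
  have := bmin (b + t *: delta_mx j 0); rewrite -subr_ge0 penalized_loss_diff.
  rewrite dotZl dot_delta -scalemxAr dotZl dotZr dot_delta.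
  rewrite mulmx_delta -/S.
  rewrite (bigD1 j)//= big1 ?addr0; last first.
    by move=> k /negbTE kj; rewrite !mxE kj mulr0 addr0 subrr.
  by rewrite !mxE !eqxx mulr1 (mulrA t t) -expr2.
set r := score v b j 0 in H *.
(* The sign [s] treats positive and negative coordinates together: [c] is the absolute value of the
   coordinate and [h] its increment. *)
have Hq (s c h : R) : s ^+ 2 = 1 -> 0 <= c -> 0 <= c + h -> b j 0 = s * c ->
    h * (s * r) <= h ^+ 2 * S / 2 + (rho (c + h) - rho c).
  move=> s1 c0 ch bE; have := H (s * h).
  have ns : `|s| = 1.
    by apply/eqP; rewrite -(@eqrXn2 _ 2)// ?expr1n ?real_normK ?num_real ?s1//.
  rewrite bE -mulrDr !normrM ns !mul1r (ger0_norm c0) (ger0_norm ch) exprMn s1 mul1r.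
  lra.
have Hpos (s c : R) : s ^+ 2 = 1 -> 0 < c -> b j 0 = s * c -> s * r = derive1 rho c.
  move=> s1 c0 bE.
  have dq : h^-1 *: (rho (h *: 1 + c) - rho c) @[h --> (0 : R)^'] --> derive1 rho c.
    by rewrite derive1E; exact: (penalty_derivable hrho c0).
  have lin : h * S / 2 @[h --> (0 : R)] --> (0 : R).
    rewrite -[X in _ --> X](mul0r (S / 2)); under eq_fun do rewrite -mulrA.
    by apply: cvgM; [exact: cvg_id|exact: cvg_cst].
  apply/eqP; rewrite eq_le; apply/andP; split.
    have c1 : h * S / 2 + h^-1 *: (rho (h *: 1 + c) - rho c) @[h --> (0 : R)^'+] --> 0 + derive1 rho c.
      by apply: cvgD; [exact: cvg_at_right_filter lin|exact: cvg_dnbhs_at_right].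
    rewrite -[leRHS]add0r; apply: (cvgr_to_ge c1); near=> h.
    have h0 : 0 < h by near: h; exact: nbhs_right_gt.
    have := Hq s c h s1 (ltW c0) (addr_ge0 (ltW c0) (ltW h0)) bE.
    rewrite [h *: 1]mulr1 /GRing.scale/= (addrC h) => /le_trans hh; rewrite -(ler_pM2l h0); apply: hh.
    rewrite le_eqVlt; apply/orP; left; apply/eqP.
    by field; rewrite gt_eqF.
  have c1 : h * S / 2 + h^-1 *: (rho (h *: 1 + c) - rho c) @[h --> (0 : R)^'-] --> 0 + derive1 rho c.
    by apply: cvgD; [exact: cvg_at_left_filter lin|exact: cvg_dnbhs_at_left].
  rewrite -[leLHS]add0r; apply: (cvgr_to_le c1); near=> h.
  have h0 : h < 0 by near: h; exact: nbhs_left_lt.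
  have hc : - c < h by near: h; apply: nbhs_left_gt; rewrite oppr_lt0.
  have hc0 : 0 <= c + h by lra.
  have := Hq s c h s1 (ltW c0) hc0 bE.
  rewrite [h *: 1]mulr1 /GRing.scale/= (addrC h) => /le_trans hh; rewrite -(ler_nM2l h0); apply: hh.
  rewrite le_eqVlt; apply/orP; left; apply/eqP.
  by field; rewrite lt_eqF.
split => [b0|b0|b0].
- have := Hpos 1 (b j 0); rewrite !mul1r expr1n; exact.
- have := Hpos (- 1) (- b j 0); rewrite mulrNN !mul1r sqrrN expr1n oppr_gt0 mulN1r.
  by move=> /(_ erefl b0 erefl) <-; rewrite opprK.
- have Hz s : s ^+ 2 = 1 -> s * r <= lambda.
    move=> s1.
    apply/ler_addgt0Pr => e e0; have e20 : 0 < e / 2 by rewrite divr_gt0.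
    have /cvgrPdist_lt /(_ _ e20) [dd /= d0 Hd] := penalty_derive1_cvg hrho hK.
    (* One half of [e] pays for the quadratic term t S / 2, the other for the distance from [lambda]
       of [derive1 rho] at the mean value point below [t]. *)
    pose t := Num.min (dd / 2) (e / (`|S| + 1)).
    have S1 : 0 < `|S| + 1 by rewrite ltr_wpDl.
    have t0 : 0 < t by rewrite /t lt_min !divr_gt0.
    have td : t < dd by rewrite /t gt_min ltr_pdivrMr// ltr_pMr// ltr1n.
    have tS : t * S <= e.
      apply: (@le_trans _ _ (t * (`|S| + 1))).
        by rewrite ler_wpM2l ?(ltW t0)// (le_trans (ler_norm S))// lerDl.
      by rewrite -ler_pdivlMr// /t ge_min lexx orbT.
    have [c /andP[c0 ct] cE] := penalty_increment0 hrho t0.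
    have : `|lambda - derive1 rho c| < e / 2.
      by apply: Hd => //=; rewrite sub0r normrN gtr0_norm// (lt_trans ct).
    have := Hq s 0 t s1 (lexx _); rewrite add0r mulr0 => /(_ (ltW t0) b0).
    rewrite cE expr2 -mulrA -mulrA (mulrC _ t) -mulrDr ler_pM2l//.
    rewrite ltr_norml => h /andP[h' _]; lra.
  rewrite ler_norml; apply/andP; split; last by rewrite -(mul1r r) Hz// expr1n.
  by rewrite lerNl -mulN1r Hz// sqrrN expr1n.
Unshelve. all: by end_near. Qed.

(** The quadratic part is strongly monotone with constant [c_min (gram X)] and the penalty loses at
    most [K]; [delta] is what remains. *)
Lemma argmin_lipschitz v v' b b' :
  is_argmin (penalized_loss X rho v) b -> is_argmin (penalized_loss X rho v') b' ->
  delta * sqnorm (b - b') <= dot (b - b') (n%:R^-1 *: (X^T *m (v - v'))).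
Proof.
move=> /argmin_pgraph g /argmin_pgraph g'.
have : - K * sqnorm (b - b') <= dot (b - b') (score v b - score v' b').
  rewrite /sqnorm mulr_sumr; apply: ler_sum => j _.
  rewrite !mxE; have := pgraph_monotone lambda0 hrho hK (g j) (g' j).
  by rewrite /score !mxE.
rewrite scoreB dotBr; have := gram_ge (b - b'); rewrite /delta; lra.
Qed.

End Minimizer.

Lemma mulmx_norm_bound {R : realType} {m n : nat} (A : 'M[R]_(m, n)) (x : 'cV[R]_n) :
  `|A *m x| <= (\sum_i \sum_j `|A i j|) * `|x|.
Proof.
have A0 : 0 <= \sum_i \sum_j `|A i j| by apply: sumr_ge0 => i _; exact: sumr_ge0.
have [->|x0] := eqVneq `|A *m x| 0; first by rewrite mulr_ge0.
have [[i j] /= xi] := mx_norm_neq0 x0.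
rewrite [leLHS]xi (ord1 j) mxE (le_trans (ler_norm_sum _ _ _))//.
apply: (@le_trans _ _ ((\sum_j `|A i j|) * `|x|)).
  rewrite mulr_suml; apply: ler_sum => k _.
  by rewrite normrM ler_wpM2l// coord_le_norm.
by rewrite ler_wpM2r// [leRHS](bigD1 i)//= lerDl sumr_ge0// => k _; exact: sumr_ge0.
Qed.

Lemma ler_divr_sqr {R : realType} (e t z : R) : 0 < e -> 0 <= t -> 0 <= z ->
  e * t ^+ 2 <= t * z -> t <= z / e.
Proof.
move=> e0 t0 z0 h; rewrite ler_pdivlMr//.
move: t0; rewrite le_eqVlt => /predU1P[<-|t0]; first by rewrite mul0r.
by rewrite -(ler_pM2l t0) (le_trans _ h)// (_ : _ * _ = e * t ^+ 2)//; ring.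
Qed.

Lemma cvg_sumr {R : realType} {I T : Type} (F : set_system T) (r : seq I)
    (f : I -> T -> R) (l : I -> R) : Filter F ->
  (forall i, f i x @[x --> F] --> l i) ->
  \sum_(i <- r) f i x @[x --> F] --> \sum_(i <- r) l i.
Proof. by move=> FF h; apply: cvg_big => //; exact: add_continuous. Qed.

Section Minimizer.
Context {R : realType} {n p : nat} (X : 'M[R]_(n, p)).
Context (rho ddrho : R -> R) (lambda K : R).
Hypotheses (n0 : (0 < n)%N) (p0 : (0 < p)%N).
Hypothesis lambda0 : 0 < lambda.
Hypothesis hrho : penalty rho ddrho lambda.
Hypothesis Kc : K < c_min (gram X).
Hypothesis hK : forall t1 t2, 0 < t1 -> t1 < t2 ->
  derive1 rho t1 - derive1 rho t2 <= K * (t2 - t1).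

Let delta := c_min (gram X) - K.
Let delta0 : 0 < delta. Proof. by rewrite subr_gt0. Qed.

Lemma argmin_norm_bound : exists2 L, 0 <= L & forall v v' b b',
  is_argmin (penalized_loss X rho v) b -> is_argmin (penalized_loss X rho v') b' ->
  `|b - b'| <= L * `|n%:R^-1 *: (X^T *m (v - v'))|.
Proof.
exists (p%:R / delta); first by rewrite divr_ge0// ltW.
move=> v v' b b' bm bm'; set u := n%:R^-1 *: _.
have := argmin_lipschitz n0 p0 lambda0 hrho hK bm bm'; rewrite -/delta -/u.
have h1 := sqr_norm_le_sqnorm (b - b').
have h2 := le_trans (ler_norm _) (dot_norm_bound (b - b') u).
move=> h3; have {h1 h2 h3} : delta * `|b - b'| ^+ 2 <= p%:R * `|b - b'| * `|u|.
  by apply: le_trans h2; apply: le_trans h3; rewrite ler_wpM2l// ltW.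
rewrite (_ : p%:R * _ * _ = `|b - b'| * (p%:R * `|u|)); last by ring.
by move=> /(ler_divr_sqr delta0 (normr_ge0 _)) h; rewrite mulrAC h// mulr_ge0.
Qed.

Lemma argmin_unique v b b' : is_argmin (penalized_loss X rho v) b ->
  is_argmin (penalized_loss X rho v) b' -> b = b'.
Proof.
have [L _ HL] := argmin_norm_bound => bm bm'.
have := HL v v b b' bm bm'; rewrite subrr mulmx0 scaler0 normr0 mulr0 normr_le0.
by move=> /eqP /subr0_eq.
Qed.

(** At a point not worse than 0, the quadratic lower bound yields delta |b|^2 / 2 <= <b, score>, and
    the sup norm bounds the scalar product with a factor [p]. *)
Lemma argmin_sublevel v b : penalized_loss X rho v b <= penalized_loss X rho v 0 ->
  `|b| <= 2 * p%:R / delta * `|score X v 0|.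
Proof.
rewrite -subr_le0 -{1}(add0r b) penalized_loss_diff//.
have h0 : \sum_(j < p) (lambda * `|b j 0| - K / 2 * b j 0 ^+ 2) <=
    \sum_(j < p) (rho `|(0 : 'cV[R]_p) j 0 + b j 0| - rho `|(0 : 'cV[R]_p) j 0|).
  apply: ler_sum => j _; rewrite !mxE add0r normr0.
  have := penalty_ge hrho hK (normr_ge0 (b j 0)).
  by rewrite real_normK ?num_real//; lra.
have h1 : - (K / 2) * sqnorm b <= \sum_(j < p) (lambda * `|b j 0| - K / 2 * b j 0 ^+ 2).
  rewrite /sqnorm mulr_sumr; apply: ler_sum => j _.
  by have := mulr_ge0 (ltW lambda0) (normr_ge0 (b j 0)); lra.
have h2 := gram_ge X p0 b.
have h3 := le_trans (ler_norm _) (dot_norm_bound b (score X v 0)).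
have h4 : delta * `|b| ^+ 2 <= delta * sqnorm b.
  by rewrite ler_wpM2l ?sqr_norm_le_sqnorm// ltW.
move=> h5; have {h0 h1 h2 h3 h4 h5} : delta * `|b| ^+ 2 <= 2 * (p%:R * `|b| * `|score X v 0|).
  apply: (le_trans h4); rewrite /delta; lra.
rewrite (_ : 2 * _ = `|b| * (2 * p%:R * `|score X v 0|)); last by ring.
by move=> /(ler_divr_sqr delta0 (normr_ge0 _)) h; rewrite mulrAC h// !mulr_ge0.
Qed.

Lemma continuous_penalized_loss v :
  continuous (fun u : 'rV[R]_p => penalized_loss X rho v u^T).
Proof.
move=> u.
have cc j : (fun u : 'rV[R]_p => u 0 j) u @[u --> u] --> u 0 j by exact: coord_continuous.
rewrite (_ : (fun _ => _) = fun u : 'rV[R]_p => (2 * n%:R)^-1 *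
    \sum_(i < n) (v i 0 - \sum_(j < p) X i j * u 0 j) ^+ 2 + \sum_(j < p) rho `|u 0 j|); last first.
  apply/funext => w; rewrite /penalized_loss /sqnorm; congr (_ * _ + _).
    apply: eq_bigr => i _; rewrite !mxE; congr ((_ - _) ^+ 2).
    by apply: eq_bigr => j _; rewrite mxE.
  by apply: eq_bigr => j _; rewrite mxE.
have h1 i : (v i 0 - \sum_(j < p) X i j * (w : 'rV[R]_p) 0 j) ^+ 2 @[w --> u] -->
    (v i 0 - \sum_(j < p) X i j * u 0 j) ^+ 2.
  have h : v i 0 - \sum_(j < p) X i j * (w : 'rV[R]_p) 0 j @[w --> u] -->
      v i 0 - \sum_(j < p) X i j * u 0 j.
    have h0 j : X i j * (w : 'rV[R]_p) 0 j @[w --> u] --> X i j * u 0 j.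
      exact: (cvgM (cvg_cst _) (cc j)).
    have h0' := @cvg_sumr _ _ _ _ (index_enum _) _ _ (nbhs_filter u) h0.
    exact: (cvgB (cvg_cst _) h0').
  rewrite expr2; under eq_fun do rewrite expr2; exact: (cvgM h h).
have h2 j : rho `|(w : 'rV[R]_p) 0 j| @[w --> u] --> rho `|u 0 j|.
  apply: (@continuous_comp _ _ _ (fun u : 'rV[R]_p => u 0 j) (fun t : R => rho `|t|)).
    exact: cc.
  exact: (continuous_penalty_norm hrho).
have {}h1 := @cvg_sumr _ _ _ _ (index_enum _) _ _ (nbhs_filter u) h1.
have {}h2 := @cvg_sumr _ _ _ _ (index_enum _) _ _ (nbhs_filter u) h2.
exact: (cvgD (cvgM (cvg_cst _) h1) h2).
Qed.

(** A minimizer over a box containing every point not worse than 0 is a global one, because 0 itself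
    lies in the box. *)
Lemma argmin_exists v : exists b, is_argmin (penalized_loss X rho v) b.
Proof.
pose M := 2 * p%:R / delta * `|score X v 0|.
have M0 : 0 <= M by rewrite mulr_ge0// divr_ge0// ltW.
pose A := [set u : 'rV[R]_p | forall j, `[- M, M]%classic (u ord0 j)].
have cA : compact A.
  by apply: (@rV_compact R p (fun=> `[- M, M]%classic)) => _; exact: segment_compact.
have A0 : A 0 by move=> j; rewrite /= mxE in_itv/= oppr_le0 M0.
have [u uA umin] := @EVT_min_rV R p (fun u => penalized_loss X rho v u^T) A
  (ex_intro _ _ A0) cA (continuous_subspaceT (@continuous_penalized_loss v)).
exists u^T => b.
have [h|h] := leP (penalized_loss X rho v b) (penalized_loss X rho v 0).
  rewrite -(trmxK b); apply: umin; rewrite inE => j /=.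
  rewrite mxE in_itv/= -ler_norml.
  by apply: le_trans (argmin_sublevel h); exact: coord_le_norm.
have h0 := umin 0; rewrite linear0 in h0.
by apply: le_trans (ltW h); apply: h0; rewrite inE.
Qed.

(** A zero column forces [c_min (gram X) <= 0], hence [K < 0], and then [derive1 rho] exceeds
    [lambda] and never vanishes, whereas the score of that coordinate is 0. The data do not move
    along a zero column, so this case has to be settled apart. *)
Lemma argmin_zero_column v b k : is_argmin (penalized_loss X rho v) b ->
  col k X = 0 -> b k 0 = 0.
Proof.
move=> bm Xk.
have Xe : X *m delta_mx k (0 : 'I_1) = 0.
  apply/matrixP => i j; rewrite (ord1 j) mulmx_delta mxE.
  by have := congr1 (fun A : 'cV[R]_n => A i 0) Xk; rewrite !mxE.
have K0 : K < 0.
  apply: (lt_le_trans Kc); have := gram_ge X p0 (delta_mx k 0).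
  rewrite gram_dot Xe; rewrite (_ : dot 0 0 = 0) ?mulr0; last first.
    by rewrite /dot big1// => i _; rewrite mxE mul0r.
  by rewrite sqnormE dot_delta mxE !eqxx mulr1.
have r0 : score X v b k 0 = 0.
  by rewrite -dot_delta /score dotZr -dot_mulmxl Xe /dot big1 ?mulr0// => i _; rewrite mxE mul0r.
have [gp gn _] := argmin_pgraph n0 hrho hK bm k.
have pos t : 0 < t -> derive1 rho t != 0.
  move=> t0; rewrite gt_eqF//; apply: lt_le_trans (penalty_derive1_ge hrho hK t0).
  by rewrite subr_gt0; apply: lt_trans lambda0; rewrite nmulr_rlt0.
have [h|h|//] := ltgtP (b k 0) 0.
- have := gn h; rewrite r0 => /eqP; rewrite eq_sym oppr_eq0 (negbTE (pos _ _))//.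
  by rewrite oppr_gt0.
- by have := gp h; rewrite r0 => /eqP; rewrite eq_sym (negbTE (pos _ _)).
Qed.

(** The form stays positive in coordinate [k] even though that coordinate receives no help from the
    penalty. For [K >= 0] this is strong convexity. For [K < 0] the Gram matrix may be singular;
    then - K |d|^2 controls the vector [d] of the other coordinates, and X c - X d is c_k times the
    nonzero column. *)
Lemma column_curvature k : col k X != 0 -> exists2 e, 0 < e & forall c : 'cV[R]_p,
  e * c k 0 ^+ 2 <= dot c (gram X *m c) - K * (sqnorm c - c k 0 ^+ 2).
Proof.
move=> Xk; have [K0|K0] := leP 0 K.
  exists delta => // c; have := gram_ge X p0 c.
  have := sqnorm_ge_coord c k => h1 h2.
  have : delta * c k 0 ^+ 2 <= delta * sqnorm c by rewrite ler_wpM2l// ltW.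
  have := mulr_ge0 K0 (sqr_ge0 (c k 0)); rewrite /delta; lra.
have [C C0 HC] := dot_mulmx_bound (gram X).
pose S := n%:R^-1 * sqnorm (col k X).
have S0 : 0 < S by rewrite mulr_gt0 ?sqnorm_gt0// invr_gt0 ltr0n.
(* m <= 1 lets the form at [c] absorb its own multiple, and m C <= - K lets - K |d|^2 absorb the
   form at [d]. *)
pose m := Num.min 1 (- K / C).
have m0 : 0 < m by rewrite lt_min ltr01 divr_gt0// oppr_gt0.
exists (m * S / 2); first by rewrite divr_gt0// mulr_gt0.
move=> c; pose d := c - c k 0 *: delta_mx k 0.
have dE : sqnorm d = sqnorm c - c k 0 ^+ 2.
  rewrite /d sqnormB sqnormZ dotZr dotC dot_delta.
  by rewrite [sqnorm (delta_mx _ _)]sqnormE dot_delta mxE !eqxx/=; ring.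
have hd := le_trans (ler_norm _) (HC d).
have d0 := sqnorm_ge0 d.
have q0 : 0 <= dot c (gram X *m c).
  by rewrite gram_dot mulr_ge0 ?invr_ge0// -sqnormE sqnorm_ge0.
have par : S * c k 0 ^+ 2 <= 2 * dot c (gram X *m c) + 2 * dot d (gram X *m d).
  have -> : S * c k 0 ^+ 2 = n%:R^-1 * sqnorm (X *m c - X *m d).
    rewrite -mulmxBr /d opprB addrCA subrr addr0 -scalemxAr sqnormZ /S.
    rewrite (_ : X *m delta_mx k 0 = col k X); first by ring.
    by apply/matrixP => i j; rewrite (ord1 j) mulmx_delta mxE.
  rewrite !gram_dot -!sqnormE !(mulrCA 2) -mulrDr ler_wpM2l ?invr_ge0//.
  have := sqnorm_ge0 (X *m c + X *m d); rewrite sqnormD sqnormB; lra.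
have h1 : m * dot c (gram X *m c) <= dot c (gram X *m c).
  by rewrite ler_piMl// ge_min lexx.
have h2 : m * dot d (gram X *m d) <= - K * sqnorm d.
  apply: (@le_trans _ _ (m * (C * sqnorm d))); first by rewrite ler_wpM2l// ltW.
  rewrite mulrA ler_wpM2r// -ler_pdivlMr//.
  by rewrite /m ge_min lexx orbT.
have : m * (S * c k 0 ^+ 2) <= m * (2 * dot c (gram X *m c) + 2 * dot d (gram X *m d)).
  by rewrite ler_wpM2l// ltW.
rewrite -dE; lra.
Qed.

(** Moving the data by [s] along column [k] leaves the residual of [b] shifted by - s in coordinate
    [k]. With [c] the difference of the shifted minimizers, the scores differ by minus the Gram
    matrix times [c], and [c] agrees with b - b' off [k], where the subgradients are monotone.
    [column_curvature] then bounds c_k by the increment of the [k]-th score, and s - s' is the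
    increment of coordinate [k] minus c_k. *)
Lemma argmin_line k : col k X != 0 -> exists2 C, 0 < C & forall v (s s' : R) b b',
  is_argmin (penalized_loss X rho (v + s *: col k X)) b ->
  is_argmin (penalized_loss X rho (v + s' *: col k X)) b' ->
  `|s - s'| <= C * (`|b k 0 - b' k 0| +
    `|score X (v + s *: col k X) b k 0 - score X (v + s' *: col k X) b' k 0|).
Proof.
move=> Xk; have [e e0 He] := column_curvature Xk.
exists (1 + e^-1); first by rewrite ltr_wpDr// invr_ge0 ltW.
move=> v s s' b b' bm bm'.
have g := argmin_pgraph n0 hrho hK bm.
have g' := argmin_pgraph n0 hrho hK bm'.
set r := score _ _ b in g *; set r' := score _ _ b' in g' *.
pose tau := s - s'.
pose c := b - b' - tau *: delta_mx k 0.
have rE : r - r' = - (gram X *m c).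
  rewrite /r /r' scoreB//; rewrite opprD addrACA subrr add0r -scalerBl -/tau.
  rewrite /c [gram X *m (_ - tau *: _)]mulmxBr opprB; congr (_ - _).
  rewrite -scalemxAr -scalemxAr scalerA mulrC -scalerA; congr (_ *: _).
  rewrite /gram -scalemxAl -mulmxA; congr (_ *: (_ *m _)).
  by apply/matrixP => i j; rewrite (ord1 j) mulmx_delta mxE.
have ck : c k 0 = b k 0 - b' k 0 - tau by rewrite !mxE !eqxx mulr1.
have cj j : j != k -> c j 0 = b j 0 - b' j 0.
  by move=> /negbTE jk; rewrite !mxE jk mulr0 subr0.
have hq : dot c (gram X *m c) - K * (sqnorm c - c k 0 ^+ 2) <= `|c k 0| * `|r k 0 - r' k 0|.
  have -> : gram X *m c = - (r - r') by rewrite rE opprK.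
  rewrite dotNr /sqnorm (bigD1 k)//= [dot _ _](bigD1 k)//= addrAC subrr add0r.
  have h1 : - K * (\sum_(i < p | i != k) c i 0 ^+ 2) <= \sum_(i < p | i != k) c i 0 * (r - r') i 0.
    rewrite mulr_sumr; apply: ler_sum => i ik; rewrite cj// [(r - r') i 0]mxE [(- r') i 0]mxE.
    exact: (pgraph_monotone lambda0 hrho hK (g i) (g' i)).
  have h2 : - (c k 0 * (r - r') k 0) <= `|c k 0| * `|r k 0 - r' k 0|.
    by rewrite -normrM [(r - r') k 0]mxE [(- r') k 0]mxE -normrN ler_norm.
  lra.
have := le_trans (He c) hq.
rewrite -(@real_normK _ (c k 0)) ?num_real// expr2 mulrCA => h.
have {}h : e * `|c k 0| <= `|r k 0 - r' k 0|.
  have [->|c0] := eqVneq `|c k 0| 0; first by rewrite mulr0.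
  by rewrite -(ler_pM2l (_ : 0 < `|c k 0|))// lt_neqAle eq_sym c0 normr_ge0.
have {}h : `|c k 0| <= e^-1 * `|r k 0 - r' k 0| by rewrite mulrC ler_pdivlMr// mulrC.
have ht : `|tau| <= `|b k 0 - b' k 0| + `|c k 0|.
  by rewrite (_ : tau = (b k 0 - b' k 0) - c k 0) ?ler_normB// ck; ring.
apply: (le_trans ht); rewrite mulrDl mul1r mulrDr.
have := mulr_ge0 (ltW (_ : 0 < e^-1)) (normr_ge0 (b k 0 - b' k 0)); rewrite invr_gt0 => /(_ e0).
have := normr_ge0 (r k 0 - r' k 0); lra.
Qed.

End Minimizer.

(** * The matrix Q on the active coordinates *)

Section SupportMatrix.
Context {R : realType} {p : nat} (Sigma : 'M[R]_p) (f : R -> R) (b : 'cV[R]_p).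

Lemma Pmx_mulE (c : 'cV[R]_p) j : (Pmx b *m c) j 0 = c (supp_idx j) 0.
Proof. by rewrite /Pmx mul_rowsub_mx mul1mx mxE. Qed.

Lemma Pmx_mul_tr : Pmx b *m (Pmx b)^T = 1%:M.
Proof.
apply/matrixP => i j; rewrite /Pmx mul_rowsub_mx mul1mx !mxE.
by rewrite /supp_idx (inj_eq enum_val_inj) eq_sym.
Qed.

Lemma Pmx_tr_mulE (z : 'cV[R]_#|supp b|) k :
  ((Pmx b)^T *m z) k 0 = \sum_(j | supp_idx j == k) z j 0.
Proof.
rewrite mxE [RHS]big_mkcond; apply: eq_bigr => j _; rewrite !mxE.
by case: eqP => _; rewrite ?mul1r ?mul0r.
Qed.

Lemma Pmx_tr_mul0 (z : 'cV[R]_#|supp b|) k : b k 0 = 0 -> ((Pmx b)^T *m z) k 0 = 0.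
Proof.
move=> bk; rewrite Pmx_tr_mulE big_pred0// => j; apply/eqP => jk.
by have := enum_valP j; rewrite inE -/(supp_idx j) jk bk eqxx.
Qed.

Lemma Pmx_tr_mulK (c : 'cV[R]_p) : (forall k, b k 0 = 0 -> c k 0 = 0) ->
  (Pmx b)^T *m (Pmx b *m c) = c.
Proof.
move=> c0; apply/matrixP => k j; rewrite (ord1 j){j}.
have [bk|bk] := eqVneq (b k 0) 0; first by rewrite Pmx_tr_mul0// c0.
have kb : k \in supp b by rewrite inE.
rewrite Pmx_tr_mulE (big_pred1 (enum_rank_in kb k)).
  by rewrite Pmx_mulE /supp_idx enum_rankK_in.
move=> j; rewrite /= -(inj_eq enum_val_inj) enum_rankK_in//.
Qed.

Let M := Sigma + diag_mx (\row_k f `|b k 0|).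

Lemma QmxE : Qmx Sigma f b = Pmx b *m M *m (Pmx b)^T.
Proof.
rewrite /Pmx mul_rowsub_mx mul1mx; apply/matrixP => i j; rewrite !mxE.
rewrite (bigD1 (supp_idx j))//= big1 ?addr0 => [|k /negbTE kj]; last first.
  by rewrite !mxE [supp_idx j == k]eq_sym kj mulr0.
by rewrite !mxE eqxx mulr1 /supp_idx (inj_eq enum_val_inj).
Qed.

(** A kernel vector, extended by 0 to all coordinates, would annihilate a form bounded below by
    [c - K] times the squared norm. *)
Lemma Qmx_unitmx (c K : R) : K < c ->
  (forall x, c * sqnorm x <= dot x (Sigma *m x)) ->
  (forall k, b k 0 != 0 -> - K <= f `|b k 0|) ->
  Qmx Sigma f b \in unitmx.
Proof.
move=> Kc Hc fK; rewrite unitmxE unitfE; apply/negP => /det0P[v v0 vQ].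
pose x := (Pmx b)^T *m v^T.
have x0 : dot x (M *m x) = 0.
  rewrite dotE /x trmx_mul !trmxK !mulmxA -(mulmxA v) -(mulmxA v) -QmxE vQ.
  by rewrite mul0mx mxE.
have xM : (c - K) * sqnorm x <= dot x (M *m x).
  rewrite /M mulmxDl dotDr mulrBl lerD// -mulNr /sqnorm mulr_sumr.
  apply: ler_sum => k _; have [bk|bk] := eqVneq (b k 0) 0.
    by rewrite Pmx_tr_mul0// expr0n mulr0 mul0r.
  rewrite mul_diag_mx !mxE -/x; have := fK k bk.
  by move: (x k 0) (sqr_ge0 (x k 0)) => t t0 h; nra.
have {}x0 : x = 0.
  apply: sqnorm_eq0; apply/eqP; rewrite eq_le sqnorm_ge0 andbT.
  by rewrite -(ler_pM2l (_ : 0 < c - K)) ?subr_gt0// mulr0 (le_trans xM)// x0.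
have : v^T = 0 by rewrite -(mul1mx v^T) -Pmx_mul_tr -mulmxA -/x x0 mulmx0.
by move=> /eqP; rewrite trmx_eq0 (negbTE v0).
Qed.

(** When [f] vanishes at the active values, Q is the active block of [Sigma] and the estimator is
    the trace of an identity matrix. [0 <= K] makes the value 0 admissible in the lower bound - K
    that yields invertibility. *)
Lemma df_hat_flat (c K : R) : K < c ->
  (forall x, c * sqnorm x <= dot x (Sigma *m x)) -> 0 <= K ->
  (forall k, b k 0 != 0 -> f `|b k 0| = 0) -> df_hat Sigma f b = #|supp b|%:R.
Proof.
move=> Kc Hc K0 f0.
have Q1 : Qmx Sigma f b \in unitmx.
  by apply: (@Qmx_unitmx c K) => // k bk; rewrite f0// oppr_le0.
rewrite /df_hat -!mulmxA (mulmxA (Pmx b)).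
have -> : Pmx b *m Sigma *m (Pmx b)^T = Qmx Sigma f b.
  rewrite QmxE; apply/matrixP => i j.
  rewrite /Pmx !mul_rowsub_mx !mul1mx !mxE; apply: eq_bigr => k _; rewrite !mxE.
  by rewrite f0 ?mul0rn ?addr0//; have := enum_valP i; rewrite inE.
by rewrite mulVmx// mxtrace1.
Qed.

End SupportMatrix.

(** * Differentiating the stationarity equations *)

Section DifferenceQuotients.
Context {R : realType}.

Lemma cvg_of_dquot (u : nat -> R) (x D : R) :
  m.+1%:R * (u m - x) @[m --> \oo] --> D -> u m @[m --> \oo] --> x.
Proof.
move=> h.
have -> : (fun m => u m) = (fun m => m.+1%:R^-1 * (m.+1%:R * (u m - x)) + x).
  by apply/funext => m; rewrite mulKf// subrK.
rewrite -[X in _ --> X]add0r -(mul0r D); apply: cvgD; last exact: cvg_cst.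
by apply: cvgM => //; exact: cvg_harmonic.
Qed.

(** Caratheodory's form of the derivative avoids dividing by [u m - x], which may be 0. *)
Lemma cvg_dquot_comp (f : R -> R) (u : nat -> R) (x D : R) : derivable f x 1 ->
  m.+1%:R * (u m - x) @[m --> \oo] --> D ->
  m.+1%:R * (f (u m) - f x) @[m --> \oo] --> derive1 f x * D.
Proof.
move=> /derivableP; rewrite -derive1E => /is_derive1_caratheodory [g [fg cg <-]] h.
have -> : (fun m => m.+1%:R * (f (u m) - f x)) = (fun m => g (u m) * (m.+1%:R * (u m - x))).
  by apply/funext => m; rewrite fg mulrCA.
apply: cvgM => //.
exact: (cvg_comp _ _ (cvg_of_dquot h) cg).
Qed.

Lemma derive1_increment_ge (f : R -> R) (t K : R) : 0 < t -> derivable f t 1 ->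
  (forall t1 t2, 0 < t1 -> t1 < t2 -> f t1 - f t2 <= K * (t2 - t1)) ->
  - K <= derive1 f t.
Proof.
move=> t0 df fK.
have c1 : m.+1%:R * ((t + m.+1%:R^-1) - t) @[m --> \oo] --> (1 : R).
  rewrite (_ : (fun _ => _) = fun=> 1); first exact: cvg_cst.
  by apply/funext => m; rewrite addrAC subrr add0r divff.
have := cvg_dquot_comp df c1; rewrite mulr1 => h.
apply: (cvgr_to_ge h); apply: nearW => m.
have m0 : 0 < m.+1%:R^-1 :> R by rewrite invr_gt0.
have := fK t (t + m.+1%:R^-1) t0; rewrite ltrDl => /(_ m0).
rewrite addrAC subrr add0r => k.
rewrite -[leRHS]opprK -mulrN opprB lerN2 mulrC -ler_pdivlMr//.
Qed.

End DifferenceQuotients.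

Lemma colB {R : realType} {n : nat} (x y : 'cV[R]_n) k : (x - y) k 0 = x k 0 - y k 0.
Proof. by rewrite !mxE. Qed.

Section Minimizer.
Context {R : realType} {n p : nat} (X : 'M[R]_(n, p)).
Context (rho ddrho : R -> R) (lambda K : R).
Hypotheses (n0 : (0 < n)%N) (p0 : (0 < p)%N).
Hypothesis lambda0 : 0 < lambda.
Hypothesis hrho : penalty rho ddrho lambda.
Hypothesis Kc : K < c_min (gram X).
Hypothesis hK : forall t1 t2, 0 < t1 -> t1 < t2 ->
  derive1 rho t1 - derive1 rho t2 <= K * (t2 - t1).
Context (h : 'cV[R]_n -> 'cV[R]_p).
Hypothesis hmin : forall v, is_argmin (penalized_loss X rho v) (h v).

Lemma minimizer_lipschitz : exists L, forall k, is_lipschitz (fun v => h v k 0) L.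
Proof.
have [L L0 HL] := argmin_norm_bound n0 p0 lambda0 hrho Kc hK.
exists (L * (\sum_i \sum_j `|(n%:R^-1 *: X^T) i j|)) => k v v'.
have -> : h v k 0 - h v' k 0 = (h v - h v') k 0 by rewrite !mxE.
apply: (le_trans (coord_le_norm _ _ _)); apply: (le_trans (HL _ _ _ _ (hmin v) (hmin v'))).
by rewrite -mulrA ler_wpM2l// scalemxAl mulmx_norm_bound.
Qed.

(** The data enter the bound on the minimizers only through their products with the columns of
    [X]. *)
Lemma minimizer_invariant v z : X^T *m z = 0 -> h (v + z) = h v.
Proof.
move=> Xz; have [L L0 HL] := argmin_norm_bound n0 p0 lambda0 hrho Kc hK.
have := HL _ _ _ _ (hmin (v + z)) (hmin v).
rewrite addrAC subrr add0r Xz scaler0 normr0 mulr0 normr_le0 => /eqP.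
exact: subr0_eq.
Qed.

Section Differentiation.
Variables (v a : 'cV[R]_n) (D : 'cV[R]_p).
Hypothesis dD : forall k, dquot (fun u => h u k 0) a m v @[m --> \oo] --> D k 0.

(** The quotients of the score have two limits, one from its linear expression in the data and the
    coefficients, the other from the chain rule applied to [derive1 rho]. *)
Lemma minimizer_stationary k : h v k 0 != 0 -> derivable (derive1 rho) `|h v k 0| 1 ->
  (n%:R^-1 *: (X^T *m a)) k 0 - (gram X *m D) k 0 =
  derive1 (derive1 rho) `|h v k 0| * D k 0.
Proof.
move=> hk dr.
have s1 : m.+1%:R * (score X (v + m.+1%:R^-1 *: a) (h (v + m.+1%:R^-1 *: a)) k 0
    - score X v (h v) k 0) @[m --> \oo] -->
    (n%:R^-1 *: (X^T *m a)) k 0 - (gram X *m D) k 0.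
  rewrite (_ : (fun _ => _) = fun m => (n%:R^-1 *: (X^T *m a)) k 0 -
      \sum_j gram X k j * dquot (fun u => h u j 0) a m v); last first.
    apply/funext => m; set v' := v + _.
    have -> : score X v' (h v') k 0 - score X v (h v) k 0 =
      (score X v' (h v') - score X v (h v)) k 0 by rewrite colB.
    rewrite scoreB /v' addrAC subrr add0r -scalemxAr scalerA [n%:R^-1 * _]mulrC -scalerA -/v'.
    rewrite [X in _ * X]colB [X in _ * (X - _)]mxE mulrBr mulVKf//.
    rewrite [(gram X *m _) k 0]mxE mulr_sumr; congr (_ - _); apply: eq_bigr => j _.
    by rewrite /dquot -/v' colB mulrCA.
  rewrite [(gram X *m D) k 0]mxE; apply: cvgB; first exact: cvg_cst.
  by apply: cvg_sumr => j; apply: cvgM; [exact: cvg_cst|exact: dD].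
(* The sign at [v] is frozen: it is kept by the nearby minimizers for large [m], so both signs are
   treated by one formula. *)
pose sg := Num.sg (h v k 0).
have s2 : m.+1%:R * (sg * derive1 rho (sg * h (v + m.+1%:R^-1 *: a) k 0)
    - sg * derive1 rho (sg * h v k 0)) @[m --> \oo] -->
    derive1 (derive1 rho) `|h v k 0| * D k 0.
  rewrite (_ : _ * D k 0 = sg * (derive1 (derive1 rho) `|h v k 0| * (sg * D k 0))); last first.
    by rewrite [RHS]mulrCA [sg * (sg * _)]mulrA -expr2 sqr_sg hk mul1r.
  rewrite (_ : (fun _ => _) = fun m => sg * (m.+1%:R *
    (derive1 rho (sg * h (v + m.+1%:R^-1 *: a) k 0) - derive1 rho `|h v k 0|))); last first.
    by apply/funext => m; rewrite -mulrBr mulrCA [`|h v k 0|]normrEsg.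
  apply: cvgM; first exact: cvg_cst.
  apply: cvg_dquot_comp => //; rewrite normrEsg -/sg.
  rewrite (_ : (fun _ => _) = fun m => sg * dquot (fun u => h u k 0) a m v).
    by apply: cvgM; [exact: cvg_cst|exact: dD].
  by apply/funext => m; rewrite /dquot -mulrBr mulrCA.
have sc w : 0 < sg * h w k 0 -> score X w (h w) k 0 = sg * derive1 rho (sg * h w k 0).
  have [gp gn _] := argmin_pgraph n0 hrho hK (hmin w) k.
  rewrite /sg; case: sgrP => [|_|_]; first by rewrite mul0r ltxx.
  - by rewrite !mul1r => /gp.
  - by rewrite !mulN1r oppr_gt0 => /gn.
have sv : 0 < sg * h v k 0 by rewrite -normrEsg normr_gt0.
have cv0 : h (v + m.+1%:R^-1 *: a) k 0 @[m --> \oo] --> h v k 0.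
  exact: (cvg_of_dquot (@dD k)).
have cv : sg * h (v + m.+1%:R^-1 *: a) k 0 @[m --> \oo] --> sg * h v k 0.
  exact: (cvgM (cvg_cst sg) cv0).
suff s3 : m.+1%:R * (score X (v + m.+1%:R^-1 *: a) (h (v + m.+1%:R^-1 *: a)) k 0
    - score X v (h v) k 0) @[m --> \oo] -->
    derive1 (derive1 rho) `|h v k 0| * D k 0 by exact: (cvg_unique _ s1 s3).
move: s2; apply: cvg_trans; apply: near_eq_cvg.
near=> m; rewrite sc ?sc//; near: m; exact: (cvgr_gt _ cv).
Unshelve. all: by end_near. Qed.

Lemma minimizer_inactive k l : h v k 0 = 0 ->
  dquot (fun u => `|h u k 0|) a m v @[m --> \oo] --> l ->
  dquot (fun u => `|h u k 0|) (- a) m v @[m --> \oo] --> - l -> D k 0 = 0.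
Proof.
move=> hk d1 d2.
have nn b m : 0 <= dquot (fun u => `|h u k 0|) b m v.
  by rewrite /dquot hk normr0 subr0 mulr_ge0.
have l0 : 0 <= l by apply: (cvgr_to_ge d1); exact: nearW.
have l0' : 0 <= - l by apply: (cvgr_to_ge d2); exact: nearW.
have {}l0 : l = 0 by apply/eqP; rewrite eq_le l0 andbT -oppr_ge0.
have := cvg_norm (@dD k) => /(_ eventually_filter).
have -> : (fun m => `|dquot (fun u => h u k 0) a m v|) = dquot (fun u => `|h u k 0|) a ^~ v.
  by apply/funext => m; rewrite /dquot hk normr0 !subr0 normrM ger0_norm.
move=> d3; have : l = `|D k 0| by exact: (cvg_unique _ d1 d3).
by rewrite l0 => /esym /eqP; rewrite normr_eq0 => /eqP ->.
Qed.

Lemma minimizer_derivative :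
  (forall k, exists l, dquot (fun u => `|h u k 0|) a m v @[m --> \oo] --> l /\
     dquot (fun u => `|h u k 0|) (- a) m v @[m --> \oo] --> - l) ->
  (forall k, h v k 0 != 0 -> derivable (derive1 rho) `|h v k 0| 1 /\
     derive1 (derive1 rho) `|h v k 0| = ddrho `|h v k 0|) ->
  D = (Pmx (h v))^T *m invmx (Qmx (gram X) ddrho (h v)) *m Pmx (h v) *m
      (n%:R^-1 *: (X^T *m a)).
Proof.
move=> dabs dd; set b := h v; set Q := Qmx _ _ _.
have D0 k : b k 0 = 0 -> D k 0 = 0.
  by move=> bk; have [l [d1 d2]] := dabs k; exact: minimizer_inactive d1 d2.
have Q1 : Q \in unitmx.
  apply: (Qmx_unitmx Kc (gram_ge X p0)) => k bk; have [d1 <-] := dd k bk.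
  by apply: derive1_increment_ge => //; rewrite normr_gt0.
(* [D] vanishes off the support, so it is recovered from its active part and only the active
   equations have to be solved. *)
suff QD : Q *m (Pmx b *m D) = Pmx b *m (n%:R^-1 *: (X^T *m a)).
  by rewrite -!mulmxA -QD mulKmx// Pmx_tr_mulK.
rewrite /Q QmxE -!mulmxA Pmx_tr_mulK//; apply/matrixP => j l; rewrite (ord1 l){l}.
rewrite !Pmx_mulE mulmxDl [LHS]mxE mul_diag_mx.
set k := supp_idx j; have bk : b k 0 != 0 by have := enum_valP j; rewrite inE.
have [d1 d2] := dd k bk.
have := minimizer_stationary bk d1; rewrite d2 -/b => st.
rewrite [X in _ + X]mxE [X in _ + X * _]mxE -/k -st; ring.
Qed.

End Differentiation.
End Minimizer.

(** * Null sets along the column directions *)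

Section Minimizer.
Context {R : realType} {n p : nat} (X : 'M[R]_(n, p)).
Context (rho ddrho : R -> R) (lambda K : R).
Hypotheses (n0 : (0 < n)%N) (p0 : (0 < p)%N).
Hypothesis lambda0 : 0 < lambda.
Hypothesis hrho : penalty rho ddrho lambda.
Hypothesis Kc : K < c_min (gram X).
Hypothesis hK : forall t1 t2, 0 < t1 -> t1 < t2 ->
  derive1 rho t1 - derive1 rho t2 <= K * (t2 - t1).
Context (h : 'cV[R]_n -> 'cV[R]_p).
Hypothesis hmin : forall v, is_argmin (penalized_loss X rho v) (h v).

Lemma penalty_weight_integrable (C a b : R) : 0 < a ->
  lebesgue_measure.-integrable `[a, b] (EFin \o (fun x => C * (1 + `|ddrho x|))).
Proof.
move=> a0; have mD : measurable (`[a, b]%classic : set (measurableTypeR R)).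
  exact: measurable_itv.
have ci : lebesgue_measure.-integrable `[a, b] (EFin \o (fun x : R => 1 : R)).
  apply: continuous_compact_integrable; first exact: segment_compact.
  by apply: continuous_subspaceT => x; exact: cvg_cst.
have ni : lebesgue_measure.-integrable `[a, b] (EFin \o (fun x => `|ddrho x|)).
  by apply: integrable_norm; exact: (penalty_integrable hrho).
exact: (integrableZl mD C (integrableD mD ci ni)).
Qed.

(** On the branch where the coordinate has the sign [e], its score is [e] times [derive1 rho] of its
    absolute value, so the two increments in [argmin_line] are integrals of 1 and of [ddrho] over
    the range covered. This is the weight required by [null_preimage]. *)
Lemma minimizer_line_increment k (e : R) : e = 1 \/ e = -1 -> col k X != 0 ->
  exists2 C, 0 < C & forall v s s',
  let b t := e * h (v + t *: col k X) k 0 in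
  0 < b s -> b s <= b s' ->
  (`|s - s'|%:E <= \int[lebesgue_measure]_(x in `[b s, b s'])
     `|C * (1 + `|ddrho x|)|%:E)%E.
Proof.
move=> e1 Xk; have [C C0 HC] := argmin_line n0 p0 lambda0 hrho Kc hK Xk.
exists C => // v s s' b bs bs'.
have sc t : 0 < b t ->
    score X (v + t *: col k X) (h (v + t *: col k X)) k 0 = e * derive1 rho (b t).
  have [gp gn _] := argmin_pgraph n0 hrho hK (hmin (v + t *: col k X)) k.
  rewrite /b; case: e1 => ->; first by rewrite !mul1r => /gp.
  by rewrite !mulN1r oppr_gt0 => /gn.
have en : `|e| = 1 by case: e1 => ->; rewrite ?normrN normr1.
have mD : measurable (`[b s, b s']%classic : set (measurableTypeR R)) by exact: measurable_itv.
have di := penalty_integrable hrho (b s') bs.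
have ni : lebesgue_measure.-integrable `[b s, b s'] (EFin \o (fun x => `|ddrho x|)).
  exact: integrable_norm.
have ci : lebesgue_measure.-integrable `[b s, b s'] (EFin \o (fun x : R => 1 : R)).
  apply: continuous_compact_integrable; first exact: segment_compact.
  by apply: continuous_subspaceT => x; exact: cvg_cst.
have si : lebesgue_measure.-integrable `[b s, b s']
    (EFin \o (fun x : R => 1 + `|ddrho x|)) := integrableD mD ci ni.
have -> : (\int[lebesgue_measure]_(x in `[b s, b s']) `|C * (1 + `|ddrho x|)|%:E)%E =
    (C * ((b s' - b s) + \int[lebesgue_measure]_(x in `[b s, b s']) `|ddrho x|))%:E.
  transitivity (\int[lebesgue_measure]_(x in `[b s, b s'])
      (EFin \o (fun x : R => (C * (1 + `|ddrho x|))%R)) x)%E.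
    by apply: eq_integral => x _; rewrite /= ger0_norm// mulr_ge0 ?ltW// addr_ge0.
  have Cs := penalty_weight_integrable C (b s') bs.
  rewrite -(fineK (integrable_fin_num mD Cs)); congr _%:E.
  have := RintegralZl C mD si; rewrite /Rintegral/= => ->; congr (_ * _).
  have := RintegralD mD ci ni; rewrite /Rintegral/= => ->; congr (_ + _).
  have := Rintegral_cst lebesgue_measure mD 1; rewrite /Rintegral/= => ->.
  rewrite mul1r lebesgue_measure_itv/= lte_fin.
  by move: (bs'); rewrite le_eqVlt => /predU1P[->|->]//; rewrite ltxx subrr.
rewrite lee_fin; apply: (le_trans (HC v _ _ _ _ (hmin _) (hmin _))).
rewrite ler_pM2l//; apply: lerD.
  have -> : h (v + s *: col k X) k 0 - h (v + s' *: col k X) k 0 = e * (b s - b s').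
    by rewrite /b -mulrBr mulrA; case: e1 => ->; rewrite ?mulN1r ?mulrN1 ?opprK ?mulr1 mul1r.
  by rewrite normrM en mul1r distrC ger0_norm// subr_ge0.
rewrite (sc s)// (sc s') ?(lt_le_trans bs)// -mulrBr normrM en mul1r distrC.
rewrite (penalty_increment hrho bs bs').
exact: le_normr_Rintegral.
Qed.

Lemma minimizer_line_null k v N : col k X != 0 -> measurable N ->
  lebesgue_measure N = 0 ->
  lebesgue_measure [set s | (N `&` `]0, +oo[%classic) `|h (v + s *: col k X) k 0|] = 0.
Proof.
move=> Xk mN N0; have [L HL] := minimizer_lipschitz n0 p0 lambda0 hrho Kc hK hmin.
have cont (e : R) : e = 1 \/ e = -1 -> continuous (fun t : R => e * h (v + t *: col k X) k 0).
  move=> e1; apply: (@lipschitz_continuous _ _ (L * `|col k X|)) => s t.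
  rewrite -mulrBr normrM (_ : `|e| = 1) ?mul1r; last by case: e1 => ->; rewrite ?normrN normr1.
  rewrite (le_trans (HL _ _ _))// -mulrA opprD addrACA subrr add0r -scalerBl.
  by rewrite normrZ [`|s - t| * _]mulrC.
pose B (e : R) (m : nat) := (fun t : R => e * h (v + t *: col k X) k 0) @^-1`
  (N `&` `]m.+1%:R^-1, m.+1%:R[%classic).
have B0 (e : R) (m : nat) : e = 1 \/ e = -1 -> (@lebesgue_measure R).-negligible (B e m).
  move=> e1; have [C C0 HC] := minimizer_line_increment e1 Xk.
  have m0 : 0 < m.+1%:R^-1 :> R by rewrite invr_gt0.
  have mpre (A : set R) : measurable A ->
      measurable ((fun t : R => e * h (v + t *: col k X) k 0) @^-1` A).
    move=> mA; rewrite -[X in measurable X]setTI.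
    by apply: measurable_realfun.continuous_measurable_fun => //; exact: cont.
  apply/negligibleP.
    by apply: mpre; apply: measurableI => //; exact: measurable_itv.
  apply: (@null_preimage _ _ (fun x => C * (1 + `|ddrho x|))) => //.
  - exact: cont.
  - have sub : `]m.+1%:R^-1, m.+1%:R[ `<=` `[m.+1%:R^-1, m.+1%:R : R]
      by exact: subset_itv_oo_cc.
    have mI (I : interval R) : measurable ([set` I] : set (measurableTypeR R)).
      exact: measurable_itv.
    exact: (integrableS (mI _) (mI _) sub (penalty_weight_integrable C m.+1%:R m0)).
  - by move=> s s' ms ss' _; apply: HC => //; exact: lt_trans ms.
have mS : measurable [set s | (N `&` `]0, +oo[%classic) `|h (v + s *: col k X) k 0|].
  have ca : continuous (fun t : R => `|1 * h (v + t *: col k X) k 0|).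
    move=> t; apply: (@continuous_comp _ _ _ (fun t : R => 1 * h (v + t *: col k X) k 0) Num.norm).
      by apply: cont; left.
    exact: norm_continuous.
  have := measurable_realfun.continuous_measurable_fun ca measurableT
    (measurableI _ _ mN (measurable_itv `]0 : R, +oo[)).
  rewrite setTI; congr measurable; apply/funext => t; rewrite /preimage/= mul1r.
  by [].
have cover : [set s | (N `&` `]0, +oo[%classic) `|h (v + s *: col k X) k 0|] `<=`
    (\bigcup_m B 1 m) `|` (\bigcup_m B (- 1) m).
  move=> s /= []; set u := h _ _ _; rewrite in_itv/= andbT => Nu u0.
  (* [m.+1] exceeds both the absolute value of [u] and its inverse. *)
  pose m := Num.truncn (`|u| + `|u|^-1).
  have hm : `|u| + `|u|^-1 < m.+1%:R by exact: truncnS_gt.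
  have iu0 : 0 < `|u|^-1 by rewrite invr_gt0.
  have hu : (N `&` `]m.+1%:R^-1, m.+1%:R[%classic) `|u|.
    split => //=; rewrite in_itv/=; apply/andP; split; last first.
      by apply: lt_trans hm; rewrite ltrDl.
    by rewrite -[ltRHS]invrK ltf_pV2 ?posrE//; apply: lt_trans hm; rewrite ltrDr.
  have [u_ge|u_lt] := leP 0 u.
    by left; exists m => //; rewrite /B/= mul1r -/u; rewrite ger0_norm in hu.
  by right; exists m => //; rewrite /B/= mulN1r -/u; rewrite ltr0_norm in hu.
have neg : (@lebesgue_measure R).-negligible ((\bigcup_m B 1 m) `|` (\bigcup_m B (- 1) m)).
  by apply: negligibleU; apply: negligible_bigcup => m; apply: B0; [left|right].
have [A [mA A0 SA]] := neg.
apply/eqP; rewrite -measure_le0 -A0; apply: le_measure; rewrite ?inE//.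
exact: subset_trans SA.
Qed.

End Minimizer.

Lemma limn_sup_bound {R : realType} (u : nat -> R) (C : R) :
  (forall m, `|u m| <= C) -> `|limn_sup u| <= C.
Proof.
move=> uC.
have ub m : ubound (sdrop u m) C by move=> _ [k _ <-]; exact: le_trans (ler_norm _) (uC k).
have mem m : sdrop u m (u m) by exists m => /=.
have lo m : - C <= sups u m.
  apply: (@le_trans _ _ (u m)); first by have := uC m; rewrite ler_norml => /andP[].
  by apply: ub_le_sup => //; exists C; exact: ub.
rewrite limn_supE; last first.
  by exists C; split; [exact: num_real|move=> M CM k _ /=; exact: le_trans (uC k) (ltW CM)].
rewrite ler_norml; apply/andP; split.
  by apply: lb_le_inf; [exists (sups u 0%N); exists 0%N|move=> _ [m _ <-]].
apply: (@le_trans _ _ (sups u 0%N)); last by apply: ge_sup => //; exists (u 0%N).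
by apply: ge_inf; [exists (- C) => _ [m _ <-]|exists 0%N].
Qed.

(** * The divergence of the fit *)

Section AlmostSure.
Context {R : realType} {d : measure_display} {Omega : measurableType d}
  (P : probability Omega R) {n p : nat} (X : 'M[R]_(n, p)).
Variables (sigma : R) (s0 : 0 < sigma).
Variables (eps : 'I_n -> {RV P >-> R}) (heps : gaussian_noise sigma eps).
Context (rho ddrho : R -> R) (lambda K : R).
Hypotheses (n0 : (0 < n)%N) (p0 : (0 < p)%N).
Hypothesis lambda0 : 0 < lambda.
Hypothesis hrho : penalty rho ddrho lambda.
Hypothesis Kc : K < c_min (gram X).
Hypothesis hK : forall t1 t2, 0 < t1 -> t1 < t2 ->
  derive1 rho t1 - derive1 rho t2 <= K * (t2 - t1).
Context (h : 'cV[R]_n -> 'cV[R]_p).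
Hypothesis hmin : forall v, is_argmin (penalized_loss X rho v) (h v).
Variable mu : 'cV[R]_n.

Definition shifted (k : 'I_p) (x : 'cV[R]_n) : R := h (mu + x) k 0.

Lemma shifted_lipschitz : exists L, forall k, is_lipschitz (shifted k) L /\
  is_lipschitz (fun x => `|shifted k x|) L.
Proof.
have [L HL] := minimizer_lipschitz n0 p0 lambda0 hrho Kc hK hmin.
have H k : is_lipschitz (shifted k) L.
  move=> x x'; rewrite /shifted (le_trans (HL _ _ _))//.
  by rewrite opprD addrACA subrr add0r.
exists L => k; split => // x x'; apply: le_trans (H k x x').
exact: ler_dist_dist.
Qed.

(** A different line is used for each coordinate, directed by its own column, because only there
    does the reverse estimate hold. *)
Lemma ae_twice_derivable : {ae P, forall w, forall k,
  let b := h (mu + noise eps w) k 0 in b != 0 ->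
  derivable (derive1 rho) `|b| 1 /\ derive1 (derive1 rho) `|b| = ddrho `|b|}.
Proof.
have [N [mN N0 HN]] := penalty_ae_derivable hrho.
have [L HL] := shifted_lipschitz.
pose B k := [set x | (N `&` `]0, +oo[%classic) `|shifted k x|].
have mB k : measurable (B k).
  have := lipschitz_measurable (HL k).2 measurableT
    (measurableI _ _ mN (measurable_itv `]0 : R, +oo[)).
  by rewrite setTI.
apply: filter_forall => k; exists (noise eps @^-1` B k); split.
- by rewrite -[X in measurable X]setTI; exact: measurable_noise.
- have [Xk|Xk] := eqVneq (col k X) 0.
    rewrite (_ : _ @^-1` _ = set0) ?measure0//; apply/seteqP; split => // w /= [_].
    rewrite /shifted (argmin_zero_column n0 p0 lambda0 hrho Kc hK (hmin _) Xk).
    by rewrite /= normr0 in_itv/= ltxx.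
  apply: (null_along_lines s0 heps (a := col k X)) => // x.
  have := minimizer_line_null n0 p0 lambda0 hrho Kc hK hmin (mu + x) Xk mN N0.
  by under eq_set do rewrite -addrA.
- move=> w /=; apply: contra_notP => nB b0; apply: HN; rewrite ?normr_gt0// => Nb.
  by apply: nB; split => //; rewrite /= in_itv/= andbT normr_gt0.
Qed.

(** The divergence of the fit as a function of the noise. Being built from upper limits, it is
    defined everywhere, bounded and measurable. *)
Definition divergence (x : 'cV[R]_n) : R :=
  \sum_i \sum_k X i k * ddir (shifted k) (delta_mx i 0) x.

Lemma dquot_shift (g : 'cV[R]_n -> R) a m x :
  dquot g a m (mu + x) = dquot (fun x => g (mu + x)) a m x.
Proof. by rewrite /dquot addrA. Qed.

(** Almost surely the Jacobian of the fit is X P' Q^-1 P X' / n, and cyclicity of the trace moves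
    [X] around to form [gram X]. *)
Lemma ae_df_hat : {ae P, forall w,
  df_hat (gram X) ddrho (h (mu + noise eps w)) = divergence (noise eps w)}.
Proof.
have [L HL] := shifted_lipschitz.
have ae1 : {ae P, forall w, forall i k,
    ddir_set (shifted k) (delta_mx i 0) (noise eps w)}.
  by do 2 apply: filter_forall => ?; exact: (ae_ddir_set s0 heps _ (HL _).1).
have ae2 : {ae P, forall w, forall i k,
    ddir_set (fun x => `|shifted k x|) (delta_mx i 0) (noise eps w)}.
  by do 2 apply: filter_forall => ?; exact: (ae_ddir_set s0 heps _ (HL _).2).
apply: filterS3 ae1 ae2 ae_twice_derivable => w d1 d2 d3.
set x := noise eps w in d1 d2 d3 *; set b := h (mu + x).
pose D i := \col_k ddir (shifted k) (delta_mx i 0) x.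
have DE i : D i = (Pmx b)^T *m invmx (Qmx (gram X) ddrho b) *m Pmx b *m
    (n%:R^-1 *: (X^T *m delta_mx i 0)).
  apply: (minimizer_derivative n0 p0 hrho Kc hK hmin) => // k.
  - rewrite mxE; have [dd _] := d1 i k.
    by under eq_fun do rewrite dquot_shift.
  - exists (ddir (fun x => `|shifted k x|) (delta_mx i 0) x).
    have [dd dd'] := d2 i k.
    by split; under eq_fun do rewrite dquot_shift.
set A := (Pmx b)^T *m invmx (Qmx (gram X) ddrho b) *m Pmx b in DE.
transitivity (\tr (X *m A *m (n%:R^-1 *: X^T))); last first.
  rewrite /divergence /mxtrace; apply: eq_bigr => i _.
  transitivity ((X *m D i) i 0); last by rewrite mxE; apply: eq_bigr => k _; rewrite mxE.
  by rewrite DE scalemxAl !mulmxA mulmx_delta.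
rewrite [RHS]mxtrace_mulC mulmxA -scalemxAl -/(gram X) /A /df_hat.
by rewrite -(mulmxA _ (gram X)) [LHS]mxtrace_mulC -!mulmxA.
Qed.

(** The difference quotients themselves are unchanged, so the equality holds at every point and not
    only almost surely. *)
Lemma divergence_invariant x z : X^T *m z = 0 -> divergence (x + z) = divergence x.
Proof.
move=> Xz; apply: eq_bigr => i _; apply: eq_bigr => k _; congr (_ * _).
rewrite /ddir; congr limn_sup; apply/funext => m; rewrite /dquot /shifted.
by rewrite -(addrA x) (addrC z) !addrA !(minimizer_invariant n0 p0 lambda0 hrho Kc hK hmin _ Xz).
Qed.

Lemma measurable_divergence : measurable_fun setT divergence.
Proof.
have [L HL] := shifted_lipschitz.
rewrite /divergence; apply: measurable_sum => i; apply: measurable_sum => k.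
by apply: measurable_funM => //; exact: (measurable_ddir (HL k).1).
Qed.

Lemma divergence_bound : exists C, forall x, `|divergence x| <= C.
Proof.
have [L HL] := shifted_lipschitz.
exists (\sum_i \sum_k `|X i k| * (L * `|delta_mx i 0 : 'cV[R]_n|)) => x.
rewrite (le_trans (ler_norm_sum _ _ _))//; apply: ler_sum => i _.
rewrite (le_trans (ler_norm_sum _ _ _))//; apply: ler_sum => k _.
rewrite normrM ler_wpM2l//; by apply: limn_sup_bound => m; exact: (dquot_bound (HL k).1).
Qed.

End AlmostSure.

(** * Expected risk *)

Section Tame.
Context {R : realType} {n : nat}.
Implicit Types f g : 'cV[R]_n -> R.

(** A class closed under sums and products, containing the Lipschitz functions and integrable
    against the noise; it makes every expectation below finite and linear. *)
Definition tame f := measurable_fun setT f /\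
  exists A c, [/\ 0 <= A, 0 <= c & forall x, `|f x| <= A * expR (c * `|x|)].

Lemma tame_bounded f C : measurable_fun setT f -> (forall x, `|f x| <= C) -> tame f.
Proof.
move=> mf fC; split => //; exists C, 0; split => // [|x].
  exact: le_trans (normr_ge0 _) (fC 0).
by rewrite mul0r expR0 mulr1.
Qed.

Lemma tame_cst (c : R) : tame (fun=> c).
Proof. by apply: (@tame_bounded _ `|c|). Qed.

Lemma tame_lipschitz g L : is_lipschitz g L -> tame g.
Proof.
move=> gL; split; first exact: lipschitz_measurable gL.
exists (`|g 0| + `|L|), 1; split; rewrite ?addr_ge0// => x.
rewrite mul1r -[g x](subrK (g 0)) (le_trans (ler_normD _ _))// addrC mulrDl lerD//.
  by rewrite ler_peMr// -expR0 ler_expR.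
apply: (le_trans (gL x 0)); rewrite subr0.
apply: (@le_trans _ _ (`|L| * `|x|)); first by rewrite ler_wpM2r// ler_norm.
by rewrite ler_wpM2l// ltW// (lt_le_trans _ (expR_ge1Dx _))// ltrDr.
Qed.

Lemma tame_coord i : tame (fun x => x i 0).
Proof.
apply: (@tame_lipschitz _ 1) => x y; rewrite mul1r.
by have := coord_le_norm (x - y) i 0; rewrite !mxE.
Qed.

Let wexp (A c c' : R) x : 0 <= A -> c <= c' -> A * expR (c * `|x|) <= A * expR (c' * `|x : 'cV[R]_n|).
Proof. by move=> A0 cc; rewrite ler_wpM2l// ler_expR ler_wpM2r. Qed.

Lemma tameD f g : tame f -> tame g -> tame (fun x => f x + g x).
Proof.
move=> [mf [A [a [A0 a0 fA]]]] [mg [B [b [B0 b0 gB]]]]; split.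
  exact: measurable_funD.
exists (A + B), (a + b); split; rewrite ?addr_ge0// => x.
rewrite mulrDl (le_trans (ler_normD _ _))// lerD//.
  by apply: (le_trans (fA x)); apply: wexp; rewrite // lerDl.
by apply: (le_trans (gB x)); apply: wexp; rewrite // lerDr.
Qed.

Lemma tameM f g : tame f -> tame g -> tame (fun x => f x * g x).
Proof.
move=> [mf [A [a [A0 a0 fA]]]] [mg [B [b [B0 b0 gB]]]]; split.
  exact: measurable_funM.
exists (A * B), (a + b); split; rewrite ?mulr_ge0 ?addr_ge0// => x.
by rewrite normrM mulrDl expRD mulrACA ler_pM.
Qed.

Lemma tameZ c f : tame f -> tame (fun x => c * f x).
Proof. by move=> tf; apply: tameM tf; exact: tame_cst. Qed.

Lemma tameB f g : tame f -> tame g -> tame (fun x => f x - g x).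
Proof.
move=> tf tg; rewrite (_ : (fun _ => _) = fun x => f x + -1 * g x).
  by apply: tameD => //; exact: tameZ.
by apply/funext => x; rewrite mulN1r.
Qed.

Lemma tame_sum (I : Type) (r : seq I) (f : I -> 'cV[R]_n -> R) :
  (forall i, tame (f i)) -> tame (fun x => \sum_(i <- r) f i x).
Proof.
move=> tf; elim: r => [|i r IH].
  by under eq_fun do rewrite big_nil; exact: tame_cst.
by under eq_fun do rewrite big_cons; exact: tameD.
Qed.

Lemma tame_dot (a : 'cV[R]_n) : tame (dot a).
Proof. by apply: tame_sum => i; apply: tameZ; exact: tame_coord. Qed.

End Tame.

Section Moments.
Context {R : realType} {d : measure_display} {Omega : measurableType d}
  (P : probability Omega R) {n : nat}.
Variables (sigma : R) (s0 : 0 < sigma).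
Variables (eps : 'I_n -> {RV P >-> R}) (heps : gaussian_noise sigma eps).
Implicit Types f g : 'cV[R]_n -> R.

Definition mean f : R := \int[P]_w f (noise eps w).

Lemma tame_integrable f : tame f ->
  P.-integrable setT (EFin \o (fun w => f (noise eps w))).
Proof. by move=> [mf [A [a [_ _ fA]]]]; exact: (integrable_noise s0 heps mf fA). Qed.

Lemma meanE f : tame f -> (\int[P]_w (f (noise eps w))%:E = (mean f)%:E)%E.
Proof. by move=> tf; rewrite /mean fineK// integrable_fin_num//; exact: tame_integrable. Qed.

Lemma mean_cst c : mean (fun=> c) = c.
Proof. by rewrite /mean Rintegral_cst// [X in fine X]probability_setT mulr1. Qed.

Lemma meanD f g : tame f -> tame g -> mean (fun x => f x + g x) = mean f + mean g.
Proof. by move=> tf tg; rewrite /mean RintegralD//; exact: tame_integrable. Qed.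

Lemma meanB f g : tame f -> tame g -> mean (fun x => f x - g x) = mean f - mean g.
Proof. by move=> tf tg; rewrite /mean RintegralB//; exact: tame_integrable. Qed.

Lemma meanZ c f : tame f -> mean (fun x => c * f x) = c * mean f.
Proof. by move=> tf; rewrite /mean RintegralZl//; exact: tame_integrable. Qed.

Lemma mean_sum (I : Type) (r : seq I) (f : I -> 'cV[R]_n -> R) :
  (forall i, tame (f i)) -> mean (fun x => \sum_(i <- r) f i x) = \sum_(i <- r) mean (f i).
Proof.
move=> tf; elim: r => [|i r IH].
  by rewrite big_nil -[RHS](mean_cst 0); congr mean; apply/funext => x; rewrite big_nil.
rewrite big_cons -IH -meanD//; last exact: tame_sum.
by congr mean; apply/funext => x; rewrite big_cons.
Qed.

Lemma mean_stein (a : 'cV[R]_n) g D (C c : R) : tame g -> tame D ->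
  (forall m x, `|dquot g a m x| <= C * expR (c * `|x|)) ->
  {ae P, forall w, dquot g a m (noise eps w) @[m --> \oo] --> D (noise eps w)} ->
  mean (fun x => dot a x * g x) = sigma ^+ 2 * mean D.
Proof.
move=> tg tD gC gD; have [mg [A [b [A0 b0 gA]]]] := tg.
(* A common exponential rate for [g] and for its difference quotients. *)
pose b' := b + `|c|.
have gA' x : `|g x| <= A * expR (b' * `|x|).
  by rewrite (le_trans (gA x))// ler_wpM2l// ler_expR ler_wpM2r// lerDl.
have gC' m x : `|dquot g a m x| <= `|C| * expR (b' * `|x|).
  rewrite (le_trans (gC m x))// (le_trans (ler_wpM2r (expR_ge0 _) (ler_norm C)))//.
  by rewrite ler_wpM2l// ler_expR ler_wpM2r// (le_trans (ler_norm c))// lerDr.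
have := stein s0 heps mg gA' tD.1 gC' gD.
have -> : (\int[P]_w ((\sum_i a i 0 * noise eps w i 0) * g (noise eps w))%:E)%E =
    (mean (fun x => dot a x * g x))%:E.
  by rewrite -meanE//; apply: tameM => //; exact: tame_dot.
by rewrite meanE// -EFinM => -[].
Qed.

Lemma mean_stein_exact (a : 'cV[R]_n) g D : tame g -> tame D ->
  (forall m x, dquot g a m x = D x) ->
  mean (fun x => dot a x * g x) = sigma ^+ 2 * mean D.
Proof.
move=> tg tD gD; have [_ [A [c [_ _ DA]]]] := tD.
apply: (@mean_stein _ _ _ A c) => // [m x|]; first by rewrite gD.
by apply: nearW => w; under eq_fun do rewrite gD; exact: cvg_cst.
Qed.

Lemma mean_dot a : mean (dot a) = 0.
Proof.
have -> : dot a = fun x => dot a x * 1 by apply/funext => x; rewrite mulr1.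
rewrite (@mean_stein_exact _ (fun=> 1) (fun=> 0)) ?mean_cst ?mulr0//; try exact: tame_cst.
by move=> m x; rewrite /dquot subrr mulr0.
Qed.

(* The direction [a] leaves [c] unchanged, so the only contribution to the
   derivative of [c * dot a] along [a] comes from the linear factor. *)
Lemma mean_dot_sqr (a : 'cV[R]_n) c : tame c -> (forall x t, c (x + t *: a) = c x) ->
  mean (fun x => c x * dot a x ^+ 2) = sigma ^+ 2 * (sqnorm a * mean c).
Proof.
move=> tc ca; rewrite -meanZ//.
have -> : (fun x => c x * dot a x ^+ 2) = fun x => dot a x * (c x * dot a x).
  by apply/funext => x; rewrite expr2 mulrCA.
apply: mean_stein_exact => [||m x].
- by apply: tameM => //; exact: tame_dot.
- exact: tameZ.
- rewrite /dquot ca dotDr dotZr -sqnormE; move: (dot a x) (c x) => u v.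
  by rewrite -mulrBr addrAC subrr add0r mulrCA mulVKf// mulrC.
Qed.

(** The squared norm is the sum of the squares of the scalar products with the vectors M e_i, along
    which [c] is constant; their squared norms are the diagonal entries of [M] and add up to its
    trace. *)
Lemma mean_sqnorm_projection (M : 'M[R]_n) c : M^T = M -> M *m M = M ->
  tame c -> (forall x z, c (x + M *m z) = c x) ->
  mean (fun x => c x * sqnorm (M *m x)) = sigma ^+ 2 * (\tr M * mean c).
Proof.
move=> Ms Mi tc cM; pose a i := M *m delta_mx i (0 : 'I_1).
have aE i x : (M *m x) i 0 = dot (a i) x by rewrite /a dot_mulmxl Ms dot_delta.
have -> : (fun x => c x * sqnorm (M *m x)) = fun x => \sum_i c x * dot (a i) x ^+ 2.
  by apply/funext => x; rewrite /sqnorm mulr_sumr; apply: eq_bigr => i _; rewrite aE.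
rewrite mean_sum => [|i]; last first.
  by apply: tameM => //; rewrite (_ : (fun _ => _) = fun x => dot (a i) x * dot (a i) x)//;
     apply: tameM; exact: tame_dot.
rewrite /mxtrace mulr_suml mulr_sumr; apply: eq_bigr => i _.
rewrite mean_dot_sqr// => [|x t]; last by rewrite /a scalemxAr cM.
by rewrite sqnormE -aE /a mulmxA Mi mulmx_delta.
Qed.

End Moments.

Section Risk.
Context {R : realType} {d : measure_display} {Omega : measurableType d}
  (P : probability Omega R) {n p : nat} (X : 'M[R]_(n, p)).
Variables (sigma : R) (s0 : 0 < sigma).
Variables (eps : 'I_n -> {RV P >-> R}) (heps : gaussian_noise sigma eps).
Context (rho ddrho : R -> R) (lambda K : R).
Hypotheses (n0 : (0 < n)%N) (p0 : (0 < p)%N).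
Hypothesis lambda0 : 0 < lambda.
Hypothesis hrho : penalty rho ddrho lambda.
Hypothesis Kc : K < c_min (gram X).
Hypothesis hK : forall t1 t2, 0 < t1 -> t1 < t2 ->
  derive1 rho t1 - derive1 rho t2 <= K * (t2 - t1).
Context (h : 'cV[R]_n -> 'cV[R]_p).
Hypothesis hmin : forall v, is_argmin (penalized_loss X rho v) (h v).
Variable beta : 'cV[R]_p.
Variable Pj : 'M[R]_n.
Hypotheses (Ps : Pj^T = Pj) (Pi : Pj *m Pj = Pj) (PX : Pj *m X = X).
Hypothesis Ptr : \tr Pj = (\rank X)%:R.

Let mu := X *m beta.
Let fit x := X *m h (mu + x).
Let div := divergence X h mu.

Lemma fitE i x : fit x i 0 = \sum_k X i k * shifted h mu k x.
Proof. by rewrite mxE. Qed.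

Lemma tame_fit i : tame (fun x => fit x i 0).
Proof.
have [L HL] := shifted_lipschitz n0 p0 lambda0 hrho Kc hK hmin mu.
under eq_fun do rewrite fitE.
by apply: tame_sum => k; apply: tameZ; exact: tame_lipschitz (HL k).1.
Qed.

Lemma tame_divergence : tame div.
Proof.
have [C HC] := divergence_bound n0 p0 lambda0 hrho Kc hK hmin mu.
apply: (tame_bounded _ HC).
exact: (measurable_divergence n0 p0 lambda0 hrho Kc hK hmin).
Qed.

(** Stein's identity for the [i]-th coordinate of the fit in the direction e_i, summed over [i]. *)
Lemma mean_dot_fit : mean eps (fun x => dot x (fit x)) = sigma ^+ 2 * mean eps div.
Proof.
have [L HL] := shifted_lipschitz n0 p0 lambda0 hrho Kc hK hmin mu.
pose Di i x := \sum_k X i k * ddir (shifted h mu k) (delta_mx i 0) x.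
have tDi i : tame (Di i).
  apply: tame_sum => k; apply: tameZ.
  apply: (@tame_bounded _ _ _ (L * `|delta_mx i 0 : 'cV[R]_n|)).
    exact: (measurable_ddir (HL k).1).
  by move=> x; apply: limn_sup_bound => m; exact: (dquot_bound (HL k).1).
have dqE i a m x : dquot (fun x => fit x i 0) a m x =
    \sum_k X i k * dquot (shifted h mu k) a m x.
  rewrite /dquot !fitE -sumrB mulr_sumr; apply: eq_bigr => k _.
  by rewrite -mulrBr mulrCA.
have coordE i (x : 'cV[R]_n) : x i 0 = dot (delta_mx i 0) x by rewrite dot_delta.
rewrite /dot (mean_sum s0 heps) => [|i]; last first.
  by apply: tameM; [exact: tame_coord|exact: tame_fit].
rewrite (mean_sum s0 heps)// mulr_sumr; apply: eq_bigr => i _.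
under [in LHS]eq_fun do rewrite coordE.
apply: (@mean_stein _ _ _ _ _ _ s0 _ heps _ _ _
  (\sum_k `|X i k| * (L * `|delta_mx i 0 : 'cV[R]_n|)) 0) => //.
- exact: tame_fit.
- exact: tDi.
- move=> m x; rewrite mul0r expR0 mulr1 dqE (le_trans (ler_norm_sum _ _ _))//.
  by apply: ler_sum => k _; rewrite normrM ler_wpM2l//; exact: (dquot_bound (HL k).1).
- have : {ae P, forall w, forall k, ddir_set (shifted h mu k) (delta_mx i 0) (noise eps w)}.
    by apply: filter_forall => k; exact: (ae_ddir_set s0 heps _ (HL k).1).
  apply: filterS => w dw; under eq_fun do rewrite dqE.
  apply: cvg_sumr => k; apply: cvgM; first exact: cvg_cst.
  by have [] := dw k.
Qed.

Lemma dot_proj_fit x y : dot (Pj *m x) (X *m y) = dot x (X *m y).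
Proof. by rewrite dot_mulmxl Ps mulmxA PX. Qed.

Lemma covariance_fit i :
  covariance P (fun w => (mu + Pj *m noise eps w) i 0) (fun w => fit (noise eps w) i 0) =
  (mean eps (fun x => (Pj *m x) i 0 * fit x i 0))%:E.
Proof.
have PE x : (Pj *m x) i 0 = dot (Pj *m delta_mx i 0) x.
  by rewrite dot_mulmxl Ps dot_delta.
have tP : tame (fun x => (Pj *m x) i 0) by under eq_fun do rewrite PE; exact: tame_dot.
have mP : mean eps (fun x => (Pj *m x) i 0) = 0.
  by under eq_fun do rewrite PE; exact: (mean_dot s0 heps).
have e1 : ('E_P[fun w => (mu + Pj *m noise eps w)%R i 0%R] = (mu i 0%R)%:E)%E.
  rewrite expectation.unlock.
  pose f (x : 'cV[R]_n) := mu i 0 + (Pj *m x) i 0.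
  transitivity (\int[P]_w (f (noise eps w))%:E)%E.
    by apply: eq_integral => w _; rewrite mxE.
  rewrite (meanE s0 heps); last by apply: tameD => //; exact: tame_cst.
  by rewrite (meanD s0 heps)// ?mean_cst ?mP ?addr0//; exact: tame_cst.
have e2 : ('E_P[fun w => fit (noise eps w) i 0%R] = (mean eps (fun x => fit x i 0%R))%:E)%E.
  by rewrite expectation.unlock -(meanE s0 heps)//; exact: tame_fit.
rewrite covariance.unlock e1 e2 expectation.unlock.
set c := mean eps (fun x => fit x i 0).
pose f x := (Pj *m x) i 0 * fit x i 0 - c * (Pj *m x) i 0.
transitivity (\int[P]_w (f (noise eps w))%:E)%E.
  apply: eq_integral => w _; congr EFin; set x := noise eps w.
  transitivity (((mu + Pj *m x) i 0 - mu i 0) * (fit x i 0 - c)); first by [].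
  rewrite [X in X - _]mxE /f; ring.
have t1 : tame (fun x => (Pj *m x) i 0 * fit x i 0).
  by apply: tameM => //; exact: tame_fit.
have t2 : tame (fun x => c * (Pj *m x) i 0) by exact: tameZ.
rewrite (meanE s0 heps); last exact: tameB.
by rewrite (meanB s0 heps)// (meanZ s0 heps)// mP mulr0 subr0.
Qed.

Lemma degrees_of_freedom_fit :
  degrees_of_freedom P sigma (fun w => mu + Pj *m noise eps w) (fun w => fit (noise eps w)) =
  (mean eps div)%:E.
Proof.
rewrite /degrees_of_freedom; under eq_bigr do rewrite covariance_fit.
rewrite sumEFin -EFinM -(mean_sum s0 heps); last first.
  move=> i; apply: tameM; last exact: tame_fit.
  have PE x : (Pj *m x) i 0 = dot (Pj *m delta_mx i 0) x.
    by rewrite dot_mulmxl Ps dot_delta.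
  by under eq_fun do rewrite PE; exact: tame_dot.
congr EFin; rewrite -[RHS](mulKf (_ : sigma ^+ 2 != 0)); last by rewrite expf_neq0// gt_eqF.
rewrite mulrC -mean_dot_fit; congr (_ * _); congr mean; apply/funext => x.
by rewrite -[LHS]/(dot _ _) dot_proj_fit.
Qed.

Lemma tame_sqnorm (f : 'cV[R]_n -> 'cV[R]_n) : (forall i, tame (fun x => f x i 0)) ->
  tame (fun x => sqnorm (f x)).
Proof.
move=> tf; apply: tame_sum => i; under eq_fun do rewrite expr2.
exact: tameM.
Qed.

Let loss x := sqnorm (fit x - mu).

Lemma tame_loss : tame loss.
Proof.
apply: tame_sqnorm => i; under eq_fun do rewrite colB.
by apply: tameB; [exact: tame_fit|exact: tame_cst].
Qed.

Lemma tame_mulmx (M : 'M[R]_n) i : tame (fun x : 'cV[R]_n => (M *m x) i 0).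
Proof.
under eq_fun do rewrite -dot_delta dot_mulmxr; exact: tame_dot.
Qed.

Lemma tame_residual : tame (fun x => sqnorm (mu + Pj *m x - fit x)).
Proof.
apply: tame_sqnorm => i; under eq_fun do rewrite colB [X in X - _]mxE.
by apply: tameB; [apply: tameD; [exact: tame_cst|exact: tame_mulmx]|exact: tame_fit].
Qed.

(** The residual is the projected noise minus the estimation error, which lies in the column span.
    Expanding the square leaves the mean squared norm of the projected noise, the Stein term and the
    loss; the scalar product with [mu] has mean 0. *)
Lemma mean_residual : mean eps (fun x => sqnorm (mu + Pj *m x - fit x)) =
  sigma ^+ 2 * (\rank X)%:R - 2 * (sigma ^+ 2 * mean eps div) + mean eps loss.
Proof.
have E x : sqnorm (mu + Pj *m x - fit x) =
    sqnorm (Pj *m x) - 2 * (dot x (fit x) - dot mu x) + loss x.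
  rewrite addrAC addrC -opprB sqnormB -/(loss x) /fit /mu -mulmxBr dot_proj_fit mulmxBr dotBr.
  by rewrite -/mu -/(fit x) (dotC x mu).
under eq_fun do rewrite E.
have tP : tame (fun x : 'cV[R]_n => sqnorm (Pj *m x)) by apply: tame_sqnorm => i; exact: tame_mulmx.
have tx : tame (fun x => dot x (fit x)).
  by apply: tame_sum => i; apply: tameM; [exact: tame_coord|exact: tame_fit].
have tm := tame_dot mu.
have t1 : tame (fun x => 2 * (dot x (fit x) - dot mu x)) by apply: tameZ; exact: tameB.
rewrite (meanD s0 heps); [|exact: tameB|exact: tame_loss].
rewrite (meanB s0 heps)// (meanZ s0 heps); last exact: tameB.
rewrite (meanB s0 heps)// mean_dot_fit (mean_dot s0 heps) subr0.
congr (_ - _ + _); rewrite -Ptr.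
have := mean_sqnorm_projection s0 heps Ps Pi (tame_cst 1) (fun _ _ => erefl).
by rewrite mean_cst mulr1 => <-; congr mean; apply/funext => x; rewrite mul1r.
Qed.

Lemma tame_Cp (s : 'cV[R]_n -> R) : tame s ->
  tame (fun x => sqnorm (mu + Pj *m x - fit x) + s x * (2 * div x - (\rank X)%:R)).
Proof.
move=> ts; apply: tameD; first exact: tame_residual.
apply: tameM => //; apply: tameB; last exact: tame_cst.
by apply: tameZ; exact: tame_divergence.
Qed.

Lemma mean_Cp_known : mean eps (fun x => sqnorm (mu + Pj *m x - fit x) +
  sigma ^+ 2 * (2 * div x - (\rank X)%:R)) = mean eps loss.
Proof.
have td := tame_divergence.
have t1 : tame (fun x => sqnorm (mu + Pj *m x - fit x)) by exact: tame_residual.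
have t2 : tame (fun x => 2 * div x) by exact: tameZ.
have t3 : tame (fun x => 2 * div x - (\rank X)%:R) by apply: tameB => //; exact: tame_cst.
rewrite (meanD s0 heps)//; last exact: tameZ.
rewrite (meanZ s0 heps)// (meanB s0 heps)//; last exact: tame_cst.
rewrite (meanZ s0 heps)// mean_cst mean_residual; ring.
Qed.

(** The factor multiplying the variance estimate is unchanged by shifts orthogonal to the column
    span, while the estimate is the squared norm of the orthogonal part of the noise divided by n -
    p. The mean of the product therefore equals that with [sigma ^+ 2], without independence of the
    two factors being invoked. *)
Lemma mean_Cp_estimated : (p < n)%N -> \rank X = p ->
  mean eps (fun x => sqnorm (mu + Pj *m x - fit x) +
  sqnorm (mu + x - (mu + Pj *m x)) / (n - p)%:R * (2 * div x - (\rank X)%:R)) = mean eps loss.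
Proof.
move=> pn rX; rewrite -mean_Cp_known.
have td := tame_divergence.
pose c x := 2 * div x - (\rank X)%:R.
have tc : tame c by apply: tameB; [exact: tameZ|exact: tame_cst].
pose N := 1%:M - Pj.
have Ns : N^T = N by rewrite linearB/= trmx1 Ps.
have Ni : N *m N = N by rewrite mulmxBl mul1mx mulmxBr mulmx1 Pi subrr subr0.
have np0 : (n - p)%:R != 0 :> R by rewrite pnatr_eq0 subn_eq0 -ltnNge.
have Ntr : \tr N = (n - p)%:R by rewrite linearB/= mxtrace1 Ptr rX natrB// ltnW.
have cN x z : c (x + N *m z) = c x.
  rewrite /c /div (divergence_invariant n0 p0 lambda0 hrho Kc hK hmin)//.
  have /(congr1 trmx) := PX; rewrite trmx_mul Ps => XP.
  by rewrite mulmxA mulmxBr mulmx1 XP subrr mul0mx.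
have NE x : mu + x - (mu + Pj *m x) = N *m x.
  by rewrite opprD addrACA subrr add0r mulmxBl mul1mx.
have t1 : tame (fun x => sqnorm (mu + Pj *m x - fit x)) by exact: tame_residual.
have t2 : tame (fun x => c x * sqnorm (N *m x)).
  by apply: tameM => //; apply: tame_sqnorm => i; exact: tame_mulmx.
transitivity (mean eps (fun x => sqnorm (mu + Pj *m x - fit x)) + mean eps (fun x => sigma ^+ 2 * c x)).
  transitivity (mean eps (fun x => sqnorm (mu + Pj *m x - fit x) +
      (n - p)%:R^-1 * (c x * sqnorm (N *m x)))).
    congr mean; apply/funext => x; rewrite NE -/(c x); congr (_ + _).
    by rewrite mulrAC mulrC [_ * c x]mulrC.
  rewrite (meanD s0 heps)//; last exact: tameZ.
  rewrite !(meanZ s0 heps)// (mean_sqnorm_projection s0 heps Ns Ni)// Ntr.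
  by rewrite mulrCA mulKf.
by rewrite -(meanD s0 heps)//; exact: tameZ.
Qed.

End Risk.

(** Used to obtain [0 <= K], which the count of active coordinates requires. *)
Lemma max_concavity_flat {R : realType} (f : R -> R) (K t1 t2 : R) :
  (forall t1 t2, 0 < t1 -> t1 < t2 -> f t1 - f t2 <= K * (t2 - t1)) ->
  0 < t1 -> t1 < t2 -> f t1 = f t2 -> 0 <= K.
Proof.
move=> fK t10 t12 ft; have := fK _ _ t10 t12.
by rewrite ft subrr pmulr_lge0// subr_gt0.
Qed.

Theorem theorem8 (R : realType) (d : measure_display) (Omega : measurableType d)
  (P : probability Omega R) (n p : nat) (hn : (0 < n)%N) (hp : (0 < p)%N)
  (X : 'M[R]_(n, p)) (beta : 'cV[R]_p)
  (sigma : R) (hsigma : 0 < sigma)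
  (eps : 'I_n -> {RV P >-> R}) (heps : gaussian_noise sigma eps)
  (y : Omega -> 'cV[R]_n)
  (hy : forall w, y w = X *m beta + \col_(i < n) eps i w)
  (lambda : R) (hlambda : 0 < lambda)
  (rho ddrho : R -> R) (hrho : penalty rho ddrho lambda)
  (betahat : Omega -> 'cV[R]_p)
  (hbetahat : forall w, is_argmin (penalized_loss X rho (y w)) (betahat w))
  (hkappa : (max_concavity rho < (c_min (gram X))%:E)%E)
  (mutilde : Omega -> 'cV[R]_n)
  (hmutilde : forall w, is_orth_proj X (y w) (mutilde w)) :
  let mu := X *m beta in
  let muhat := fun w => X *m betahat w in
  let dfhat := fun w => df_hat (gram X) ddrho (betahat w) in
  let Cp := Cp_hat X mutilde muhat dfhat in
  let Cp_known := Cp (fun=> sigma ^+ 2) in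
  let Cp_estimated := Cp (fun w => sqnorm (y w - mutilde w) / (n - p)%:R) in
  let loss := fun w => sqnorm (muhat w - mu) in
  [/\ ('E_P[dfhat])%E = degrees_of_freedom P sigma mutilde muhat,
      ('E_P[Cp_known] = 'E_P[loss])%E,
      (* n - p is the residual degrees of freedom only at full column rank,
         which is automatic unless max_concavity rho < 0 *)
      (p < n)%N -> \rank X = p -> ('E_P[Cp_estimated] = 'E_P[loss])%E,
      (forall t : R, 0 <= t -> rho t = lambda * t) ->
        forall w, dfhat w = #|supp (betahat w)|%:R
    & forall gamma : R,
        (forall t : R, gamma * lambda <= t -> derive1 rho t = 0) ->
        derive1 rho t @[t --> 0^'+] --> lambda ->
        forall w, (forall j, betahat w j 0 != 0 ->
                     gamma * lambda < `|betahat w j 0|) ->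
        dfhat w = #|supp (betahat w)|%:R].
Proof.
move=> mu muhat dfhat Cp Cp_known Cp_estimated loss.
have [K Kc hK] := max_concavity_bound hkappa.
(* A minimizer is chosen for every data vector, since differentiation also visits data that no
   outcome need produce; by uniqueness [betahat] is [h] at the observed data. *)
have [h hmin] := choice (argmin_exists hn hp hlambda hrho Kc hK).
have [Pj [Ps Pi PX Ptr Pproj]] := orth_projector X.
have yE w : y w = mu + noise eps w by rewrite hy.
have bE w : betahat w = h (mu + noise eps w).
  rewrite -yE; exact: (argmin_unique hn hp hlambda hrho Kc hK (hbetahat w) (hmin _)).
have mtE : mutilde = fun w => mu + Pj *m noise eps w.
  by apply/funext => w; rewrite (Pproj _ _ (hmutilde w)) yE mulmxDr mulmxA PX.
have muhatE : muhat = fun w => X *m h (mu + noise eps w).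
  by apply/funext => w; rewrite /muhat bE.
have dfE : {ae P, forall w, dfhat w = divergence X h mu (noise eps w)}.
  have := ae_df_hat hsigma heps hn hp hlambda hrho Kc hK hmin mu.
  by apply: filterS => w <-; rewrite /dfhat bE.
have lossE : ('E_P[loss] = (mean eps (fun x => sqnorm (X *m h (mu + x) - mu)))%:E)%E.
  rewrite expectation.unlock -(meanE hsigma heps).
    by apply: eq_integral => w _; rewrite /loss muhatE.
  exact: (tame_loss hn hp hlambda hrho Kc hK hmin).
split.
- rewrite muhatE mtE.
  rewrite (degrees_of_freedom_fit hsigma heps hn hp hlambda hrho Kc hK hmin beta Ps PX).
  rewrite expectation.unlock -(meanE hsigma heps); last first.
    exact: (tame_divergence hn hp hlambda hrho Kc hK hmin).
  by apply: integral_ae_eq_any; apply: filterS dfE => w /= ->.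
- rewrite lossE -(mean_Cp_known hsigma heps hn hp hlambda hrho Kc hK hmin beta Ps Pi PX Ptr).
  rewrite expectation.unlock -(meanE hsigma heps).
    apply: integral_ae_eq_any; apply: filterS dfE => w /= wE.
    by rewrite /Cp_known /Cp /Cp_hat wE mtE muhatE.
  by apply: (tame_Cp hn hp hlambda hrho Kc hK hmin); exact: tame_cst.
- move=> pn rX.
  rewrite lossE -(mean_Cp_estimated hsigma heps hn hp hlambda hrho Kc hK hmin beta Ps Pi PX Ptr pn rX).
  rewrite expectation.unlock -(meanE hsigma heps).
    apply: integral_ae_eq_any; apply: filterS dfE => w /= wE.
    by rewrite /Cp_estimated /Cp /Cp_hat wE mtE muhatE yE.
  apply: (tame_Cp hn hp hlambda hrho Kc hK hmin).
  under eq_fun do rewrite mulrC; apply: tameZ; apply: tame_sqnorm => i.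
  have NE (x : 'cV[R]_n) : mu + x - (mu + Pj *m x) = (1%:M - Pj) *m x.
    by rewrite opprD addrACA subrr add0r mulmxBl mul1mx.
  by under eq_fun do rewrite NE; exact: tame_mulmx.
- move=> rholin w.
  have dr t : 0 < t -> derive1 rho t = lambda.
    move=> t0; rewrite derive1E (near_eq_derive (g := fun t : R => lambda * t)).
      have dl : is_derive t (1 : R) (fun t : R => lambda * t) lambda.
        by apply: is_derive_eq; rewrite [_ *: 1]mulr1.
      by rewrite derive_val.
    near=> u; apply: rholin; apply: ltW; near: u; exact: lt_nbhsr.
  have K0 : 0 <= K.
    by apply: (max_concavity_flat hK ltr01 (ltr1n _ 2)); rewrite !dr.
  apply: (df_hat_flat Kc (gram_ge X hp)) => // k bk.
  have b0 : 0 < `|betahat w k 0| by rewrite normr_gt0.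
  (* The derivative of the penalty is constant near the active value, and there the chosen [ddrho]
     is exactly 0. *)
  apply: (penalty_ddrho_flat hrho b0); near=> u; rewrite !dr//.
  near: u; exact: lt_nbhsr.
- move=> gamma flat0 _ w big.
  have K0 : 0 <= K.
    (* The maximum with 1 gives a positive point whatever the sign of [gamma]. *)
    pose t1 := Num.max 1 (gamma * lambda).
    have t10 : 0 < t1 by rewrite lt_max ltr01.
    have gt1 : gamma * lambda <= t1 by rewrite le_max lexx orbT.
    apply: (max_concavity_flat hK t10 (_ : t1 < t1 + 1)); rewrite ?ltrDl// !flat0//.
    by rewrite (le_trans gt1)// lerDl.
  apply: (df_hat_flat Kc (gram_ge X hp)) => // k bk.
  have b0 : 0 < `|betahat w k 0| by rewrite normr_gt0.
  (* The strict inequality in [big] leaves a whole neighbourhood of the active value in the flat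
     region. *)
  apply: (penalty_ddrho_flat hrho b0); near=> u; rewrite !flat0// ?ltW ?big//.
  near: u; exact: lt_nbhsr (big k bk).
Unshelve. all: by end_near. Qed.
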